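(* Let $1\le k\le n$ be integers and let $K\subseteq\mathbb{R}^n$ be a centrally symmetric convex body in John's position. Then, for any $k$-dimensional linear subspace $F$ of $\mathbb{R}^n$ and every $\lambda\ge0$, $$\mathcal{W}(\lambda(K\cap F))\le\mathcal{W}\left(\lambda\sqrt{\frac{n}{k}}\,B_\infty^k\right).$$
   Context: A convex body is a compact convex set with non-empty interior; centrally symmetric means $K=-K$. A convex body $K\subseteq\mathbb{R}^n$ is in John's position if the Euclidean unit ball $B_2^n$ is the maximal volume ellipsoid contained in $K$. $B_\infty^k=[-1,1]^k$. For a compact convex set $M\subseteq\mathbb{R}^n$, the quermassintegrals $W_i(M)$ are defined by $|M+tB_2^n|=\sum_{i=0}^n\binom{n}{i}W_i(M)t^i$ for all $t\ge0$, the intrinsic volumes by $V_i(M)=\binom{n}{i}W_{n-i}(M)/|B_2^{n-i}|$ (these do not depend on the Euclidean space in which $M$ is embedded; $|B_2^0|=1$), and the Wills functional by $\mathcal{W}(M)=\sum_{i=0}^nV_i(M)$. Equivalently, for a compact convex $M$ contained in a linear subspace $F$, $\mathcal{W}(M)=\int_Fe^{-\pi d(x,M)^2}dx$, where $d(x,M)$ is the Euclidean distance from $x$ to $M$. *)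

(* Defs.v *)
From HB Require Import structures.
From mathcomp Require Import all_boot all_order all_algebra.
From mathcomp Require Import all_classical all_reals all_analysis.
Set Implicit Arguments.
Unset Strict Implicit.
Unset Printing Implicit Defensive.
Import Order.TTheory GRing.Theory Num.Theory.
Import numFieldNormedType.Exports.
Local Open Scope classical_set_scope.
Local Open Scope ring_scope.

(* The library norm on 'rV[R]_n is the sup norm, hence this Euclidean one. *)
Definition enorm (R : realType) (n : nat) (x : 'rV[R]_n) : R :=
  Num.sqrt (\sum_(i < n) x ord0 i ^+ 2).

Definition euclidean_ball (R : realType) (n : nat) : set 'rV[R]_n :=
  [set x | enorm x <= 1].
Arguments euclidean_ball : clear implicits.

Definition linf_ball (R : realType) (k : nat) : set 'rV[R]_k :=
  [set x | forall i, `|x ord0 i| <= 1].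
Arguments linf_ball : clear implicits.

Definition dilate (R : realType) (n : nat) (t : R) (A : set 'rV[R]_n) :
  set 'rV[R]_n := [set t *: x | x in A].

Definition minkowski_sum (R : realType) (n : nat) (A B : set 'rV[R]_n) :
  set 'rV[R]_n := [set x + y | x in A & y in B].

(* n-dimensional Lebesgue measure, as an n-fold product measure: the successor
   case is what [lebesgue_measure \x volume m] unfolds to, with the first
   coordinate split off. It is the Lebesgue measure on Borel sets, and only
   compact sets are measured below. In dimension 0 it is the unit mass at the
   point, so that |B_2^0| = 1. *)
Fixpoint volume (R : realType) (n : nat) : set 'rV[R]_n -> \bar R :=
  match n return set 'rV[R]_n -> \bar R with
  | 0 => fun A => (\1_A (0 : 'rV[R]_0))%:E
  | m.+1 => fun A => (\int[lebesgue_measure]_x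
      volume [set v : 'rV[R]_m |
        A (row_mx (const_mx x : 'rV[R]_1) v : 'rV[R]_(1 + m))])%E
  end.

Definition convex_body (R : realType) (n : nat) (K : set 'rV[R]_n) : Prop :=
  [/\ compact K, convex_set (K : set (convex_lmodType 'rV[R]_n))
    & interior K !=set0].

Definition centrally_symmetric (R : realType) (n : nat) (K : set 'rV[R]_n) :
  Prop := K = [set - x | x in K].

Definition ellipsoid (R : realType) (n : nat) (E : set 'rV[R]_n) : Prop :=
  exists (A : 'M[R]_n) (c : 'rV[R]_n),
    A \in unitmx /\ E = [set c + x *m A | x in euclidean_ball R n].

(* A maximal volume ellipsoid of a convex body is unique, so attaining the
   maximum is all that is required of the unit ball. *)
Definition john_position (R : realType) (n : nat) (K : set 'rV[R]_n) : Prop :=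
  euclidean_ball R n `<=` K /\
  forall E : set 'rV[R]_n, ellipsoid E -> E `<=` K ->
    (volume E <= volume (euclidean_ball R n))%E.

Definition steiner_coefficients (R : realType) (n : nat) (M : set 'rV[R]_n)
    (w : {ffun 'I_n.+1 -> R}) : Prop :=
  forall t : R, 0 <= t ->
    volume (minkowski_sum M (dilate t (euclidean_ball R n))) =
    (\sum_(i < n.+1) 'C(n, i)%:R * w i * t ^+ i)%:E.

(* Steiner's formula provides the coefficients when M is compact convex (and
   then they are unique); the value 0 is junk for other sets M. *)
Definition quermassintegral (R : realType) (n : nat) (M : set 'rV[R]_n) :
  {ffun 'I_n.+1 -> R} := xget [ffun=> 0] [set w | steiner_coefficients M w].

(* [rev_ord i : 'I_n.+1] has value n - i. *)
Definition intrinsic_volume (R : realType) (n : nat) (M : set 'rV[R]_n)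
    (i : 'I_n.+1) : R :=
  'C(n, i)%:R * quermassintegral M (rev_ord i)
    / fine (volume (euclidean_ball R (n - i))).

Definition wills (R : realType) (n : nat) (M : set 'rV[R]_n) : R :=
  \sum_(i < n.+1) intrinsic_volume M i.

(* Main.v *)
From HB Require Import structures.
Require Import Defs.
From mathcomp Require Import all_boot all_order all_algebra.
From mathcomp Require Import all_classical all_reals all_analysis.
From mathcomp Require Import measurable_realfun complex spectral ring lra zify.
Import Order.TTheory GRing.Theory Num.Theory.
Import numFieldNormedType.Exports.
Set Implicit Arguments.
Unset Strict Implicit.
Unset Printing Implicit Defensive.
Local Open Scope classical_set_scope.
Local Open Scope ring_scope.

(** Integrating [2 pi t exp (- pi t ^ 2)] against the Steiner polynomial of [M]
turns the Wills functional into [int exp (- pi d(x, M) ^ 2) dx] over the whole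
space (layer cake formula, [wills_integral]): the factors [1 / |B_2^i|] of the
intrinsic volumes are the moments that appear. For a cube the distance splits
over the coordinates, so that [W (a * B_infty^k) = (1 + 2 a) ^ k]
([wills_cube]). It remains to bound the Gaussian integral for the section
[lambda * (K `&` F)]; a set without Steiner coefficients has value 0, which
satisfies the inequality at once.

Maximality of the ball yields contact points [u i] with weights [c i >= 0] and
[sum c_i u_i (x) u_i = Id] ([john_decomposition]): if [Id / n] were not in the
convex hull of the squares of contact points, the nearest point of the hull
would provide a traceless symmetric direction [H] along which the ball can be
deformed inside [K] with larger volume ([no_improving_direction]). By symmetry
[|<y, u_i>| <= 1] on [K].

Let [P] be the orthogonal projection onto [F]. The vectors [P u_i] with weights
[c_i] decompose [P], and the rows of [Id - P] decompose [Id - P]. After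
normalization this is a family of unit vectors [v_i] with weights [w_i] (zero
vectors get weight 0),
[sum w_i v_i (x) v_i = Id]. For [y] in [K] and in [F], the point [lambda y] has
coordinate at most [a_i = lambda / |P u_i|] in modulus in the directions of the first kind
and [0 = a_i] in the others, hence
[|x - lambda y| ^ 2 >= sum w_i d(<x, v_i>, [-a_i, a_i]) ^ 2]
([projected_distance]). The integrand is therefore at most
[prod f_i (<x, v_i>) ^ w_i] where [f_i t = exp (- pi d(t, [-a_i, a_i]) ^ 2)] has
integral [1 + 2 a_i], and the Brascamp-Lieb inequality bounds the integral by
[prod (1 + 2 a_i) ^ w_i]. The weights of the first kind add up to
[tr P = k], and [sum w_i a_i = lambda sum c_i |P u_i| <= lambda sqrt (n k)], so
concavity of the logarithm gives [(1 + 2 lambda sqrt (n / k)) ^ k]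
([sum_log_bound]).

The Brascamp-Lieb inequality for a decomposition of the identity
([brascamp_lieb]) follows the transport argument of Barthe. If [T_i] transports
[f_i] to the Gaussian density, the map [x |-> sum w_i T_i (<x, v_i>) v_i] is
injective, its Jacobian [det (sum w_i T_i' v_i (x) v_i)] is at least
[prod T_i' ^ w_i] ([ln_det_ge]), and its image [z] satisfies
[|z| ^ 2 <= sum w_i T_i ^ 2] ([dot_sum_le]). Here [T_i] is replaced by a
piecewise linear interpolation, at the cost of a factor [exp kappa] with
[kappa > 0] arbitrarily small: then the map is affine on each cell of a finite
partition of a slab, and the affine change of variables formula, obtained by
elimination from the translation and scaling invariance of Lebesgue measure on
the line, is the only one that is used. *)

(** * Lebesgue measure on row vectors *)

Section coordinates.
Context {R : realType}.

Definition coord_sets n : set (set 'rV[R]_n) :=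
  [set A | exists (i : 'I_n) (B : set R),
     measurable (B : set (measurableTypeR R)) /\ A = (fun x : 'rV[R]_n => x ord0 i) @^-1` B].

(** Row vectors with the sigma-algebra generated by the coordinates. It
contains the open sets, and [volume] is a measure on it. *)
Definition rvs n := g_sigma_algebraType (@coord_sets n).

Lemma measurable_coord n (i : 'I_n) :
  measurable_fun [set: rvs n] (fun x : rvs n => (x : 'rV[R]_n) ord0 i).
Proof.
move=> _ B mB; rewrite setTI; apply: sub_sigma_algebra.
by exists i, B.
Qed.

Lemma measurable_fun_rvsP d (T : measurableType d) n (f : T -> rvs n) :
  (forall i, measurable_fun setT (fun t => (f t : 'rV[R]_n) ord0 i)) ->
  measurable_fun setT f.
Proof.
move=> mf; have := @measurability _ _ T (rvs n) setT f (@coord_sets n) erefl; apply.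
move=> _ [_ [i [B [mB ->]]] <-].
exact: mf.
Qed.

(** The splitting of the first coordinate used by [volume]. *)
Definition rcons_rv m (p : measurableTypeR R * rvs m) : rvs m.+1 :=
  row_mx (const_mx p.1 : 'rV[R]_1) (p.2 : 'rV[R]_m).

Definition runcons m (x : rvs m.+1) : measurableTypeR R * rvs m :=
  ((lsubmx (x : 'rV[R]_(1 + m))) ord0 ord0, rsubmx (x : 'rV[R]_(1 + m))).

Lemma rcons_rv0 m p : (@rcons_rv m p : 'rV[R]_m.+1) ord0 ord0 = p.1.
Proof.
have -> : (ord0 : 'I_m.+1) = lshift m (ord0 : 'I_1) by exact/val_inj.
by rewrite /rcons_rv (row_mxEl (const_mx p.1 : 'rV[R]_1)) mxE.
Qed.

Lemma rcons_rvS m p (i : 'I_m) :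
  (@rcons_rv m p : 'rV[R]_m.+1) ord0 (lift ord0 i) = (p.2 : 'rV[R]_m) ord0 i.
Proof.
have -> : lift ord0 i = rshift 1 i by exact/val_inj.
by rewrite /rcons_rv (row_mxEr (const_mx p.1 : 'rV[R]_1)).
Qed.

Lemma rconsK m : cancel (@rcons_rv m) (@runcons m).
Proof.
by case=> a v; rewrite /rcons_rv /runcons /= row_mxKl row_mxKr mxE.
Qed.

Lemma runconsK m : cancel (@runcons m) (@rcons_rv m).
Proof.
move=> x; rewrite /rcons_rv /runcons /= -[RHS](@hsubmxK _ 1 1 m x).
set l := lsubmx _; rewrite (_ : const_mx (l ord0 ord0) = l) //.
by apply/matrixP => i j; rewrite !mxE !ord1.
Qed.

Lemma measurable_rcons m : measurable_fun setT (@rcons_rv m).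
Proof.
apply: measurable_fun_rvsP => i.
case: (unliftP ord0 i) => [j ->|->].
- under eq_fun do rewrite rcons_rvS.
  exact: (measurableT_comp (measurable_coord j) measurable_snd).
- under eq_fun do rewrite rcons_rv0.
  exact: measurable_fst.
Qed.

Lemma measurable_runcons m : measurable_fun setT (@runcons m).
Proof.
apply/measurable_fun_pairP; split.
- have := @measurable_coord m.+1 ord0; congr measurable_fun.
  apply/funext => x /=; rewrite mxE; congr (_ _ _).
  exact/val_inj.
- apply: measurable_fun_rvsP => i.
  have := @measurable_coord m.+1 (lift ord0 i); congr measurable_fun.
  apply/funext => x /=; rewrite mxE; congr (_ _ _).
  exact/val_inj.
Qed.

Section lift_measure.
Variables (m : nat) (mu : {sigma_finite_measure set (rvs m) -> \bar R}).

(** The image of a product measure under [rcons_rv]; it carries a step of the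
recursion of [volume] over to measures. *)
Definition consmeas : set (rvs m.+1) -> \bar R :=
  fun A => (@lebesgue_measure R \x mu)%E (@rcons_rv m @^-1` A).

Let preimage_rcons (A : set (rvs m.+1)) :
  measurable A -> measurable (@rcons_rv m @^-1` A).
Proof. by move=> mA; rewrite -[X in measurable X]setTI; exact: measurable_rcons. Qed.

Let consmeas0 : consmeas set0 = 0%E.
Proof. by rewrite /consmeas preimage_set0 measure0. Qed.

Let consmeas_ge0 A : (0 <= consmeas A)%E.
Proof. exact: measure_ge0. Qed.

Let consmeas_sigma_additive : semi_sigma_additive consmeas.
Proof.
move=> F mF tF mUF; rewrite /consmeas preimage_bigcup.
apply: measure_semi_sigma_additive.
- by move=> i; exact: preimage_rcons.
- apply/trivIsetP => /= i j _ _ ij; rewrite -preimage_setI.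
  by move/trivIsetP : tF => /(_ _ _ _ _ ij) ->//; rewrite preimage_set0.
- by rewrite -preimage_bigcup; exact: preimage_rcons.
Qed.

HB.instance Definition _ := isMeasure.Build _ _ _ consmeas
  consmeas0 consmeas_ge0 consmeas_sigma_additive.

Let consmeas_sigma_finite : sigma_finite setT consmeas.
Proof.
have /sigma_finiteP[F [TF ndF Foo]] := sigma_finiteT (@lebesgue_measure R).
have /sigma_finiteP[G [TG ndG Goo]] := sigma_finiteT mu.
exists (fun n => @runcons m @^-1` (F n `*` G n)).
  apply/esym; rewrite -subTset => x _.
  have [i _ Fi] : (\bigcup_i F i) (runcons x).1 by rewrite -TF.
  have [j _ Gj] : (\bigcup_i G i) (runcons x).2 by rewrite -TG.
  exists (maxn i j) => //; split.
    by move: Fi; apply/subsetPset/ndF/leq_maxl.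
  by move: Gj; apply/subsetPset/ndG/leq_maxr.
move=> k; have [mF Fk] := Foo k; have [mG Gk] := Goo k; split.
  by rewrite -[X in measurable X]setTI; apply: measurable_runcons => //; exact: measurableX.
rewrite /consmeas -comp_preimage (_ : _ \o _ = id).
  by rewrite product_measure1E// lte_mul_pinfty// ge0_fin_numE.
by apply/funext => p /=; exact: rconsK.
Qed.

HB.instance Definition _ := Measure_isSigmaFinite.Build _ _ _ consmeas
  consmeas_sigma_finite.

End lift_measure.

Fixpoint vmeas n : {sigma_finite_measure set (rvs n) -> \bar R} :=
  match n with
  | 0 => @dirac _ (rvs 0) (0 : 'rV[R]_0) R
  | m.+1 => consmeas (vmeas m)
  end.

(** Both sides are the same iterated integral of sections, for every set: this is
what makes measure theory applicable to [volume]. *)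
Lemma volumeE n (A : set 'rV[R]_n) : volume A = vmeas n A.
Proof.
elim: n A => [|n IH] A //=.
rewrite /consmeas /= /product_measure1; apply: eq_integral => x _ /=.
rewrite IH; congr (vmeas n _); apply/seteqP; split => v /=; rewrite /xsection /= inE //.
Qed.

Section iterated.
Variables (m : nat) (f : rvs m.+1 -> \bar R).
Hypothesis mf : measurable_fun setT f.
Hypothesis f0 : forall x, (0 <= f x)%E.

Lemma vmeas_tonelli :
  (\int[vmeas m.+1]_x f x =
   \int[@lebesgue_measure R]_a \int[vmeas m]_v f (rcons_rv (a, v)))%E.
Proof.
transitivity (\int[@lebesgue_measure R \x vmeas m]_p f (rcons_rv p))%E.
  have := @ge0_integral_pushforward _ _ _ _ R (@rcons_rv m) (@measurable_rcons m)
    (@lebesgue_measure R \x vmeas m)%E setT f measurableT mf.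
  rewrite preimage_setT; apply => // *; exact: f0.
rewrite fubini_tonelli1 //.
exact: measurableT_comp (@measurable_rcons m).
Qed.

Lemma vmeas_tonelli_swap :
  (\int[vmeas m.+1]_x f x =
   \int[vmeas m]_v \int[@lebesgue_measure R]_a f (rcons_rv (a, v)))%E.
Proof.
rewrite vmeas_tonelli.
apply: (@fubini_tonelli _ _ _ _ _ (@lebesgue_measure R) (vmeas m) (f \o @rcons_rv m)).
  exact: measurableT_comp (@measurable_rcons m).
by move=> p; exact: f0.
Qed.

Lemma measurable_vmeas_inner :
  measurable_fun setT (fun a => \int[vmeas m]_v f (rcons_rv (a, v)))%E.
Proof.
apply: (@measurable_fun_fubini_tonelli_F _ _ _ _ _ (vmeas m) (f \o @rcons_rv m)).
  exact: measurableT_comp (@measurable_rcons m).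
by move=> p; exact: f0.
Qed.

End iterated.
End coordinates.

(** * Affine changes of variables *)

Section line.
Context {R : realType}.
Local Notation leb := (@lebesgue_measure R).
Implicit Types f : measurableTypeR R -> \bar R.

Let measurable_shift (b : R) :
  measurable_fun setT (fun x : measurableTypeR R => x + b : measurableTypeR R).
Proof. exact: measurable_funD. Qed.

(** Translated and original Lebesgue measure agree on half-open intervals,
hence everywhere by uniqueness of Lebesgue measure. *)
Lemma ge0_integral_leb_shift b f : measurable_fun setT f -> (forall x, (0 <= f x)%E) ->
  (\int[leb]_x f (x + b)%R = \int[leb]_x f x)%E.
Proof.
move=> mf f0.
have := @ge0_integral_pushforward _ _ _ _ R _ (measurable_shift b) leb setT f measurableT mf (fun x _ => f0 x).
rewrite preimage_setT => <-.
apply: eq_measure_integral => A mA _ /=.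
apply/esym; apply: lebesgue_measure_unique => //= _ [[s t]] _ <-.
rewrite /pushforward (_ : _ @^-1` _ = `]s - b, t - b]%classic); last first.
  by apply/seteqP; split => x /=; rewrite !in_itv /=; lra.
by rewrite !lebesgue_measure_itv /= !lte_fin ltrD2r; case: ifP => // _; rewrite -!EFinB; congr EFin; ring.
Qed.

Let measurable_oppr :
  measurable_fun setT (-%R : measurableTypeR R -> measurableTypeR R).
Proof. exact: oppr_measurable. Qed.

Lemma ge0_integral_leb_opp f : measurable_fun setT f -> (forall x, (0 <= f x)%E) ->
  (\int[leb]_x f (- x)%R = \int[leb]_x f x)%E.
Proof.
move=> mf f0.
have := @ge0_integral_pushforward _ _ _ _ R _ measurable_oppr leb setT f measurableT mf (fun x _ => f0 x).
rewrite preimage_setT => <-.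
apply: eq_measure_integral => A mA _ /=.
exact: lebesgue_measureN.
Qed.

Let measurable_scale (a : R) :
  measurable_fun setT (fun x : measurableTypeR R => a * x : measurableTypeR R).
Proof. exact: measurable_funM. Qed.

Lemma ge0_integral_leb_scale (a : R) f : a != 0 -> measurable_fun setT f -> (forall x, (0 <= f x)%E) ->
  (`|a|%:E * \int[leb]_x f (a * x)%R = \int[leb]_x f x)%E.
Proof.
move=> a0 mf f0.
wlog {a0} a0 : a f mf f0 / 0 < a => [H|].
  have [|an|a00] := ltrgtP a 0; last by rewrite a00 eqxx in a0.
  - move=> an; rewrite -[RHS](ge0_integral_leb_opp mf f0).
    rewrite -[RHS](H (- a) (fun x => f (- x))) ?oppr_gt0 //; last first.
      exact: (measurableT_comp mf).
    by rewrite normrN; under [in RHS]eq_integral do rewrite mulNr opprK.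
  - exact: H.
rewrite gtr0_norm //.
have := @ge0_integral_pushforward _ _ _ _ R _ (measurable_scale a) leb setT f measurableT mf (fun x _ => f0 x).
rewrite preimage_setT => <-.
have k0 : (0 <= a)%R by exact: ltW.
rewrite -(@ge0_integral_mscale _ _ R (pushforward leb _) setT measurableT (NngNum k0)) //.
apply: eq_measure_integral => A mA _ /=.
apply/esym; apply: lebesgue_measure_unique => //= _ [[s t]] _ <-.
rewrite -[RHS]/(a%:E * leb ((fun x : R => a * x)%R @^-1` `]s, t]))%E (_ : _ @^-1` _ = `]s / a, t / a]%classic); last first.
  by apply/seteqP; split => x /=; rewrite !in_itv /= ltr_pdivrMr// ler_pdivlMr// ![x * a]mulrC.
rewrite !lebesgue_measure_itv /= !lte_fin ltr_pM2r ?invr_gt0//; case: ifP => _; last by rewrite mule0.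
by rewrite -!EFinB -EFinM; congr EFin; field; rewrite gt_eqF.
Qed.

End line.

Section space.
Context {R : realType}.
Local Notation leb := (@lebesgue_measure R).

Lemma measurable_affine m n (A : 'M[R]_(m, n)) (b : 'rV[R]_n) :
  measurable_fun setT (fun x : rvs m => (x *m A + b : 'rV[R]_n) : rvs n).
Proof.
apply: measurable_fun_rvsP => j.
under eq_fun do rewrite mxE mxE.
apply: measurable_funD => //; apply: measurable_sum => i.
by apply: measurable_funM => //; exact: measurable_coord.
Qed.

Lemma measurable_shift_rv n (b : 'rV[R]_n) :
  measurable_fun setT (fun x : rvs n => (x + b : 'rV[R]_n) : rvs n).
Proof.
by have := measurable_affine (1%:M : 'M[R]_n) b; under eq_fun do rewrite mulmx1.
Qed.

Lemma measurable_linear m n (A : 'M[R]_(m, n)) :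
  measurable_fun setT (fun x : rvs m => (x *m A : 'rV[R]_n) : rvs n).
Proof.
by have := measurable_affine A 0; under eq_fun do rewrite addr0.
Qed.

Lemma integral_vmeas0 (f : rvs 0 -> \bar R) : measurable_fun setT f ->
  (\int[vmeas 0]_x f x = f (0%R : 'rV[R]_0))%E.
Proof. by move=> mf; rewrite integral_dirac // diracT mul1e. Qed.

Lemma rcons_rvD m a (v : 'rV[R]_m) b (w : 'rV[R]_m) :
  rcons_rv (a, v) + rcons_rv (b, w) = rcons_rv (a + b, v + w) :> 'rV[R]_m.+1.
Proof.
apply/rowP => i; rewrite mxE; case: (unliftP ord0 i) => [j ->|->].
  by rewrite !rcons_rvS mxE.
by rewrite !rcons_rv0.
Qed.

Lemma measurable_rcons_snd m (f : rvs m.+1 -> \bar R) (a : R) :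
  measurable_fun setT f -> measurable_fun setT (fun v => f (rcons_rv (a, v))).
Proof.
move=> mf; apply: (measurableT_comp mf).
apply: (measurableT_comp (@measurable_rcons R m)).
exact: measurable_pair1.
Qed.

Lemma measurable_rcons_fst m (f : rvs m.+1 -> \bar R) (v : rvs m) :
  measurable_fun setT f ->
  measurable_fun setT (fun a : measurableTypeR R => f (rcons_rv (a, v))).
Proof.
move=> mf; apply: (measurableT_comp mf).
apply: (measurableT_comp (@measurable_rcons R m)).
exact: measurable_pair2.
Qed.

Lemma ge0_integral_vmeas_shift n (b : 'rV[R]_n) (f : rvs n -> \bar R) :
  measurable_fun setT f -> (forall x, (0 <= f x)%E) ->
  (\int[vmeas n]_x f ((x : 'rV[R]_n) + b)%R = \int[vmeas n]_x f x)%E.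
Proof.
elim: n b f => [|n IH] b f mf f0.
  rewrite !integral_vmeas0 //; first by congr f; apply/rowP; case.
  exact: (measurableT_comp mf (measurable_shift_rv b)).
rewrite [LHS]vmeas_tonelli //; last exact: (measurableT_comp mf (measurable_shift_rv b)).
rewrite vmeas_tonelli //.
have -> : b = rcons_rv (runcons b) by rewrite runconsK.
move: (runcons b) => [c w].
transitivity (\int[leb]_a \int[vmeas n]_v f (rcons_rv ((a + c)%R, v)))%E.
  apply: eq_integral => a _.
  under eq_integral do rewrite rcons_rvD.
  by apply: (IH w (fun v => f (rcons_rv (a + c, v)))) => //; exact: measurable_rcons_snd.
apply: (ge0_integral_leb_shift c (f := fun a => \int[vmeas n]_v f (rcons_rv (a, v)))%E).
  exact: measurable_vmeas_inner.
by move=> x; exact: integral_ge0.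
Qed.

(** The change of variables formula as a property of the matrix, so that it
can be propagated along products of elementary matrices. *)
Definition scales_volume n (A : 'M[R]_n) := forall f : rvs n -> \bar R,
  measurable_fun setT f -> (forall x, (0 <= f x)%E) ->
  (`|\det A|%:E * \int[vmeas n]_x f ((x : 'rV[R]_n) *m A)%R = \int[vmeas n]_x f x)%E.

Lemma scales_volumeM n (A B : 'M[R]_n) :
  scales_volume A -> scales_volume B -> scales_volume (A *m B).
Proof.
move=> hA hB f mf f0.
rewrite det_mulmx normrM mulrC EFinM -muleA -[RHS]hB//; congr (_ * _)%E.
rewrite -[RHS](hA (fun x => f ((x : 'rV[R]_n) *m B))) //.
  by under eq_integral do rewrite mulmxA.
exact: (measurableT_comp mf (measurable_linear B)).
Qed.

(** For fixed last coordinates this shear is a translation of the first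
coordinate; hence the first coordinate is integrated first. *)
Lemma scales_volume_lower n (c : 'cV[R]_n) :
  scales_volume (block_mx 1%:M 0 c 1%:M : 'M[R]_(1 + n)).
Proof.
move=> f mf f0.
rewrite det_lblock !det1 mulr1 normr1 mul1e.
rewrite vmeas_tonelli_swap //; last exact: (measurableT_comp mf (measurable_linear _)).
rewrite [RHS]vmeas_tonelli_swap //; apply: eq_integral => v _.
rewrite -[RHS](ge0_integral_leb_shift ((v *m c : 'M[R]_1) ord0 ord0)) //; last first.
  exact: measurable_rcons_fst.
apply: eq_integral => a _; congr f; rewrite /rcons_rv /= mul_row_block !mulmx1 mulmx0 add0r.
by congr row_mx; apply/rowP => i; rewrite !ord1 !mxE.
Qed.

(** For a fixed first coordinate this is the map [S] followed by a
translation; then the first coordinate is scaled by [a]. *)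
Lemma scales_volume_upper n (a : R) (b : 'rV[R]_n) (S : 'M[R]_n) :
  a != 0 -> scales_volume S ->
  scales_volume (block_mx a%:M b 0 S : 'M[R]_(1 + n)).
Proof.
move=> a0 hS f mf f0.
rewrite det_ublock det_scalar1 normrM EFinM -muleA.
rewrite vmeas_tonelli //; last exact: (measurableT_comp mf (measurable_linear _)).
rewrite [RHS]vmeas_tonelli //.
rewrite -[RHS](ge0_integral_leb_scale a0); last 2 first.
- exact: measurable_vmeas_inner.
- by move=> x; exact: integral_ge0.
congr (_ * _)%E; rewrite -ge0_integralZl //; last 2 first.
- apply: (@measurable_vmeas_inner _ _ (fun x : rvs n.+1 => f ((x : 'rV[R]_(1 + n)) *m block_mx a%:M b 0 S))) => //.
  exact: (measurableT_comp mf (measurable_linear _)).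
- by move=> *; exact: integral_ge0.
apply: eq_integral => x _.
rewrite -[RHS](ge0_integral_vmeas_shift (x *: b)) //; last exact: measurable_rcons_snd.
rewrite -[RHS]hS //; last first.
  exact: (measurableT_comp (measurable_rcons_snd _ mf) (measurable_shift_rv _)).
congr (_ * _)%E; apply: eq_integral => v _; congr f.
rewrite /rcons_rv /= mul_row_block mulmx0 addr0.
congr row_mx; first by apply/rowP => i; rewrite !ord1 !mxE big_ord1 !mxE eqxx mulr1n mulrC.
rewrite addrC; congr (_ + _); apply/rowP => i.
by rewrite !mxE big_ord1 !mxE.
Qed.

(** Block Gaussian elimination on the upper left entry. If that entry is 0, a
shear that adds a row with nonzero first entry makes it nonzero. *)
Lemma scales_volume_unitmx n (A : 'M[R]_n) : A \in unitmx -> scales_volume A.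
Proof.
elim: n A => [|n IH] A uA.
  move=> f mf f0; rewrite det_mx00 normr1 mul1e !integral_vmeas0 //.
    by congr f; apply/rowP; case.
  exact: (measurableT_comp mf (measurable_linear _)).
have pivot (B : 'M[R]_(1 + n)) : B \in unitmx -> ulsubmx B ord0 ord0 != 0 ->
    scales_volume B.
  move=> uB; set a := ulsubmx B ord0 ord0 => a0.
  have ulE : ulsubmx B = a%:M by apply/matrixP => i j; rewrite !ord1 [RHS]mxE eqxx mulr1n.
  have BE : B = block_mx 1%:M 0 (a^-1 *: dlsubmx B) 1%:M *m
      block_mx a%:M (ursubmx B) 0 (drsubmx B - a^-1 *: dlsubmx B *m ursubmx B).
    rewrite mulmx_block !mul1mx !mul0mx !addr0 -ulE.
    rewrite addrC subrK -[LHS]submxK; congr block_mx.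
    by rewrite ulE -scalemxAl mul_mx_scalar scalerA mulVf ?scale1r.
  move: BE; set S := drsubmx B - _ => BE.
  have uS : S \in unitmx.
    move: uB; rewrite BE unitmx_mul => /andP[_].
    by rewrite !unitmxE det_ublock unitrM => /andP[].
  rewrite BE; apply: scales_volumeM; first exact: scales_volume_lower.
  by apply: scales_volume_upper => //; exact: IH.
have [A0|A0] := eqVneq (ulsubmx (A : 'M[R]_(1 + n)) ord0 ord0) 0; last exact: (pivot A).
have [j Aj] : exists j, dlsubmx (A : 'M[R]_(1 + n)) j ord0 != 0.
  apply/existsP; rewrite -[X in is_true X]negbK negb_exists; apply/negP => /forallP dl0.
  have : row ord0 (A^T) = 0.
    apply/rowP => k; rewrite !mxE.
    case: (unliftP ord0 k) => [l ->|->].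
      move: (dl0 l); rewrite negbK => /eqP; rewrite !mxE => <-.
      by congr (A _ _); exact/val_inj.
    rewrite -A0 !mxE; by congr (A _ _); exact/val_inj.
  move=> /(congr1 (mulmx^~ (invmx A^T))); rewrite -row_mul mulmxV ?unitmx_tr // mul0mx.
  move=> /rowP /(_ ord0); rewrite !mxE eqxx => /eqP; by rewrite oner_eq0.
(* Left multiplication by the unipotent matrix with first row [row_mx 1 r]
   adds row [j] of the lower block to the first row. *)
pose r : 'rV[R]_n := delta_mx ord0 j.
have -> : A = block_mx 1%:M (- r) 0 1%:M *m (block_mx 1%:M r 0 1%:M *m (A : 'M[R]_(1 + n))).
  rewrite mulmxA mulmx_block !mul1mx !mulmx1 !mulmx0 !mul0mx !addr0 subrr.
  by rewrite add0r -scalar_mx_block mul1mx.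
have uU (s : 'rV[R]_n) : block_mx 1%:M s 0 1%:M \in unitmx.
  by rewrite unitmxE det_ublock !det1 mulr1 unitr1.
apply: scales_volumeM.
  apply: scales_volume_upper; first exact: oner_neq0.
  by apply: IH; exact: unitmx1.
apply: pivot; first by rewrite unitmx_mul uU.
rewrite -[A in _ *m A](@submxK _ 1 n 1 n) mulmx_block block_mxKul !mul1mx mxE A0 add0r.
rewrite mxE (bigD1 j) //= big1 => [|i ij]; first by rewrite mxE !eqxx mul1r addr0.
by rewrite mxE (negPf ij) andbF mul0r.
Qed.

Lemma ge0_integral_vmeas_affine n (A : 'M[R]_n) (b : 'rV[R]_n) (f : rvs n -> \bar R) :
  A \in unitmx -> measurable_fun setT f -> (forall x, (0 <= f x)%E) ->
  (`|\det A|%:E * \int[vmeas n]_x f ((x : 'rV[R]_n) *m A + b)%R = \int[vmeas n]_x f x)%E.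
Proof.
move=> uA mf f0.
rewrite (scales_volume_unitmx uA (f := fun x : rvs n => f ((x : 'rV[R]_n) + b))) //.
  exact: ge0_integral_vmeas_shift.
exact: (measurableT_comp mf (measurable_shift_rv b)).
Qed.

End space.

(** * Measurability of open sets *)

Section space.
Context {R : realType}.

(** An open set is the union of the boxes with rational centre and radius
[1 / p] that it contains, and there are countably many of these. *)
Lemma open_measurable_rvs n (U : set 'rV[R]_n) :
  open U -> measurable (U : set (rvs n)).
Proof.
move=> oU.
pose box (qp : 'rV[rat]_n * nat) : set 'rV[R]_n :=
  [set x | forall i, `|x ord0 i - ratr (qp.1 ord0 i)| < qp.2.+1%:R^-1].
have mbox qp : measurable (box qp : set (rvs n)).
  rewrite (_ : box qp = \bigcap_(i in [set: 'I_n])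
    (fun x : 'rV[R]_n => x ord0 i) @^-1` ball (ratr (qp.1 ord0 i) : R) qp.2.+1%:R^-1).
    apply: fin_bigcap_measurable; first exact: finite_finset.
    move=> i _; rewrite -[X in measurable X]setTI.
    by apply: measurable_coord => //; exact: measurable_ball.
  by apply/seteqP; split => x /= H i; [move=> _|]; rewrite /ball /= distrC; exact: H.
pose F k : set 'rV[R]_n :=
  if unpickle k is Some qp then (if `[< box qp `<=` U >] then box qp else set0) else set0.
have -> : U = \bigcup_k F k.
  apply/seteqP; split => x.
    move=> Ux; have /nbhs_ballP[e /= e0 xeU] : nbhs x U by exact: open_nbhs_nbhs.
    have [p pe] : exists p : nat, 2 * p.+1%:R^-1 <= e.
      exists (Num.truncn (2 / e)).
      have := Num.Theory.truncnS_gt (2 / e).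
      by rewrite ltr_pdivrMr // => /ltW h; rewrite ler_pdivrMr // mulrC.
    pose q : 'rV[rat]_n := \row_i
      xget 0 [set q : rat | `|x ord0 i - ratr q| < p.+1%:R^-1].
    have qP i : `|x ord0 i - ratr (q ord0 i)| < p.+1%:R^-1.
      rewrite mxE; case: xgetP => [y _ //|].
      have /rat_in_itvoo[r] : x ord0 i - p.+1%:R^-1 < x ord0 i + p.+1%:R^-1.
        by rewrite ltrD2l; apply: (@lt_trans _ _ 0); rewrite ?oppr_lt0 invr_gt0.
      rewrite in_itv /= => /andP[h1 h2] /(_ r) /=; case.
      move: (p.+1%:R^-1) (ratr r) (x ord0 i) h1 h2 => c d z h1 h2.
      by rewrite ltr_norml; apply/andP; split; lra.
    exists (pickle (q, p)) => //; rewrite /F pickleK.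
    have -> : `[< box (q, p) `<=` U >] = true.
      apply/asboolP => y /= yb; apply: xeU; split => // i j; rewrite !ord1.
      rewrite /ball /=; apply: lt_le_trans pe.
      rewrite (_ : x _ _ - y _ _ = (x ord0 j - ratr (q ord0 j)) - (y ord0 j - ratr (q ord0 j))); last by ring.
      apply: le_lt_trans (ler_normB _ _) _; rewrite mulr2n mulrDl !mul1r.
      by apply: ltrD; [exact: qP|exact: yb].
    exact: qP.
  by case=> k _; rewrite /F; case: unpickle => //= qp; case: asboolP => // sU /sU.
apply: bigcupT_measurable => k; rewrite /F.
by case: unpickle => // qp; case: asboolP.
Qed.

Lemma measurable_sublevel n (rho : 'rV[R]_n -> R) :
  (forall t, open [set x | rho x < t]) ->
  measurable_fun setT (rho : rvs n -> measurableTypeR R).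
Proof.
move=> orho; have := @measurability _ _ (rvs n) (measurableTypeR R) setT rho _ (RGenInftyO.measurableE R).
apply.
move=> _ [_ [t ->] <-]; rewrite setTI.
rewrite (_ : _ @^-1` _ = [set x | rho x < t]); first exact: open_measurable_rvs.
by apply/seteqP; split => x /=; rewrite in_itv.
Qed.

End space.

(** * Gaussian functions of the distance to an interval *)

Section distance_to_interval.
Context {R : realType}.
Local Notation leb := (@lebesgue_measure R).

Definition itv_dist (a x : R) : R := Num.max (`|x| - a) 0.

Lemma itv_dist_ge0 a x : 0 <= itv_dist a x.
Proof. by rewrite /itv_dist le_max lexx orbT. Qed.

Lemma itv_dist0 x : itv_dist 0 x = `|x|.
Proof. by rewrite /itv_dist subr0 max_l. Qed.

Lemma itv_dist_le a x s : 0 <= s -> (itv_dist a x <= s) = (`|x| <= a + s).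
Proof. by move=> s0; rewrite /itv_dist ge_max s0 andbT lerBlDl. Qed.

Lemma itv_dist_continuous a : continuous (itv_dist a).
Proof.
move=> x; apply: (@continuous_max R R (fun x => `|x| - a) (fun=> 0)); last exact: cvg_cst.
by apply: cvgB; [exact: norm_continuous|exact: cvg_cst].
Qed.

Lemma measurable_itv_dist a : measurable_fun setT (itv_dist a : measurableTypeR R -> measurableTypeR R).
Proof. by apply: continuous_measurable_fun; exact: itv_dist_continuous. Qed.

Local Open Scope ereal_scope.

Lemma ge0_integral_norm (g : measurableTypeR R -> \bar R) :
  measurable_fun setT g -> (forall x, 0 <= g x) ->
  \int[leb]_x g `|x|%R = 2%:E * \int[leb]_(x in `[0%R, +oo[) g x.
Proof.
move=> mg g0.
have mh : measurable_fun setT (fun x : R => g `|x|%R).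
  by apply: (measurableT_comp mg); exact: normr_measurable.
rewrite -[in LHS](setUv [set` `[0%R, +oo[]) ge0_integral_setU//=; last 3 first.
- exact: measurableC.
- by rewrite setUv.
- exact/disj_setPCl.
rewrite mule_natl mule2n; congr +%E.
  by apply: eq_integral => x; rewrite inE /= in_itv /= andbT => x0; rewrite ger0_norm.
rewrite setCitvr integral_itv_bndo_bndc; last exact: measurable_funTS.
rewrite ge0_integration_by_substitution0//.
by apply: eq_integral => x; rewrite inE /= in_itv /= => x0; rewrite ler0_norm.
Qed.

(** The interval [[-a, a]] contributes its length, and outside it the
distance to the interval is distributed as the distance to the origin. *)
Lemma ge0_integral_itv_dist (a : R) (g : measurableTypeR R -> \bar R) : (0 <= a)%R ->
  measurable_fun setT g -> (forall x, 0 <= g x) ->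
  \int[leb]_x g (itv_dist a x) = (2 * a)%:E * g 0%R + \int[leb]_x g `|x|%R.
Proof.
move=> a0 mg g0.
(* Both integrands are even; compare them on the half line. *)
transitivity (\int[leb]_x (fun y => g (itv_dist a y)) `|x|%R).
  by apply: eq_integral => x _; rewrite /itv_dist normr_id.
have mga : measurable_fun setT (fun y : measurableTypeR R => g (itv_dist a y)).
  by apply: (measurableT_comp mg); exact: measurable_itv_dist.
rewrite (ge0_integral_norm mga)// (ge0_integral_norm mg)// EFinM -muleA -ge0_muleDr ?mule_ge0 ?lee_fin//; last first.
  exact: integral_ge0.
congr (_ * _).
have E : [set` `[0%R, +oo[] = [set` `[0%R, a[] `|` [set` `[a, +oo[] :> set R.
  by apply: itv_bndbnd_setU; rewrite ?bnd_simp.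
rewrite [in LHS]E ge0_integral_setU//; last 2 first.
- exact: measurable_funTS.
- apply/disj_setPS => x [] /=; rewrite !in_itv /= andbT => /andP[_ xa] ax.
  by move: (lt_le_trans xa ax); rewrite ltxx.
congr (_ + _).
  rewrite (eq_integral (cst (g 0%R))); last first.
    move=> x; rewrite inE /= in_itv /= => /andP[x0 xa].
    by rewrite /itv_dist ger0_norm // max_r // subr_le0 ltW.
  rewrite integral_cst //= lebesgue_measure_itv /= lte_fin muleC.
  by case: ltgtP a0 => // [a0 _|<- _]; rewrite ?oppr0 ?adde0.
rewrite integral_mkcond [RHS]integral_mkcond.
rewrite -[RHS](ge0_integral_leb_shift (- a)%R); last 2 first.
- exact: ((measurable_restrictT g (measurable_itv _)).1 (measurable_funTS mg)).
- by move=> x; apply: erestrict_ge0.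
apply: eq_integral => x _; rewrite !patchE !mem_setE !in_itv /= !andbT subr_ge0.
by case: ifP => // ax; rewrite /itv_dist ger0_norm ?(le_trans a0) // max_l // subr_ge0.
Qed.

Lemma integral_gauss_pi : \int[leb]_x (expR (- (pi * x ^+ 2)))%:E = 1.
Proof.
have sp : Num.sqrt pi != 0%R :> R by rewrite sqrtr_eq0 -ltNge pi_gt0.
have := @ge0_integral_leb_scale R (Num.sqrt pi) (fun x => (gauss_fun x)%:E) sp.
have m1 : measurable_fun setT (fun x : measurableTypeR R => (gauss_fun x)%:E).
  by apply/measurable_EFinP; exact: measurable_gauss_fun.
have g0 (x : measurableTypeR R) : 0 <= (gauss_fun x)%:E by rewrite lee_fin gauss_fun_ge0.
rewrite integralT_gauss => /(_ m1 g0).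
rewrite ger0_norm ?sqrtr_ge0 //.
under eq_integral do rewrite /gauss_fun exprMn sqr_sqrtr ?pi_ge0//.
move=> H; rewrite -[LHS]mul1e -(mulVf sp) EFinM -muleA H -EFinM mulVf //.
Qed.

Definition gauss_dist (a x : R) : R := expR (- (pi * itv_dist a x ^+ 2)).

Lemma measurable_gauss_dist a : measurable_fun setT (gauss_dist a : measurableTypeR R -> measurableTypeR R).
Proof.
apply: (measurableT_comp (@measurable_expR R)).
apply: (measurableT_comp (@oppr_measurable R setT)).
apply: measurable_funM => //; apply: measurable_funX; exact: measurable_itv_dist.
Qed.

(** With the normalization [exp (- pi t ^ 2)] the tails contribute 1 and the
interval contributes its length; this is the Wills functional of an interval. *)
Lemma integral_gauss_dist (a : R) : (0 <= a)%R ->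
  \int[leb]_x (gauss_dist a x)%:E = (1 + 2 * a)%:E.
Proof.
move=> a0; rewrite (@ge0_integral_itv_dist a (fun s => (expR (- (pi * s ^+ 2)))%:E)) //.
- under eq_integral do rewrite -normrX ger0_norm ?sqr_ge0//.
  by rewrite integral_gauss_pi expr0n /= mulr0 oppr0 expR0 mule1 addeC.
- apply/measurable_EFinP; apply: (measurableT_comp (@measurable_expR R)).
  apply: (measurableT_comp (@oppr_measurable R setT)).
  by apply: measurable_funM => //; apply: measurable_funX.
Qed.

Lemma measurable_prod_coord n (f : 'I_n -> R -> R) :
  (forall i, measurable_fun setT (f i : measurableTypeR R -> measurableTypeR R)) ->
  measurable_fun setT (fun x : rvs n => \prod_i f i ((x : 'rV[R]_n) ord0 i))%R.
Proof.
move=> mf; apply: measurable_prod => i _.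
exact: (measurableT_comp (mf i) (measurable_coord i)).
Qed.

Lemma integral_prod_coord n (f : 'I_n -> R -> R) :
  (forall i x, (0 <= f i x)%R) ->
  (forall i, measurable_fun setT (f i : measurableTypeR R -> measurableTypeR R)) ->
  \int[vmeas n]_x (\prod_i f i ((x : 'rV[R]_n) ord0 i))%:E =
  \prod_i \int[leb]_x (f i x)%:E.
Proof.
elim: n f => [|n IH] f f0 mf.
  rewrite integral_vmeas0; last by apply/measurable_EFinP; exact: measurable_prod_coord.
  by rewrite !big_ord0.
rewrite vmeas_tonelli; last 2 first.
- by apply/measurable_EFinP; exact: measurable_prod_coord.
- by move=> x; rewrite lee_fin; apply: prodr_ge0.
rewrite big_ord_recl -ge0_integralZr //; last 3 first.
- by apply/measurable_EFinP; exact: (mf ord0).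
- by move=> x _; rewrite lee_fin.
- by apply: prode_ge0 => i _; apply: integral_ge0 => x _; rewrite lee_fin.
apply: eq_integral => a _; rewrite -IH //.
rewrite -ge0_integralZl ?lee_fin //; last 2 first.
- apply/measurable_EFinP.
  exact: (measurable_prod_coord (f := fun i => f (lift ord0 i))).
- by move=> x _; rewrite lee_fin; apply: prodr_ge0.
apply: eq_integral => v _.
rewrite -EFinM big_ord_recl rcons_rv0; congr (_ * _)%:E%R.
by apply: eq_bigr => i _; rewrite rcons_rvS.
Qed.

Lemma integral_gauss_cube n (a : R) : (0 <= a)%R ->
  \int[vmeas n]_x (expR (- (pi * \sum_i itv_dist a ((x : 'rV[R]_n) ord0 i) ^+ 2)))%:E
  = ((1 + 2 * a) ^+ n)%:E.
Proof.
move=> a0; transitivity (\int[vmeas n]_x (\prod_i gauss_dist a ((x : 'rV[R]_n) ord0 i))%:E).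
  apply: eq_integral => x _; congr EFin.
  by rewrite /gauss_dist -expR_sum mulr_sumr -sumrN.
rewrite (integral_prod_coord (f := fun=> gauss_dist a)); last 2 first.
- by move=> i x; exact: expR_ge0.
- by move=> i; exact: measurable_gauss_dist.
under eq_bigr do rewrite integral_gauss_dist //.
by rewrite big_const_ord iter_mule mule1 EFin_expe.
Qed.

Lemma integral_gauss_rv n :
  \int[vmeas n]_x (expR (- (pi * \sum_i (x : 'rV[R]_n) ord0 i ^+ 2)))%:E = 1.
Proof.
have := integral_gauss_cube n (lexx 0%R); rewrite mulr0 addr0 expr1n => <-.
apply: eq_integral => x _; congr (expR (- (pi * _)))%:E.
by apply: eq_bigr => i _; rewrite itv_dist0 -normrX ger0_norm ?sqr_ge0.
Qed.

End distance_to_interval.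

(** * The Wills functional as a Gaussian integral *)

Section wills_integral.
Context {R : realType}.
Local Notation leb := (@lebesgue_measure R).

Definition gaussian (x : R) : R := expR (- (pi * x ^+ 2)).

(** The density, in the radius, for which the ball of radius [t] averages to
the Gaussian: minus the derivative of [gaussian]. *)
Definition rayleigh (t : R) : R := 2 * pi * t * expR (- (pi * t ^+ 2)).

Lemma rayleigh_ge0 t : 0 <= t -> 0 <= rayleigh t.
Proof. by move=> t0; rewrite !mulr_ge0 ?expR_ge0 ?pi_ge0. Qed.

Lemma is_derive_gauss (x : R) :
  is_derive x 1 (fun x => - gaussian x) (rayleigh x).
Proof.
rewrite /gaussian; apply: is_derive_eq.
rewrite /rayleigh /GRing.scale /=; ring.
Qed.

Lemma continuous_gaussian : continuous gaussian.
Proof.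
move=> x; apply: (@continuous_comp _ _ _ (fun x : R => - (pi * x ^+ 2)) expR); last exact: continuous_expR.
apply: continuousN; apply: continuousM; [exact: cvg_cst|exact: exprn_continuous].
Qed.

Lemma continuous_rayleigh : continuous rayleigh.
Proof.
move=> x; apply: continuousM; last exact: continuous_gaussian.
by apply: continuousM => //; exact: cvg_cst.
Qed.

Lemma measurable_rayleigh : measurable_fun setT (rayleigh : measurableTypeR R -> measurableTypeR R).
Proof. by apply: continuous_measurable_fun; exact: continuous_rayleigh. Qed.

Lemma integral_rayleigh (d : R) : 0 <= d ->
  (\int[leb]_(t in `[d, +oo[) (rayleigh t)%:E = (gaussian d)%:E)%E.
Proof.
move=> d0.
rewrite (@ge0_continuous_FTC2y R rayleigh (fun x => - gaussian x) d 0).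
- by rewrite -EFinN opprK add0e.
- by move=> x dx; apply: rayleigh_ge0; exact: le_trans dx.
- by apply: continuous_subspaceT; exact: continuous_rayleigh.
- rewrite -oppr0; apply: cvgN.
  have sp : 0 < Num.sqrt pi :> R by rewrite sqrtr_gt0 pi_gt0.
  rewrite (_ : gaussian = gauss_fun \o (fun x => Num.sqrt pi * x)).
    apply: (cvg_comp (fun x => Num.sqrt pi * x) gauss_fun _ (@cvg_gauss_fun R)).
    by apply: gt0_cvgMry => //; exact: cvg_id.
  by apply/funext => x /=; rewrite /gaussian /gauss_fun exprMn sqr_sqrtr ?pi_ge0.
- by move=> x _; have [] := is_derive_gauss x.
- by apply: cvg_at_right_filter; apply: cvgN; exact: continuous_gaussian.
- by move=> x _; rewrite derive1E; exact: (@derive_val _ _ _ _ _ _ _ (is_derive_gauss x)).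
Qed.

Local Open Scope ereal_scope.

(** [gaussian d] is the integral of [rayleigh] over [t >= d]; exchange the two
integrations. *)
Lemma layer_cake n (rho : rvs n -> measurableTypeR R) :
  measurable_fun setT rho -> (forall x, (0 <= rho x)%R) ->
  \int[vmeas n]_x (expR (- (pi * rho x ^+ 2)))%:E =
  \int[leb]_(t in `[0%R, +oo[) ((rayleigh t)%:E * vmeas n [set x | (rho x <= t)%R]).
Proof.
move=> mrho rho0.
have mle : measurable [set p : rvs n * measurableTypeR R | (rho p.1 <= p.2)%R].
  rewrite -[X in measurable X]setTI.
  by apply: (measurable_fun_le (f := fun p : rvs n * measurableTypeR R => rho p.1)
    (g := fun p : rvs n * measurableTypeR R => p.2)) => //; exact: measurableT_comp.
have mS t : measurable [set x | (rho x <= t)%R].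
  rewrite -[X in measurable X]setTI (_ : [set x | _] = rho @^-1` `]-oo, t]%classic); first exact: mrho.
  by apply/seteqP; split => x /=; rewrite in_itv.
(* The absolute value makes the integrand nonnegative for all [t], as Tonelli's
   theorem wants; only [t >= 0] contributes. *)
pose phi (p : rvs n * measurableTypeR R) : \bar R :=
  (rayleigh `|p.2| * \1_[set p : rvs n * measurableTypeR R | (rho p.1 <= p.2)%R] p)%:E.
have phi0 p : 0 <= phi p.
  by rewrite lee_fin mulr_ge0 // rayleigh_ge0.
have mphi : measurable_fun setT phi.
  apply/measurable_EFinP; apply: measurable_funM; last exact: measurable_indic.
  apply: (measurableT_comp measurable_rayleigh).
  by apply: (measurableT_comp (@normr_measurable R setT)).
transitivity (\int[vmeas n]_x \int[leb]_t phi (x, t)).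
  apply: eq_integral => x _; rewrite -integral_rayleigh // integral_mkcond.
  apply: eq_integral => t _; rewrite patchE /phi /= indicE mem_setE in_itv /= andbT.
  have -> : ((x, t) \in [set p : rvs n * measurableTypeR R | (rho p.1 <= p.2)%R]) = (rho x <= t)%R.
    by apply/idP/idP; rewrite inE.
  case: ifP => rt; last by rewrite mulr0.
  by rewrite mulr1 ger0_norm // (le_trans (rho0 x)).
rewrite (@fubini_tonelli _ _ _ _ R (vmeas n) leb phi mphi phi0).
rewrite [RHS]integral_mkcond; apply: eq_integral => t _.
rewrite patchE mem_setE in_itv /= andbT; case: ifPn => t0.
  transitivity (\int[vmeas n]_x ((rayleigh t)%:E * (\1_[set x | (rho x <= t)%R] x)%:E)).
    by apply: eq_integral => x _; rewrite /phi ger0_norm //= -EFinM.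
  rewrite ge0_integralZl ?lee_fin ?rayleigh_ge0 //; last 1 first.
  - by apply/measurable_EFinP; exact: measurable_indic.
  by rewrite integral_indic // setIT.
apply: integral0_eq => x _; rewrite /phi indicE memNset ?mulr0 //=.
by apply/negP; rewrite -ltNge (lt_le_trans _ (rho0 x)) // ltNge.
Qed.

Lemma enorm_ge0 n (x : 'rV[R]_n) : (0 <= enorm x)%R.
Proof. exact: sqrtr_ge0. Qed.

Lemma sqr_enorm n (x : 'rV[R]_n) : (enorm x ^+ 2 = \sum_i x ord0 i ^+ 2)%R.
Proof. by rewrite sqr_sqrtr // sumr_ge0 // => i _; exact: sqr_ge0. Qed.

Lemma enormZ n (t : R) (x : 'rV[R]_n) : (enorm (t *: x) = `|t| * enorm x)%R.
Proof.
rewrite /enorm -sqrtr_sqr -sqrtrM ?sqr_ge0 // mulr_sumr; congr Num.sqrt.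
by apply: eq_bigr => i _; rewrite mxE exprMn.
Qed.

Lemma measurable_enorm n : measurable_fun setT (@enorm R n : rvs n -> measurableTypeR R).
Proof.
apply: (@measurableT_comp _ _ _ _ _ _ (@Num.sqrt R)).
  by apply: continuous_measurable_fun; exact: sqrt_continuous.
by apply: measurable_sum => i; apply: measurable_funX; exact: measurable_coord.
Qed.

Lemma measurable_enorm_le n (t : R) : measurable ([set x : 'rV[R]_n | (enorm x <= t)%R] : set (rvs n)).
Proof.
rewrite -[X in measurable X]setTI (_ : [set x | _] = @enorm R n @^-1` `]-oo, t]%classic).
  exact: measurable_enorm.
by apply/seteqP; split => x /=; rewrite in_itv.
Qed.

(** The preimage is the image under the inverse matrix, whence the determinant
on the left-hand side. *)
Lemma vmeas_linear_preimage n (A : 'M[R]_n) (S : set (rvs n)) :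
  A \in unitmx -> measurable S ->
  `|\det A|%:E * vmeas n [set x | S ((x : 'rV[R]_n) *m A)] = vmeas n S.
Proof.
move=> uA mS.
have mS' : measurable ([set x | S ((x : 'rV[R]_n) *m A)] : set (rvs n)).
  by rewrite -[X in measurable X]setTI; apply: (measurable_linear A).
have vE (T : set (@rvs R n)) : measurable T -> vmeas n T = \int[vmeas n]_x (\1_T x)%:E.
  by move=> mT; rewrite integral_indic // setIT.
rewrite (vE _ mS) (vE _ mS').
rewrite -(scales_volume_unitmx uA (f := fun x : rvs n => (\1_S x)%:E)) //.
by apply/measurable_EFinP; exact: measurable_indic.
Qed.

Lemma vmeas_ballE n (t : R) : (0 < t)%R ->
  vmeas n [set x | (enorm x <= t)%R] = (t ^+ n)%:E * vmeas n [set x | (enorm x <= 1)%R].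
Proof.
move=> t0; have tn0 : (t ^+ n != 0)%R by rewrite expf_neq0 // gt_eqF.
have uA : (t%:M : 'M[R]_n) \in unitmx by rewrite unitmxE det_scalar unitfE.
rewrite -(vmeas_linear_preimage uA (measurable_enorm_le t)) det_scalar.
rewrite ger0_norm ?exprn_ge0 ?ltW //; congr (_ * vmeas n _).
apply/seteqP; split => x /=;
  by rewrite mul_mx_scalar enormZ gtr0_norm // ger_pMr.
Qed.

Definition rayleigh_moment n : \bar R :=
  \int[leb]_(t in `[0%R, +oo[) (rayleigh t * t ^+ n)%:E.

Let itv0_ge0 (t : R) : t \in `[0%R, +oo[%classic -> (0 <= t)%R.
Proof. by rewrite inE /= in_itv /= andbT. Qed.

Lemma measurable_rayleigh_moment n :
  measurable_fun setT (fun t : measurableTypeR R => (rayleigh t * t ^+ n)%:E).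
Proof.
apply/measurable_EFinP; apply: measurable_funM; first exact: measurable_rayleigh.
exact: measurable_funX.
Qed.

Lemma rayleigh_moment_ge0 n : 0 <= rayleigh_moment n.
Proof.
apply: integral_ge0 => t; rewrite /= in_itv /= andbT => t0.
by rewrite lee_fin mulr_ge0 ?exprn_ge0 ?rayleigh_ge0.
Qed.

(** The layer cake formula for the norm itself, whose Gaussian integral is 1.
It explains the normalization of intrinsic volumes by volumes of balls. *)
Lemma ball_rayleigh_moment n :
  volume (euclidean_ball R n) * rayleigh_moment n = 1.
Proof.
rewrite volumeE -(integral_gauss_rv n).
under [in RHS]eq_integral do rewrite -sqr_enorm.
rewrite (layer_cake (@measurable_enorm n) (@enorm_ge0 n)).
rewrite -ge0_integralZl //; last 2 first.
- by apply: measurable_funTS; exact: measurable_rayleigh_moment.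
- move=> t; rewrite /= in_itv /= andbT => t0.
  by rewrite lee_fin mulr_ge0 ?exprn_ge0 ?rayleigh_ge0.
apply: eq_integral => t /itv0_ge0; rewrite le_eqVlt => /predU1P[<-|t0].
  by rewrite /rayleigh mulr0 !mul0r mule0 mul0e.
by rewrite [in RHS](vmeas_ballE n t0) [RHS]muleA -EFinM muleC.
Qed.

(** A product equal to 1 in the extended nonnegative reals forces both factors
to be finite and positive. *)
Lemma ball_volume n : exists2 v : R, (0 < v)%R &
  volume (euclidean_ball R n) = v%:E /\ rayleigh_moment n = v^-1%:E.
Proof.
have := ball_rayleigh_moment n; have := rayleigh_moment_ge0 n.
have : 0 <= volume (euclidean_ball R n) by rewrite volumeE.
case: (volume _) => [v| |] //; last first.
  case: (rayleigh_moment n) => [g| |] // _ g0.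
  move: g0; rewrite lee_fin le_eqVlt => /predU1P[<-|g0]; first by rewrite mule0 => -[] /esym /eqP; rewrite oner_eq0.
  by rewrite gt0_mulye.
case: (rayleigh_moment n) => [g| |] //; rewrite !lee_fin => v0 g0; last first.
  move: v0; rewrite le_eqVlt => /predU1P[<-|v0]; first by rewrite mul0e => -[] /esym /eqP; rewrite oner_eq0.
  by rewrite gt0_muley.
rewrite -EFinM => -[vg]; have vn : v != 0%R by apply/eqP => ve; move: vg; rewrite ve mul0r => /esym/eqP; rewrite oner_eq0.
exists v; first by rewrite lt_neqAle eq_sym vn v0.
by split => //; rewrite -[g]mul1r -(mulVf vn) -mulrA vg mulr1.
Qed.

(** [rho] stands for the distance to [M]: its sublevel sets are the parallel
bodies. Layer cake, then the Steiner polynomial, then the moments of [rayleigh],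
which are the reciprocal volumes of balls. *)
Lemma wills_integral n (M : set 'rV[R]_n) (rho : rvs n -> measurableTypeR R) :
  measurable_fun setT rho -> (forall x, (0 <= rho x)%R) ->
  (forall t, (0 <= t)%R ->
    minkowski_sum M (dilate t (euclidean_ball R n)) = [set x | (rho x <= t)%R]) ->
  (exists w : {ffun 'I_n.+1 -> R}, steiner_coefficients M w) ->
  (wills M)%:E = \int[vmeas n]_x (expR (- (pi * rho x ^+ 2)))%:E.
Proof.
move=> mrho rho0 rhoM exw.
have qM : steiner_coefficients M (quermassintegral M) by exact: (@xgetPex _ _ [set w | steiner_coefficients M w]).
pose c (i : 'I_n.+1) : R := ('C(n, i)%:R * quermassintegral M i)%R.
(* Reversing the summation indexes the terms by the dimension of the ball. *)
have willsE : wills M = (\sum_(i < n.+1) c i / fine (volume (euclidean_ball R i)))%R.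
  rewrite /wills (reindex_inj rev_ord_inj) /=; apply: eq_bigr => i _.
  have ilen : (i <= n)%N by rewrite -ltnS.
  by rewrite /intrinsic_volume rev_ordK /= subSS bin_sub // subKn.
rewrite (layer_cake mrho rho0).
transitivity (\int[leb]_(t in `[0%R, +oo[) \sum_(i < n.+1) ((c i)%:E * (rayleigh t * t ^+ i)%:E)).
  have igr (i : 'I_n.+1) : leb.-integrable `[0%R, +oo[ (fun t : R => (rayleigh t * t ^+ i)%:E).
    apply/integrableP; split; first by apply: measurable_funTS; exact: measurable_rayleigh_moment.
    have [v v0 [_ Gv]] := ball_volume i.
    rewrite (_ : \int[_]_(_ in _) _ = rayleigh_moment i); first by rewrite Gv ltry.
    apply: eq_integral => t /itv0_ge0 t0 /=.
    by rewrite ger0_norm // mulr_ge0 ?exprn_ge0 ?rayleigh_ge0.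
  rewrite integral_sum //; last first.
    by move=> i; apply: integrableZl.
  rewrite willsE -sumEFin; apply: eq_bigr => i _.
  rewrite integralZl //.
  have [v v0 [vE Gv]] := ball_volume i.
  by rewrite -/(rayleigh_moment i) Gv vE.
apply: eq_integral => t /itv0_ge0 t0.
rewrite -volumeE -rhoM // qM // -EFinM.
under eq_bigr do rewrite -EFinM; rewrite sumEFin.
by congr EFin; rewrite mulr_sumr; apply: eq_bigr => i _; rewrite mulrCA mulrA.
Qed.

End wills_integral.

(** * The Wills functional of a cube *)

Section cube.
Context {R : realType}.
Local Notation leb := (@lebesgue_measure R).

Lemma dilate_ballE n (t : R) : 0 <= t ->
  dilate t (euclidean_ball R n) = [set x | enorm x <= t].
Proof.
move=> t0; apply/seteqP; split => [_ [x /= x1 <-]|x /= xt].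
  by rewrite enormZ ger0_norm // ler_piMr.
have [tE|tn0] := eqVneq t 0; last first.
  exists (t^-1 *: x); last by rewrite scalerA divff // scale1r.
  have tp : 0 < t by rewrite lt_neqAle eq_sym tn0.
  by rewrite /euclidean_ball /= enormZ ger0_norm ?invr_ge0 // ler_pdivrMl // mulr1.
have x0 : x = 0.
  have /eqP : enorm x ^+ 2 = 0.
    have -> : enorm x = 0 by apply/le_anti; rewrite enorm_ge0 -tE xt.
    by rewrite expr0n.
  rewrite sqr_enorm psumr_eq0 => [/allP x0|i _]; last exact: sqr_ge0.
  apply/rowP => i; rewrite mxE; apply/eqP.
  by have := x0 i; rewrite mem_index_enum sqrf_eq0; apply.
exists 0; last by rewrite scaler0 x0.
rewrite /euclidean_ball /= (_ : enorm 0 = 0) //.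
by rewrite /enorm big1 ?sqrtr0 // => i _; rewrite mxE expr0n.
Qed.

Lemma dilate_linfE n (a : R) : 0 <= a ->
  dilate a (linf_ball R n) = [set x | forall i, `|x ord0 i| <= a].
Proof.
move=> a0; apply/seteqP; split => [_ [x /= x1 <-] i|x /= xa].
  by rewrite mxE normrM ger0_norm // ler_piMr.
have [aE|an0] := eqVneq a 0; last first.
  exists (a^-1 *: x); last by rewrite scalerA divff // scale1r.
  have ap : 0 < a by rewrite lt_neqAle eq_sym an0.
  by move=> i; rewrite mxE normrM ger0_norm ?invr_ge0 // ler_pdivrMl // mulr1.
exists 0; first by move=> i; rewrite mxE normr0.
apply/rowP => i; rewrite !mxE mulr0; apply/esym/eqP.
by rewrite -normr_le0 -aE.
Qed.

Definition cube_dist n (a : R) (x : 'rV[R]_n) : R :=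
  Num.sqrt (\sum_i itv_dist a (x ord0 i) ^+ 2).

Lemma sum_itv_dist_ge0 n a (x : 'rV[R]_n) : 0 <= \sum_i itv_dist a (x ord0 i) ^+ 2.
Proof. by apply: sumr_ge0 => i _; exact: sqr_ge0. Qed.

(** The nearest point of the cube is found coordinate by coordinate. *)
Lemma cube_parallel n (a t : R) : 0 <= a -> 0 <= t ->
  minkowski_sum (dilate a (linf_ball R n)) (dilate t (euclidean_ball R n)) =
  [set x | cube_dist a x <= t].
Proof.
move=> a0 t0; rewrite dilate_ballE // dilate_linfE //; apply/seteqP; split.
  move=> _ [y /= ya [z /= zt <-]]; apply: le_trans zt.
  rewrite /cube_dist ler_sqrt ?sum_itv_dist_ge0 //; last first.
    by apply: sumr_ge0 => i _; exact: sqr_ge0.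
  apply: ler_sum => i _; rewrite -[leRHS]real_normK ?num_real //.
  rewrite lerXn2r ?nnegrE ?itv_dist_ge0 // itv_dist_le // mxE.
  by apply: le_trans (ler_normD _ _) _; rewrite lerD2r.
move=> x /= xt.
pose z : 'rV[R]_n := \row_i (Num.sg (x ord0 i) * itv_dist a (x ord0 i)).
have zE i : `|z ord0 i| = itv_dist a (x ord0 i).
  rewrite mxE normrM (ger0_norm (itv_dist_ge0 _ _)) normr_sg.
  have [->|] := eqVneq (x ord0 i) 0; last by rewrite mul1r.
  by rewrite mul0r /itv_dist normr0 sub0r max_r // oppr_le0.
exists (x - z).
  move=> i /=; rewrite !mxE {1}[x ord0 i]numEsg -mulrBr normrM normr_sg.
  have [//|_] := eqVneq (x ord0 i) 0; first by rewrite mul0r.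
  rewrite mul1r /itv_dist; case: (leP (`|x ord0 i| - a) 0) => h.
    by rewrite subr0 normr_id -subr_le0.
  by rewrite subKr ger0_norm.
exists z; last by rewrite subrK.
apply: le_trans xt; rewrite /enorm /cube_dist.
rewrite ler_sqrt ?sum_itv_dist_ge0 //; apply: ler_sum => i _.
by rewrite -zE real_normK ?num_real.
Qed.

Lemma measurable_cube_dist n (a : R) :
  measurable_fun setT (cube_dist a : rvs n -> measurableTypeR R).
Proof.
apply: (@measurableT_comp _ _ _ _ _ _ (@Num.sqrt R)).
  by apply: continuous_measurable_fun; exact: sqrt_continuous.
apply: measurable_sum => i; apply: measurable_funX.
exact: (measurableT_comp (measurable_itv_dist a) (measurable_coord i)).
Qed.

(** If a coordinate is at distance [s] from the interval, the remaining ones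
may be at distance [sqrt (t ^ 2 - s ^ 2)] from the cube; this is the [j]-th
power of that radius. *)
Definition half_disc (t : R) (j : nat) (s : R) : R :=
  if `|s| <= t then Num.sqrt (t ^+ 2 - s ^+ 2) ^+ j else 0.

Lemma half_disc_ge0 t j s : 0 <= half_disc t j s.
Proof. by rewrite /half_disc; case: ifP => // _; rewrite exprn_ge0 ?sqrtr_ge0. Qed.

Lemma measurable_half_disc t j :
  measurable_fun setT (half_disc t j : measurableTypeR R -> measurableTypeR R).
Proof.
apply: measurable_fun_ifT.
- apply: (measurable_fun_ler (f := fun s : measurableTypeR R => `|s|) (g := cst t)).
    exact: (@normr_measurable R setT).
  exact: measurable_cst.
- apply: measurable_funX; apply: (@measurableT_comp _ _ _ _ _ _ (@Num.sqrt R)).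
    by apply: continuous_measurable_fun; exact: sqrt_continuous.
  by apply: measurable_funB => //; apply: measurable_funX.
- exact: measurable_cst.
Qed.

Local Open Scope ereal_scope.

(** By homogeneity in [t]; the constant is the integral for [t = 1]. *)
Lemma integral_half_disc j : exists kappa : R, (0 <= kappa)%R /\
  forall t, (0 <= t)%R -> \int[leb]_s (half_disc t j s)%:E = (kappa * t ^+ j.+1)%:E.
Proof.
have I0 t : 0 <= \int[leb]_s (half_disc t j s)%:E.
  by apply: integral_ge0 => s _; rewrite lee_fin half_disc_ge0.
have mh t : measurable_fun setT (fun s : measurableTypeR R => (half_disc t j s)%:E).
  by apply/measurable_EFinP; exact: measurable_half_disc.
have Ifin : \int[leb]_s (half_disc 1 j s)%:E < +oo.
  apply: (@le_lt_trans _ _ (\int[leb]_s (\1_(`[-1, 1]%classic : set R) s)%:E)).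
    apply: ge0_le_integral => //.
    - by move=> s _; rewrite lee_fin half_disc_ge0.
    - by apply/measurable_EFinP; exact: measurable_indic.
    move=> s _; rewrite lee_fin /half_disc indicE mem_setE in_itv /= -ler_norml.
    case: ifP => // s1; rewrite exprn_ile1 ?sqrtr_ge0 //.
    by rewrite -[leRHS]sqrtr1 ler_sqrt ?ler01 // expr1n gerBl sqr_ge0.
  by rewrite integral_indic //= setIT lebesgue_measure_itv /=; case: ifP => // _; rewrite -EFinB ltry.
exists (fine (\int[leb]_s (half_disc 1 j s)%:E)); split; first exact: fine_ge0.
move=> t t0; have [->|tn0] := eqVneq t 0%R.
  rewrite expr0n /= mulr0.
  have -> : \int[leb]_s (half_disc 0 j s)%:E = \int[leb]_(s in [set 0%R]) (half_disc 0 j s)%:E.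
    rewrite [RHS]integral_mkcond; apply: eq_integral => s _; rewrite patchE.
    case: ifPn => // /negP; rewrite inE /= => s0; rewrite /half_disc ifF //.
    by apply/negbTE; rewrite normr_le0; exact/eqP.
  by rewrite integral_set1.
rewrite -[LHS](ge0_integral_leb_scale tn0) //; last by move=> s; rewrite lee_fin half_disc_ge0.
have tp : (0 < t)%R by rewrite lt_neqAle eq_sym tn0.
rewrite ger0_norm // EFinM fineK ?ge0_fin_numE // muleC exprS EFinM [RHS]muleCA muleC.
congr (_ * _); rewrite muleC -ge0_integralZl ?lee_fin ?exprn_ge0 //; last first.
  by move=> s _; rewrite lee_fin half_disc_ge0.
apply: eq_integral => s _; rewrite -EFinM; congr EFin; rewrite /half_disc.
rewrite normrM ger0_norm // ger_pMr // exprMn -[X in (X - _)%R]mulr1 -mulrBr.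
rewrite expr1n; case: ifP => _; last by rewrite mulr0.
by rewrite sqrtrM ?sqr_ge0 // sqrtr_sqr ger0_norm // exprMn.
Qed.

(** The Steiner polynomial of the cube, by induction on the dimension: slicing
by one coordinate, a slice at distance [s] from the interval is a parallel body
of radius [sqrt (t ^ 2 - s ^ 2)]. The radius is squared in the statement so
that slices keep the same form. *)
Lemma cube_parallel_volume k (a : R) : (0 <= a)%R ->
  exists2 alpha : nat -> R, (forall j, (0 <= alpha j)%R) &
  forall t, (0 <= t)%R ->
    volume [set x : 'rV[R]_k | (\sum_i itv_dist a (x ord0 i) ^+ 2 <= t ^+ 2)%R] =
    (\sum_(j < k.+1) alpha j * t ^+ j)%:E.
Proof.
move=> a0; elim: k => [|k [alpha alpha0 IH]].
  exists (fun=> 1%R) => // t t0.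
  by rewrite big_ord1 expr0 mulr1 /= indicE mem_set //= big_ord0 sqr_ge0.
have [kappa kappa_int] := choice integral_half_disc.
(* The first summand comes from the slices outside the interval, which raise
   the degree by 1; the second one from the interval, of length [2 * a]. *)
exists (fun j => (if j is j'.+1 then kappa j' * alpha j' else 0) +
                 (if (j < k.+1)%N then 2 * a * alpha j else 0))%R.
  move=> j; rewrite addr_ge0 //; first by case: j => // j; rewrite mulr_ge0 //; have [] := kappa_int j.
  by case: ifP => // _; rewrite !mulr_ge0.
move=> t t0.
pose Psi (s : R) : \bar R := \sum_(j < k.+1) (alpha j)%:E * (half_disc t j s)%:E.
have Psi0 s : 0 <= Psi s.
  by apply: sume_ge0 => j _; rewrite mule_ge0 ?lee_fin ?half_disc_ge0.
have mPsi1 (j : 'I_k.+1) : measurable_fun setT (fun s : measurableTypeR R => (alpha j)%:E * (half_disc t j s)%:E).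
  by apply: measurable_funeM; apply/measurable_EFinP; exact: measurable_half_disc.
have mPsi : measurable_fun setT (Psi : measurableTypeR R -> \bar R).
  exact: emeasurable_sum.
transitivity (\int[leb]_x Psi (itv_dist a x)).
  rewrite /=; apply: eq_integral => x _.
  have -> : [set v : 'rV[R]_k | [set x0 : 'rV[R]_k.+1 |
        (\sum_i itv_dist a (x0 ord0 i) ^+ 2 <= t ^+ 2)%R]
        (row_mx (const_mx x : 'rV[R]_1) v : 'rV[R]_(1 + k))] =
      [set v : 'rV[R]_k | (\sum_i itv_dist a (v ord0 i) ^+ 2 <= t ^+ 2 - itv_dist a x ^+ 2)%R].
    have sE (v : 'rV[R]_k) : (\sum_i itv_dist a ((rcons_rv (x, v) : 'rV[R]_k.+1) ord0 i) ^+ 2 =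
        itv_dist a x ^+ 2 + \sum_i itv_dist a (v ord0 i) ^+ 2)%R.
      rewrite big_ord_recl rcons_rv0; congr (_ + _)%R.
      by apply: eq_bigr => i _; rewrite rcons_rvS.
    by apply/seteqP; split => v /=; rewrite lerBrDl -sE.
  rewrite /Psi /half_disc ger0_norm ?itv_dist_ge0 //; case: (leP (itv_dist a x) t) => xt.
    have d0 : (0 <= t ^+ 2 - itv_dist a x ^+ 2)%R.
      by rewrite subr_ge0 lerXn2r ?nnegrE ?itv_dist_ge0.
    rewrite -{1}(sqr_sqrtr d0) IH ?sqrtr_ge0 // -sumEFin.
    by apply: eq_bigr => j _; rewrite EFinM.
  rewrite big1 ?mule0 //; last by move=> j _; rewrite mule0.
  rewrite volumeE (_ : [set v : 'rV[R]_k | _] = set0) ?measure0 //.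
  rewrite -subset0 => v /= h.
  have : (t ^+ 2 - itv_dist a x ^+ 2 < 0)%R by rewrite subr_lt0 ltrXn2r ?nnegrE ?itv_dist_ge0.
  by rewrite ltNge (le_trans (sum_itv_dist_ge0 a v) h).
rewrite (ge0_integral_itv_dist a0 mPsi Psi0).
have -> : Psi 0%R = (\sum_(j < k.+1) alpha j * t ^+ j)%:E.
  rewrite -sumEFin; apply: eq_bigr => j _.
  by rewrite /half_disc normr0 t0 expr0n subr0 sqrtr_sqr ger0_norm // EFinM.
have -> : \int[leb]_x Psi `|x|%R = (\sum_(j < k.+1) kappa j * alpha j * t ^+ j.+1)%:E.
  transitivity (\int[leb]_x Psi x).
    apply: eq_integral => x _; apply: eq_bigr => j _.
    by rewrite /half_disc normr_id real_normK ?num_real.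
  rewrite ge0_integral_sum //; last by move=> j x _; rewrite mule_ge0 ?lee_fin ?half_disc_ge0.
  rewrite -sumEFin; apply: eq_bigr => j _.
  rewrite ge0_integralZl ?lee_fin //; last 2 first.
  - by apply/measurable_EFinP; exact: measurable_half_disc.
  - by move=> x _; rewrite lee_fin half_disc_ge0.
  by have [_ ->] := kappa_int j; rewrite // -EFinM mulrA [(alpha j * _)%R]mulrC.
rewrite -EFinM -EFinD addrC; congr EFin.
under [RHS]eq_bigr do rewrite mulrDl.
rewrite big_split /=; congr (_ + _)%R.
  by rewrite [RHS]big_ord_recl /= mul0r add0r.
rewrite [RHS]big_ord_recr /= ltnn mul0r addr0 mulr_sumr; apply: eq_bigr => j _.
by rewrite ltn_ord mulrA.
Qed.

Lemma cube_parallel_sqr k (a t : R) : (0 <= t)%R ->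
  [set x : 'rV[R]_k | (cube_dist a x <= t)%R] =
  [set x | (\sum_i itv_dist a (x ord0 i) ^+ 2 <= t ^+ 2)%R].
Proof.
move=> t0.
have E (x : 'rV[R]_k) : (cube_dist a x <= t)%R = (\sum_i itv_dist a (x ord0 i) ^+ 2 <= t ^+ 2)%R.
  by rewrite /cube_dist -{1}(ger0_norm t0) -sqrtr_sqr ler_sqrt ?sqr_ge0.
by apply/seteqP; split => x /=; rewrite E.
Qed.

(** The Gaussian of the distance to a cube is a product over coordinates. *)
Lemma wills_cube k (a : R) : (0 <= a)%R ->
  wills (dilate a (linf_ball R k)) = ((1 + 2 * a) ^+ k)%R.
Proof.
move=> a0; apply/EFin_inj; rewrite -(integral_gauss_cube k a0).
rewrite (wills_integral (rho := cube_dist a)).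
- apply: eq_integral => x _; rewrite /cube_dist sqr_sqrtr //; exact: sum_itv_dist_ge0.
- exact: measurable_cube_dist.
- by move=> x; exact: sqrtr_ge0.
- by move=> t t0; exact: cube_parallel.
have [alpha _ alphaE] := cube_parallel_volume k a0.
exists [ffun i : 'I_k.+1 => (alpha i / 'C(k, i)%:R)%R] => t t0.
rewrite cube_parallel // cube_parallel_sqr // alphaE //; congr EFin.
apply: eq_bigr => i _; rewrite ffunE; congr (_ * _)%R.
rewrite mulrC divfK // pnatr_eq0 -lt0n bin_gt0.
by rewrite -ltnS.
Qed.

End cube.

(** * The Euclidean inner product *)

Section dot.
Context {R : realType} {n : nat}.
Implicit Types x y z : 'rV[R]_n.

Definition dot x y : R := (x *m y^T) ord0 ord0.

Lemma dotE x y : dot x y = \sum_i x ord0 i * y ord0 i.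
Proof. by rewrite /dot mxE; apply: eq_bigr => i _; rewrite mxE. Qed.

Lemma dotC x y : dot x y = dot y x.
Proof. by rewrite !dotE; apply: eq_bigr => i _; rewrite mulrC. Qed.

Lemma dotDl x y z : dot (x + y) z = dot x z + dot y z.
Proof. by rewrite /dot mulmxDl mxE. Qed.

Lemma dotNl x y : dot (- x) y = - dot x y.
Proof. by rewrite /dot mulNmx mxE. Qed.

Lemma dotBl x y z : dot (x - y) z = dot x z - dot y z.
Proof. by rewrite dotDl dotNl. Qed.

Lemma dotZl a x y : dot (a *: x) y = a * dot x y.
Proof. by rewrite /dot -scalemxAl mxE. Qed.

Lemma dot_suml (I : finType) (f : I -> 'rV[R]_n) y :
  dot (\sum_i f i) y = \sum_i dot (f i) y.
Proof. by rewrite /dot mulmx_suml summxE. Qed.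

Lemma dotDr x y z : dot z (x + y) = dot z x + dot z y.
Proof. by rewrite dotC dotDl !(dotC z). Qed.

Lemma dotBr x y z : dot z (x - y) = dot z x - dot z y.
Proof. by rewrite dotC dotBl !(dotC z). Qed.

Lemma dotZr a x y : dot y (a *: x) = a * dot y x.
Proof. by rewrite dotC dotZl dotC. Qed.

Lemma dot_sqr x : dot x x = \sum_i x ord0 i ^+ 2.
Proof. by rewrite dotE; apply: eq_bigr => i _; rewrite expr2. Qed.

Lemma dot_ge0 x : 0 <= dot x x.
Proof. by rewrite dot_sqr sumr_ge0 // => i _; exact: sqr_ge0. Qed.

Lemma dot_eq0 x : (dot x x == 0) = (x == 0).
Proof.
apply/eqP/eqP => [|->]; last by rewrite /dot mul0mx mxE.
rewrite dot_sqr => /eqP; rewrite psumr_eq0 => [/allP x0|i _]; last exact: sqr_ge0.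
apply/rowP => i; rewrite mxE; apply/eqP.
by have := x0 i; rewrite mem_index_enum sqrf_eq0; apply.
Qed.

Lemma measurable_dot y : measurable_fun setT (dot^~ y : rvs n -> measurableTypeR R).
Proof.
apply: (eq_measurable_fun (fun x : rvs n => \sum_i (x : 'rV[R]_n) ord0 i * y ord0 i)).
  by move=> x _; rewrite -dotE.
by apply: measurable_sum => i; apply: measurable_funM => //; exact: measurable_coord.
Qed.

End dot.

(** * A lower bound for determinants of rank-one sums *)

Section weighted_determinant.
Context {R : realType} {I : finType} {n : nat}.
Variables (v : I -> 'rV[R]_n).

Definition rank_one_sum (w : I -> R) : 'M[R]_n := \sum_i w i *: ((v i)^T *m v i).

Local Notation toC := (real_complex R).
Local Notation "M ^t*" := (map_mx Num.conj (M ^T)) (at level 30).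

Let conj_toC (x : R) : (toC x)^* = toC x.
Proof. by apply: conj_Creal; rewrite complex_real. Qed.

(** The spectral theorem, applied over the complex numbers to the symmetric
matrix [rank_one_sum w]: [q i j] is the squared modulus of the [j]-th
coordinate of [v i] in an orthonormal eigenbasis, and [lam] lists the
eigenvalues. *)
Lemma rank_one_sum_diag w (c : I -> R) :
  (forall i, 0 <= c i) -> rank_one_sum c = 1%:M ->
  exists (q : I -> 'I_n -> R) (lam : 'I_n -> R),
    [/\ forall i j, 0 <= q i j,
        forall j, \sum_i c i * q i j = 1,
        forall i, \sum_j q i j = dot (v i) (v i),
        forall j, lam j = \sum_i w i * q i j &
        \det (rank_one_sum w) = \prod_j lam j].
Proof.
move=> c0 c1.
(* Real symmetric, hence hermitian and normal over the complex numbers. *)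
pose A := map_mx toC (rank_one_sum w).
have AtC : A^t* = A.
  rewrite /A map_trmx -map_mx_comp; apply/matrixP => i j.
  rewrite !mxE /= conj_toC; congr toC.
  by rewrite !summxE; apply: eq_bigr => l _; rewrite !mxE !big_ord1 !mxE mulrC [X in _ = _ * X]mulrC mulrC.
have An : A \is normalmx by apply/normalmxP; rewrite AtC.
set P := spectralmx A; set D := spectral_diag A.
have uP : P \is unitarymx := spectral_unitarymx A.
have AE : A = P^t* *m diag_mx D *m P.
  by rewrite -invmx_unitary //; apply/orthomx_spectralP.
have PP : P *m P^t* = 1%:M by apply/unitarymxP.
have PP' : P^t* *m P = 1%:M by apply: mulmx1C.
pose z i j : R[i] := (P *m map_mx toC (v i)^T) j ord0.
pose q i j : R := complex.Re (z i j) ^+ 2 + complex.Im (z i j) ^+ 2.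
have qE i j : toC (q i j) = z i j * (z i j)^*.
  by rewrite -normCK normc_def -rmorphXn /= sqr_sqrtr // addr_ge0 // sqr_ge0.
have rE (u : I -> R) j : (P *m map_mx toC (rank_one_sum u) *m P^t*) j j =
    toC (\sum_i u i * q i j).
  rewrite /rank_one_sum map_mx_sum mulmx_sumr mulmx_suml summxE rmorph_sum /=.
  apply: eq_bigr => i _; rewrite map_mxZ map_mxM -scalemxAr -scalemxAl mxE rmorphM /= qE.
  congr (_ * _); rewrite !mulmxA -(mulmxA (P *m _)) mxE big_ord1; congr (_ * _).
  rewrite /z !mxE rmorph_sum /=; apply: eq_bigr => k _.
  by rewrite !mxE rmorphM /= conj_toC mulrC.
exists q, (fun j => \sum_i w i * q i j); split => //.
- by move=> i j; rewrite addr_ge0 // sqr_ge0.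
- move=> j; apply: complexI; rewrite -rE c1 map_mx1 mulmx1 PP mxE eqxx.
  by rewrite rmorph1.
- move=> i; apply: complexI; rewrite rmorph_sum /= /dot.
  have -> : toC ((v i *m (v i)^T) ord0 ord0) =
      (map_mx toC (v i) *m (P^t* *m P) *m map_mx toC (v i)^T) ord0 ord0.
    by rewrite PP' mulmx1 -map_mxM [RHS]mxE.
  rewrite mulmxA -mulmxA mxE; apply: eq_bigr => j _; rewrite qE mulrC; congr (_ * _).
  rewrite /z !mxE rmorph_sum /=; apply: eq_bigr => k _.
  by rewrite !mxE rmorphM /= conj_toC mulrC.
apply: complexI; rewrite -det_map_mx -/A AE !det_mulmx det_diag mulrAC.
rewrite -det_mulmx PP' det1 mul1r rmorph_prod; apply: eq_bigr => j _ /=.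
rewrite -rE -/A AE !mulmxA PP mul1mx -mulmxA PP mulmx1.
by rewrite mxE eqxx mulr1n.
Qed.

Lemma ln_le_tangent (x y : R) : 0 < x -> 0 < y -> ln x <= ln y + (x / y - 1).
Proof.
move=> x0 y0; rewrite -lerBlDl -ln_div ?posrE //.
have := @le_ln1Dx R (x / y - 1); rewrite [1 + _]addrC subrK; apply.
by rewrite ltrBrDr addNr divr_gt0.
Qed.

(** Each eigenvalue [lam j] is the average of the [m i] with weights
[c i * q i j], so [ln (lam j)] is at least the average of the [ln (m i)] by
Jensen's inequality; add up over [j]. *)
Lemma ln_det_ge (c m : I -> R) :
  (forall i, 0 <= c i) -> (forall i, 0 < m i) -> rank_one_sum c = 1%:M ->
  0 < \det (rank_one_sum (fun i => c i * m i)) /\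
  \sum_i c i * dot (v i) (v i) * ln (m i)
    <= ln (\det (rank_one_sum (fun i => c i * m i))).
Proof.
move=> c0 m0 c1.
have [q [lam [q0 cq qv lamE ->]]] := rank_one_sum_diag (fun i => c i * m i) c0 c1.
have lam0 j : 0 < lam j.
  rewrite lamE lt_neqAle eq_sym sumr_ge0 ?andbT => [|i _]; last first.
    by rewrite !mulr_ge0 // (ltW (m0 i)).
  apply/negP; rewrite psumr_eq0 => [/allP H|i _]; last by rewrite !mulr_ge0 // (ltW (m0 i)).
  have /eqP := cq j; rewrite big1 ?(eq_sym 0) ?oner_eq0 // => i _.
  have := H i (mem_index_enum i); rewrite /= mulrAC mulf_eq0 => /orP[/eqP //|].
  by rewrite gt_eqF.
split; first by apply: prodr_gt0.
have -> : ln (\prod_j lam j) = \sum_j ln (lam j).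
  suff [] : 0 < \prod_j lam j /\ ln (\prod_j lam j) = \sum_j ln (lam j) by [].
  elim/big_rec2: _ => [|j y x _ [y0 <-]]; first by rewrite ln1 ltr01.
  by rewrite mulr_gt0 // lnM ?posrE.
under eq_bigr do rewrite -qv mulr_sumr mulr_suml.
rewrite exchange_big /=; apply: ler_sum => j _.
(* Jensen's inequality, by the tangent of [ln] at [lam j]. *)
apply: (@le_trans _ _ (\sum_i c i * q i j * (ln (lam j) + (m i / lam j - 1)))).
  apply: ler_sum => i _; apply: ler_wpM2l; first by rewrite mulr_ge0.
  exact: ln_le_tangent.
have -> : \sum_i c i * q i j * (ln (lam j) + (m i / lam j - 1)) =
    \sum_i c i * q i j * (ln (lam j) - 1) + \sum_i c i * m i * q i j / lam j.
  rewrite -big_split; apply: eq_bigr => i _ /=; ring.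
by rewrite -!mulr_suml cq -lamE mul1r divff ?subrK // gt_eqF.
Qed.

End weighted_determinant.

(** * Transport to the Gaussian *)

Section transport.
Context {R : realType}.
Local Notation leb := (@lebesgue_measure R).

Lemma antiderivative (f : R -> R) : continuous f ->
  leb.-integrable setT (EFin \o f) ->
  exists F : R -> R, forall x : R, is_derive x 1 F (f x).
Proof.
move=> cf intf.
exists (fun x => \int[leb]_(t in [set` Interval -oo%O (BRight x)]) f t) => x.
have [] := @continuous_FTC1 R f -oo%O x (x + 1) _ _ _ (cf x).
- by rewrite ltrDl.
- by apply: integrableS intf.
- by rewrite /Order.lt /=.
by move=> dF FE; rewrite -FE derive1E; exact: derivableP.
Qed.

Lemma integral_itv_antiderivative (f F : R -> R) (a b : R) : a < b ->
  continuous f -> (forall x : R, is_derive x 1 F (f x)) ->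
  (\int[leb]_(x in `[a, b]) (f x)%:E = (F b - F a)%:E)%E.
Proof.
move=> ab cf dF; rewrite (continuous_FTC2 ab (F := F)).
- by rewrite EFinB.
- exact: continuous_subspaceT.
- have cF x : F y @[y --> x] --> F x.
    by apply: differentiable_continuous; apply/derivable1_diffP; have [] := dF x.
  split => //.
    exact: cvg_at_right_filter.
  exact: cvg_at_left_filter.
- by move=> x _; rewrite derive1E; exact: (@derive_val _ _ _ _ _ _ _ (dF x)).
Qed.

Lemma continuous_of_derive (f F : R -> R) : (forall x : R, is_derive x 1 F (f x)) -> continuous F.
Proof.
move=> dF x; apply: differentiable_continuous; apply/derivable1_diffP; by have [] := dF x.
Qed.

Lemma mean_value (f F : R -> R) (a b : R) : a < b -> (forall x : R, is_derive x 1 F (f x)) ->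
  exists2 c, a < c < b & F b - F a = f c * (b - a).
Proof.
move=> ab dF; have [c] := MVT ab (fun x _ => dF x) (continuous_subspaceT (continuous_of_derive dF)).
by rewrite in_itv /= => cab E; exists c.
Qed.

Lemma integrable_gaussian : leb.-integrable setT (EFin \o gaussian).
Proof.
apply/integrableP; split.
  by apply/measurable_EFinP; apply: continuous_measurable_fun; exact: continuous_gaussian.
rewrite (_ : \int[_]_(_ in _) _ = 1)%E ?ltry // -(@integral_gauss_pi R).
by apply: eq_integral => x _ /=; rewrite ger0_norm // expR_ge0.
Qed.

(** All mass [< 1] of the Gaussian is already found on a bounded interval. *)
Lemma gaussian_mass_itv (G : R -> R) (rho : R) : (forall x : R, is_derive x 1 G (gaussian x)) ->
  rho < 1 -> exists2 S, 0 < S & rho < G S - G (- S).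
Proof.
move=> dG rho1.
have cv : (\int[leb]_(x in `[(- i%:R)%R, (i%:R)%R]) (gaussian x)%:E @[i --> \oo] -->
    \int[leb]_(x in \bigcup_i `[(- i%:R)%R, (i%:R)%R]%classic) (gaussian x)%:E)%E.
  apply: ge0_nondecreasing_set_cvg_integral.
  - move=> i j ij; apply/subsetPset => x /=; rewrite !in_itv /= -!ler_norml => /le_trans; apply.
    by rewrite ler_nat.
  - by [].
  - by move=> i; apply: measurable_funTS; apply/measurable_EFinP; apply: continuous_measurable_fun; exact: continuous_gaussian.
  - by move=> i x _; rewrite lee_fin expR_ge0.
have UE : \bigcup_i `[(- i%:R)%R, (i%:R)%R]%classic = [set: R].
  rewrite -subTset => x _; exists (Num.truncn `|x|).+1 => //=.
  by rewrite in_itv /= -ler_norml ltW // Num.Theory.truncnS_gt.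
rewrite UE integral_gauss_pi in cv.
apply: contrapT => H.
suff : (1 <= rho%:E :> \bar R)%E by rewrite lee_fin leNgt rho1.
rewrite -(cvg_lim (@ereal_hausdorff R) cv); apply: lime_le; first by apply/cvg_ex; exists 1%E.
exists 1%N => // i /= i0.
have i0' : 0 < i%:R :> R by rewrite ltr0n.
have ii : - i%:R < i%:R :> R by rewrite gtrN.
rewrite (integral_itv_antiderivative ii continuous_gaussian dG) lee_fin leNgt.
by apply/negP => h; apply: H; exists i%:R.
Qed.

Section grid.
Variables (phi : R -> R) (I L : R).
Hypotheses (cphi : continuous phi) (I0 : 0 < I) (L0 : 0 < L)
  (intphi : (\int[leb]_x (expR (phi x))%:E = I%:E)%E).

(** [T] is defined by equality of the masses of [expR phi] and of a Gaussian
with total mass [I * expR kappa] between the left end points and [t], [T t].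
The excess [expR kappa] of mass makes [T] bounded on [[-L, L]]: the Gaussian is
not exhausted there. The transport identity is stated for increments, by the
mean value theorem, since only difference quotients of [T] are used. *)
Lemma monotone_rearrangement (kappa : R) : 0 < kappa ->
  exists (T : R -> R) (S : R), [/\ 0 < S,
    forall t, `|t| <= L -> `|T t| <= S,
    forall t t', - L <= t -> t < t' -> t' <= L -> T t < T t' &
    forall t t', - L <= t -> t < t' -> t' <= L ->
      exists xi eta, [/\ t < xi < t', T t < eta < T t' &
        I * expR kappa * expR (- (pi * eta ^+ 2)) * (T t' - T t) = expR (phi xi) * (t' - t)]].
Proof.
move=> k0.
have cf : continuous (expR \o phi).
  by move=> x; apply: continuous_comp; [exact: cphi|exact: continuous_expR].
have [F dF] : exists F : R -> R, forall x : R, is_derive x 1 F (expR (phi x)).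
  apply: (antiderivative cf); apply/integrableP; split.
    by apply/measurable_EFinP; exact: continuous_measurable_fun.
  rewrite (_ : \int[_]_(_ in _) _ = I%:E)%E ?ltry // -intphi.
  by apply: eq_integral => x _ /=; rewrite ger0_norm // expR_ge0.
have [G dG] := antiderivative continuous_gaussian integrable_gaussian.
have k1 : expR (- kappa) < 1 by rewrite expR_lt1 oppr_lt0.
have [S S0 GS] := gaussian_mass_itv dG k1.
have Fmono a b : a < b -> F a < F b.
  move=> ab; have [c _ E] := mean_value ab dF.
  by rewrite -subr_gt0 E mulr_gt0 ?expR_gt0 ?subr_gt0.
have Gmono a b : a < b -> G a < G b.
  move=> ab; have [c _ E] := mean_value ab dG.
  by rewrite -subr_gt0 E mulr_gt0 ?expR_gt0 ?subr_gt0.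
have LL : - L < L by rewrite gtrN.
have FI : F L - F (- L) <= I.
  rewrite -lee_fin -(integral_itv_antiderivative LL cf dF) -intphi.
  apply: ge0_subset_integral => //=.
  by apply/measurable_EFinP; exact: continuous_measurable_fun.
pose J := I * expR kappa.
have J0 : 0 < J by rewrite mulr_gt0 ?expR_gt0.
(* The Gaussian mass, counted from the left, that [T t] must have. *)
pose v t := G (- S) + (F t - F (- L)) / J.
have vS t : `|t| <= L -> G (- S) <= v t <= G S.
  rewrite ler_norml => /andP[t1 t2].
  have Ft1 : 0 <= F t - F (- L).
    by rewrite subr_ge0; move: t1; rewrite le_eqVlt => /predU1P[->//|/Fmono/ltW].
  have Ft2 : F t - F (- L) <= I.
    apply: le_trans FI; rewrite lerD2r.
    by move: t2; rewrite le_eqVlt => /predU1P[->//|/Fmono/ltW].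
  rewrite lerDl divr_ge0 ?(ltW J0) //= /v -lerBrDl.
  apply: ltW; apply: le_lt_trans GS.
  by rewrite ler_pdivrMr // /J mulrCA -expRD addNr expR0 mulr1.
pose T t := xget 0 [set c | - S <= c <= S /\ G c = v t].
have TP t : `|t| <= L -> - S <= T t <= S /\ G (T t) = v t.
  move=> /vS /andP[v1 v2]; rewrite /T; case: xgetP => // H.
  have SS : - S <= S by rewrite ge0_cp ?ltW.
  have [|c] := @IVT R G (- S) S (v t) SS (continuous_subspaceT (continuous_of_derive dG)).
    by rewrite ge_min v1 le_max v2 orbT.
  by rewrite in_itv /= => cS Gc; case: (H c).
have absL t : - L <= t -> t <= L -> `|t| <= L by move=> *; rewrite ler_norml; apply/andP.
have Tmono t t' : - L <= t -> t < t' -> t' <= L -> T t < T t'.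
  move=> h1 h2 h3.
  have [_ E] := TP t (absL _ h1 (le_trans (ltW h2) h3)).
  have [_ E'] := TP t' (absL _ (le_trans h1 (ltW h2)) h3).
  have : G (T t) < G (T t').
    by rewrite E E' /v ltrD2l ltr_pM2r ?invr_gt0 // ltrD2r Fmono.
  by apply: contraTT; rewrite -!leNgt le_eqVlt => /predU1P[->//|/Gmono/ltW].
exists T, S; split => //.
  by move=> t /TP[]; rewrite ler_norml.
move=> t t' h1 h2 h3.
have [_ E] := TP t (absL _ h1 (le_trans (ltW h2) h3)).
have [_ E'] := TP t' (absL _ (le_trans h1 (ltW h2)) h3).
have [xi xi_in Exi] := mean_value h2 dF.
have [eta eta_in Eeta] := mean_value (Tmono t t' h1 h2 h3) dG.
exists xi, eta; split => //.
rewrite -Exi -mulrA -[expR (- (pi * eta ^+ 2)) * _]Eeta E E' /v -/J.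
by rewrite opprD addrACA subrr add0r -mulrBl opprB addrA subrK mulrC divfK // gt_eqF.
Qed.

(** Half-open, so that the cells are pairwise disjoint and one monotone affine
piece is attached to each point. *)
Definition cell (N k : nat) : set R :=
  [set t | - L + k%:R * (2 * L / N%:R) <= t < - L + k.+1%:R * (2 * L / N%:R)].

Lemma cell_cover N t : (0 < N)%N -> - L <= t < L -> exists k : 'I_N, cell N k t.
Proof.
move=> N0 /andP[t1 t2]; have N0' : 0 < N%:R :> R by rewrite ltr0n.
have h0 : 0 < 2 * L / N%:R by rewrite divr_gt0 // mulr_gt0.
pose u := (t + L) / (2 * L / N%:R).
have u0 : 0 <= u by rewrite divr_ge0 ?(ltW h0) // -lerBlDr sub0r.
have uk := Num.Theory.truncn_itv u0.
have kN : (Num.truncn u < N)%N.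
  rewrite -(@ltr_nat R); move: uk => /andP[/le_lt_trans + _]; apply.
  rewrite /u ltr_pdivrMr // mulrC divfK ?gt_eqF //; lra.
exists (Ordinal kN); move: uk; rewrite /cell /= /u ler_pdivlMr // ltr_pdivrMr //.
by move=> /andP[a b]; apply/andP; split; lra.
Qed.

(** The interpolation of [T] at the grid points, with slopes [m k]. The last
conclusion is the transport equation [expR phi = I * gaussian T * T'] in
logarithmic form; the error [kappa] absorbs the excess of mass and the
oscillation of [phi] and of the Gaussian over a cell, which is of order
[1 / N]. *)
Lemma piecewise_linear_transport (C kappa : R) : 0 <= C -> 0 < kappa ->
  (forall t t', `|t| <= L -> `|t'| <= L -> phi t <= phi t' + C * `|t - t'|) ->
  exists N0, forall N, (N0 <= N)%N -> (0 < N)%N -> exists m b : nat -> R,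
    [/\ forall k, (k < N)%N -> 0 < m k,
        forall k l t t', (k < N)%N -> (l < N)%N -> cell N k t -> cell N l t' -> t < t' ->
          m k * t + b k < m l * t' + b l &
        forall k t, (k < N)%N -> cell N k t ->
          phi t <= kappa + ln I + ln (m k) - pi * (m k * t + b k) ^+ 2].
Proof.
move=> C0 k0 lip; have k30 : 0 < kappa / 3 by rewrite divr_gt0.
have [T [S [S0 TS Tmono Tmv]]] := monotone_rearrangement k30.
pose J := I * expR (kappa / 3).
have J0 : 0 < J by rewrite mulr_gt0 ?expR_gt0.
(* A bound for the slopes [m k], by the transport identity on [[-L, L]]. *)
pose D := expR (phi 0 + C * L) * expR (pi * S ^+ 2) / J.
have D0 : 0 <= D by rewrite !mulr_ge0 ?expR_ge0 ?invr_ge0 ?(ltW J0).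
(* A Lipschitz bound, in [t], of [phi t + pi * T t ^ 2]. *)
pose E := C + 2 * pi * S * D.
have E0 : 0 <= E by rewrite addr_ge0 // mulr_ge0 // mulr_ge0 ?(ltW S0) // mulr_ge0 ?pi_ge0.
exists (Num.truncn (2 * L * E / (kappa / 3))).+1 => N N0N N0.
have N0' : 0 < N%:R :> R by rewrite ltr0n.
pose h := 2 * L / N%:R.
have h0 : 0 < h by rewrite divr_gt0 // mulr_gt0.
have hE : E * h <= kappa / 3.
  have : 2 * L * E / (kappa / 3) <= N%:R.
    by apply: ltW; apply: lt_le_trans (Num.Theory.truncnS_gt _) _; rewrite ler_nat.
  rewrite ler_pdivrMr // => H; rewrite /h mulrA ler_pdivrMr //.
  by rewrite [_ * N%:R]mulrC; apply: le_trans H; rewrite mulrC.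
have hN : N%:R * h = 2 * L by rewrite /h mulrC divfK // gt_eqF.
pose tau k : R := - L + k%:R * h.
have tauS k : tau k.+1 = tau k + h by rewrite /tau -natr1; ring.
have tau_le k l : (k <= l)%N -> tau k <= tau l.
  by move=> kl; rewrite lerD2l ler_wpM2r ?ler_nat // ltW.
have tau0 k : - L <= tau k by rewrite lerDl mulr_ge0 // ltW.
have tauN k : (k <= N)%N -> tau k <= L.
  by move=> /tau_le /le_trans; apply; rewrite /tau hN; lra.
have Tle t t' : - L <= t -> t <= t' -> t' <= L -> T t <= T t'.
  by move=> ?; rewrite le_eqVlt => /predU1P[-> //|?] ?; apply/ltW/Tmono.
have absL t : - L <= t -> t <= L -> `|t| <= L by move=> *; rewrite ler_norml; apply/andP.
pose m k := (T (tau k.+1) - T (tau k)) / h.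
pose b k := T (tau k) - m k * tau k.
have m0 k : (k < N)%N -> 0 < m k.
  move=> kN; rewrite divr_gt0 // subr_gt0; apply: Tmono => //; last exact: tauN.
  by rewrite tauS ltrDl.
have yE k t : m k * t + b k = T (tau k) + m k * (t - tau k) by rewrite /b; ring.
have yS k : T (tau k) + m k * h = T (tau k.+1).
  by rewrite /m divfK ?gt_eqF // addrC subrK.
have yge k t : (k < N)%N -> cell N k t -> T (tau k) <= m k * t + b k.
  by move=> kN /andP[k1 _]; rewrite yE lerDl mulr_ge0 ?subr_ge0 // ltW // m0.
have ylt k t : (k < N)%N -> cell N k t -> m k * t + b k < T (tau k.+1).
  move=> kN /andP[_ k2]; rewrite yE -yS ltrD2l ltr_pM2l ?m0 //.
  by rewrite ltrBlDl -tauS.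
exists m, b; split => //.
  move=> k l t t' kN lN ct ct' tt'.
  case: (ltngtP k l) => kl.
  - apply: lt_le_trans (ylt _ _ kN ct) _; apply: le_trans (yge _ _ lN ct').
    by apply: Tle => //; [exact: tau_le|exact: tauN (ltnW lN)].
  - case/andP: ct => ct _; case/andP: ct' => _ ct'.
    have := lt_le_trans ct' (tau_le _ _ kl); rewrite ltNge => /negP[].
    exact: le_trans ct (ltW tt').
  - by rewrite -kl ltrD2r ltr_pM2l // m0.
move=> k t kN ct.
have tk : tau k < tau k.+1 by rewrite tauS ltrDl.
have [xi [eta [/andP[xi1 xi2] /andP[eta1 eta2] JE]]] := Tmv _ _ (tau0 k) tk (tauN _ kN).
set y := m k * t + b k.
have y1 : T (tau k) <= y := yge _ _ kN ct.
have y2 : y < T (tau k.+1) := ylt _ _ kN ct.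
have mE : J * expR (- (pi * eta ^+ 2)) * m k = expR (phi xi).
  by rewrite /m mulrA JE tauS addrC addKr mulfK // gt_eqF.
have lnE : phi xi = ln I + kappa / 3 - pi * eta ^+ 2 + ln (m k).
  have mk0 := m0 k kN.
  rewrite -[LHS]expRK -mE lnM ?posrE ?(mulr_gt0 J0 (expR_gt0 _)) //.
  rewrite lnM ?posrE ?expR_gt0 // /J lnM ?posrE ?expR_gt0 //.
  by rewrite !expRK.
have [bT1 bT2] : `|T (tau k)| <= S /\ `|T (tau k.+1)| <= S.
  by split; apply: TS; apply: absL => //; [exact: tauN (ltnW kN)|exact: tauN].
move: bT1 bT2; rewrite !ler_norml => /andP[Tk1 Tk2] /andP[Tk3 Tk4].
have xiL : `|xi| <= L.
  by apply: absL; [exact: le_trans (tau0 k) (ltW xi1)|exact: le_trans (ltW xi2) (tauN _ kN)].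
have tL : `|t| <= L.
  case/andP: (ct) => c1 c2; apply: absL; first exact: le_trans (tau0 k) c1.
  by apply: ltW; apply: lt_le_trans c2 (tauN _ kN).
have dt : `|t - xi| <= h.
  case/andP: (ct) => c1 c2; move: c1 c2 xi1 xi2; rewrite -/h -/(tau k) -/(tau k.+1) tauS => *.
  by rewrite ler_norml; apply/andP; split; lra.
have mD : m k <= D.
  have -> : m k = expR (phi xi) * expR (pi * eta ^+ 2) / J.
    rewrite -mE expRN; have := expR_gt0 (pi * eta ^+ 2).
    by move: (expR _) => e e0; field; rewrite !gt_eqF.
  rewrite /D ler_pM2r ?invr_gt0 //; apply: ler_pM; rewrite ?expR_ge0 // ler_expR.
    have := lip xi 0 xiL; rewrite normr0 subr0 => /(_ (ltW L0)) /le_trans; apply.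
    by rewrite lerD2l ler_wpM2l.
  rewrite ler_pM2l ?pi_gt0 // -[leLHS]real_normK ?num_real // lerXn2r ?nnegrE ?(ltW S0) //.
  by rewrite ler_norml; apply/andP; split; lra.
have dy : y ^+ 2 - eta ^+ 2 <= 2 * S * (D * h).
  have d1 : `|y - eta| <= m k * h.
    by rewrite ler_norml; move: (yS k) => ?; apply/andP; split; lra.
  have d2 : `|y + eta| <= 2 * S.
    by rewrite ler_norml; apply/andP; split; lra.
  rewrite subr_sqr; apply: le_trans (ler_norm _) _; rewrite normrM mulrC.
  apply: ler_pM => //; apply: le_trans d1 _.
  by rewrite ler_wpM2r // ltW.
have := lip t xi tL xiL; rewrite lnE => lp.
have Ch : C * `|t - xi| <= C * h by rewrite ler_wpM2l.
have pdy : pi * (y ^+ 2 - eta ^+ 2) <= pi * (2 * S * (D * h)) by rewrite ler_pM2l ?pi_gt0.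
move: hE; rewrite /E mulrDl => hE.
have e1 : pi * (2 * S * (D * h)) = 2 * pi * S * D * h by ring.
rewrite e1 mulrBr in pdy.
move: lp Ch pdy hE; set q1 := C * `| _ |; set q2 := C * h; set q3 := 2 * pi * S * D * h; set q4 := pi * y ^+ 2; set q5 := pi * eta ^+ 2; set q6 := ln (m k); set q7 := ln I.
lra.
Qed.

End grid.
End transport.

(** * The geometric Brascamp-Lieb inequality *)

Section rank_one_sums.
Context {R : realType} {n : nat}.
Implicit Types x y : 'rV[R]_n.
Variables (I : finType) (v : I -> 'rV[R]_n).

Lemma mul_rank_one_sum (w : I -> R) x :
  x *m rank_one_sum v w = \sum_i (w i * dot x (v i)) *: v i.
Proof.
rewrite /rank_one_sum mulmx_sumr; apply: eq_bigr => i _.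
rewrite -scalemxAr mulmxA -scalerA; congr (_ *: _).
by rewrite [x *m _]mx11_scalar mul_scalar_mx.
Qed.

Lemma dot_rank_one_sum (w : I -> R) x y :
  dot (x *m rank_one_sum v w) y = \sum_i w i * dot x (v i) * dot (v i) y.
Proof. by rewrite mul_rank_one_sum dot_suml; apply: eq_bigr => i _; rewrite dotZl. Qed.

Lemma dot_decomposition (c : I -> R) x y : rank_one_sum v c = 1%:M ->
  dot x y = \sum_i c i * dot x (v i) * dot (v i) y.
Proof. by move=> c1; rewrite -dot_rank_one_sum c1 mulmx1. Qed.

End rank_one_sums.

Section brascamp_lieb.
Context {R : realType} {I : finType} {n : nat}.
Variables (v : I -> 'rV[R]_n) (c : I -> R).
Hypotheses (c0 : forall i, 0 <= c i) (c1 : rank_one_sum v c = 1%:M)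
  (cv : forall i, c i * dot (v i) (v i) = c i).
Local Notation leb := (@lebesgue_measure R).

(** The right-hand side minus the left-hand side is
[sum c_i (y_i - <v_i, th>) ^ 2], where [th] is the vector on the left. *)
Lemma dot_sum_le (y : I -> R) :
  dot (\sum_i (c i * y i) *: v i) (\sum_i (c i * y i) *: v i) <= \sum_i c i * y i ^+ 2.
Proof.
set th := \sum_i _ *: _; rewrite -subr_ge0.
have E1 : dot th th = \sum_i c i * y i * dot (v i) th.
  by rewrite {1}/th dot_suml; apply: eq_bigr => i _; rewrite dotZl.
have E2 : dot th th = \sum_i c i * dot (v i) th ^+ 2.
  by rewrite (dot_decomposition th th c1); apply: eq_bigr => i _; rewrite (dotC th) -mulrA -expr2.
have -> : \sum_i c i * y i ^+ 2 - dot th th = \sum_i c i * (y i - dot (v i) th) ^+ 2.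
  have -> : \sum_i c i * (y i - dot (v i) th) ^+ 2 =
     \sum_i c i * y i ^+ 2 - (\sum_i c i * y i * dot (v i) th) *+ 2 + \sum_i c i * dot (v i) th ^+ 2.
    rewrite -sumrMnl -sumrB -big_split; apply: eq_bigr => i _ /=; ring.
  rewrite -E1 -E2; ring.
by apply: sumr_ge0 => i _; rewrite mulr_ge0 // sqr_ge0.
Qed.

(** Pairing the difference of the images with [x - x'] gives a sum of
nonnegative terms [c_i (T_i - T'_i) <x - x', v_i>]. If it vanishes, so does each
[c_i <x - x', v_i> ^ 2]. *)
Lemma monotone_frame_injective (T T' : I -> R) (x x' : 'rV[R]_n) :
  (forall i, dot x (v i) < dot x' (v i) -> T i < T' i) ->
  (forall i, dot x' (v i) < dot x (v i) -> T' i < T i) ->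
  \sum_i (c i * T i) *: v i = \sum_i (c i * T' i) *: v i -> x = x'.
Proof.
move=> TT' T'T E.
have nonneg i : 0 <= c i * (T i - T' i) * (dot x (v i) - dot x' (v i)).
  rewrite -mulrA mulr_ge0 //; case: (ltgtP (dot x (v i)) (dot x' (v i))) => h.
  - by rewrite mulr_le0 // subr_le0 ltW // TT'.
  - by rewrite mulr_ge0 // subr_ge0 ltW // T'T.
  - by rewrite h subrr mulr0.
have sum0 : \sum_i c i * (T i - T' i) * (dot x (v i) - dot x' (v i)) = 0.
  transitivity (dot (\sum_i (c i * T i) *: v i - \sum_i (c i * T' i) *: v i) (x - x')).
    rewrite -sumrB dot_suml; apply: eq_bigr => i _.
    by rewrite -scalerBl -mulrBr dotZl dotBr !(dotC (v i)).
  by rewrite E subrr /dot mul0mx mxE.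
apply/eqP; rewrite -subr_eq0 -dot_eq0 (dot_decomposition _ _ c1) big1 // => i _.
have : c i * (T i - T' i) * (dot x (v i) - dot x' (v i)) == 0.
  move: sum0 => /eqP; rewrite psumr_eq0 => [/allP /(_ i (mem_index_enum i)) //|j _]; exact: nonneg.
rewrite !mulf_eq0 => /orP[/orP[/eqP ->|]|]; rewrite ?mul0r //.
  rewrite subr_eq0 => /eqP Ti; rewrite dotBl.
  case: (ltgtP (dot x (v i)) (dot x' (v i))) => h.
  - by have := TT' i h; rewrite Ti ltxx.
  - by have := T'T i h; rewrite Ti ltxx.
  - by rewrite h subrr mulr0 mul0r.
by rewrite dotBl => /eqP ->; rewrite mulr0 mul0r.
Qed.

Variables (phi : I -> R -> R) (mass : I -> R).
Hypotheses (cphi : forall i, continuous (phi i)) (mass0 : forall i, 0 < mass i)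
  (intphi : forall i, (\int[leb]_x (expR (phi i x))%:E = (mass i)%:E)%E)
  (lip : forall (L : R) i, exists2 C, 0 <= C & forall t t' : R,
     `|t| <= L -> `|t'| <= L -> phi i t <= phi i t' + C * `|t - t'|).

Let F (x : rvs n) : \bar R := (expR (\sum_i c i * phi i (dot x (v i))))%:E.

Let mF : measurable_fun setT F.
Proof.
apply/measurable_EFinP; apply: (measurableT_comp (@measurable_expR R)).
apply: measurable_sum => i; apply: measurable_funM => //.
apply: measurableT_comp (measurable_dot (v i)).
by apply: continuous_measurable_fun; exact: cphi.
Qed.

Let slab (L : R) : set (rvs n) := [set x | forall i, - L <= dot x (v i) < L].

Let measurable_slab L : measurable (slab L).
Proof.
rewrite (_ : slab L = \bigcap_(i in [set: I]) (dot^~ (v i) @^-1` `[- L, L[%classic)).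
  apply: fin_bigcap_measurable; first exact: finite_finset.
  by move=> i _; rewrite -[X in measurable X]setTI; exact: measurable_dot.
by apply/seteqP; split => x /= H i; [move=> _|]; move: (H i); rewrite /= in_itv; [|apply].
Qed.

(** On the set [C J] of points whose coordinates lie in the cells [J], the
piecewise linear transports form the affine map with linear part [A J] and
constant [be J]. The determinant estimate bounds the integrand by
[K * \det (A J)] times the Gaussian density at the image. After the affine
change of variables the images of different pieces do not overlap, and the Gaussian has total mass 1. *)
Lemma brascamp_lieb_slab (L kappa : R) : 0 < L -> 0 < kappa ->
  (\int[vmeas n]_(x in slab L) F x <=
   (expR (kappa * \sum_i c i + \sum_i c i * ln (mass i)))%:E)%E.
Proof.
move=> L0 k0.
have /choice[N0 HN0] : forall i, exists N0, forall N, (N0 <= N)%N -> (0 < N)%N ->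
    exists m b : nat -> R,
    [/\ forall k, (k < N)%N -> 0 < m k,
        forall k l t t', (k < N)%N -> (l < N)%N -> cell L N k t -> cell L N l t' -> t < t' ->
          m k * t + b k < m l * t' + b l &
        forall k t, (k < N)%N -> cell L N k t ->
          phi i t <= kappa + ln (mass i) + ln (m k) - pi * (m k * t + b k) ^+ 2].
  move=> i; have [C C0 lipC] := lip L i.
  exact: (piecewise_linear_transport (@cphi i) (mass0 i) L0 (intphi i) C0 k0 lipC).
pose N := (\max_i N0 i).+1.
have {HN0} /choice[m /choice[b mb]] : forall i, exists m b : nat -> R, _ :=
  fun i => HN0 i N (leq_trans (leq_bigmax i) (leqnSn _)) (ltn0Sn _).
pose A (J : {ffun I -> 'I_N}) := rank_one_sum v (fun i => c i * m i (J i)).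
pose be (J : {ffun I -> 'I_N}) := \sum_i (c i * b i (J i)) *: v i.
pose y (J : {ffun I -> 'I_N}) x i := m i (J i) * dot x (v i) + b i (J i).
have thE J x : x *m A J + be J = \sum_i (c i * y J x i) *: v i.
  rewrite mul_rank_one_sum -big_split; apply: eq_bigr => i _ /=.
  by rewrite -scalerDl /y mulrDr mulrA.
pose C (J : {ffun I -> 'I_N}) : set (rvs n) := [set x | forall i, cell L N (J i) (dot x (v i))].
have mC J : measurable (C J).
  rewrite (_ : C J = \bigcap_(i in [set: I]) (dot^~ (v i) @^-1`
      `[- L + (J i)%:R * (2 * L / N%:R), - L + (J i).+1%:R * (2 * L / N%:R)[%classic)).
    apply: fin_bigcap_measurable; first exact: finite_finset.
    by move=> i _; rewrite -[X in measurable X]setTI; exact: measurable_dot.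
  by apply/seteqP; split => x /= H i; [move=> _|]; move: (H i); rewrite /= in_itv; [|apply].
have mJ0 (J : {ffun I -> 'I_N}) i : 0 < m i (J i) by have [+ _ _] := mb i; apply.
have detA J : 0 < \det (A J) /\ \sum_i c i * ln (m i (J i)) <= ln (\det (A J)).
  have [d1 d2] := ln_det_ge c0 (mJ0 J) c1; split => //.
  by apply: le_trans d2; apply: ler_sum => i _; rewrite cv.
have uA J : A J \in unitmx by rewrite unitmxE unitfE gt_eqF //; have [] := detA J.
pose g (z : rvs n) := expR (- (pi * \sum_i (z : 'rV[R]_n) ord0 i ^+ 2)).
have g0 z : 0 <= g z := expR_ge0 _.
have mg : measurable_fun setT g.
  apply: (measurableT_comp (@measurable_expR R)).
  apply: (measurableT_comp (@oppr_measurable R setT)).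
  apply: measurable_funM => //; apply: measurable_sum => i.
  by apply: measurable_funX; exact: measurable_coord.
pose h J (z : rvs n) : R := \1_(C J) (((z : 'rV[R]_n) - be J) *m invmx (A J)) * g z.
have h0 J z : 0 <= h J z by rewrite mulr_ge0.
have mh J : measurable_fun setT (h J).
  apply: measurable_funM => //; apply: (measurableT_comp (measurable_indic (mC J))).
  apply: (measurableT_comp (measurable_linear (invmx (A J)))).
  exact: (measurable_shift_rv (- be J)).
pose K := expR (kappa * \sum_i c i + \sum_i c i * ln (mass i)).
have hth J x : h J (x *m A J + be J) = \1_(C J) x * g (x *m A J + be J).
  by rewrite /h addrK mulmxK.
(* The images of the pieces are disjoint: at most one term is nonzero. The
   cells of the common preimage determine [J]. *)
have sum_h z : \sum_J h J z <= g z.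
  have [[J CJ]|noJ] := pselect (exists J, C J ((z - be J) *m invmx (A J))); last first.
    rewrite big1 // => J _; rewrite /h indicE memNset ?mul0r // => CJ.
    by apply: noJ; exists J.
  rewrite (bigD1 J) //= big1 => [|J' J'J].
    by rewrite addr0 /h ler_piMl // indicE; case: (_ \in _).
  rewrite /h indicE memNset ?mul0r // => CJ'.
  set x := (z - be J) *m _ in CJ; set x' := (z - be J') *m _ in CJ'.
  have xE : x *m A J + be J = z by rewrite mulmxKV // subrK.
  have xE' : x' *m A J' + be J' = z by rewrite mulmxKV // subrK.
  have xx' : x = x'.
    apply: (@monotone_frame_injective (y J x) (y J' x')).
    - move=> i; have [_ + _] := mb i; apply => //.
    - move=> i; have [_ + _] := mb i; apply => //.
    - by rewrite -!thE xE xE'.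
  move/eqP: J'J; apply; apply/ffunP => i; apply/val_inj => /=.
  have := CJ i; have := CJ' i; rewrite -xx' /cell /=.
  have hN : 0 < 2 * L / N%:R by rewrite divr_gt0 ?mulr_gt0.
  move=> /andP[a1 a2] /andP[a3 a4].
  have := le_lt_trans a1 a4; have := le_lt_trans a3 a2.
  rewrite !ltrD2l !(ltr_pM2r hN) !ltr_nat !ltnS => e1 e2.
  by apply/eqP; rewrite eqn_leq e1 e2.
(* The three ingredients: the transport inequality in each coordinate, the
   determinant estimate, and [dot_sum_le]. *)
have FC J x : C J x -> expR (\sum_i c i * phi i (dot x (v i))) <=
    K * \det (A J) * g (x *m A J + be J).
  move=> CJ; have [d0 dln] := detA J.
  rewrite /K /g -(lnK (d0 : \det (A J) \in Num.pos)) -!expRD ler_expR -dot_sqr thE.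
  have := dot_sum_le (y J x); set th := dot _ _ => thy.
  apply: (@le_trans _ _ (\sum_i c i * (kappa + ln (mass i) + ln (m i (J i)) - pi * y J x i ^+ 2))).
    apply: ler_sum => i _; apply: ler_wpM2l => //.
    by have [_ _] := mb i; apply => //; exact: CJ.
  have -> : \sum_i c i * (kappa + ln (mass i) + ln (m i (J i)) - pi * y J x i ^+ 2) =
    kappa * \sum_i c i + \sum_i c i * ln (mass i) + \sum_i c i * ln (m i (J i)) - pi * \sum_i c i * y J x i ^+ 2.
    rewrite !mulr_sumr -sumrN -!big_split; apply: eq_bigr => i _ /=; ring.
  by rewrite lerD // ?lerD2l // lerN2 ler_pM2l ?pi_gt0.
apply: (@le_trans _ _ (\int[vmeas n]_x \sum_J (K * (`|\det (A J)| * h J (x *m A J + be J)))%:E)%E).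
  rewrite integral_mkcond; apply: ge0_le_integral => //.
  - by move=> x _; apply: erestrict_ge0 => z _; rewrite lee_fin expR_ge0.
  - exact: ((measurable_restrictT F (measurable_slab L)).1 (measurable_funTS mF)).
  - apply: emeasurable_sum => J; apply/measurable_EFinP.
    apply: measurable_funM => //; apply: measurable_funM => //.
    exact: (measurableT_comp (mh J) (measurable_affine (A J) (be J))).
  move=> x _; rewrite patchE; case: ifPn => [|_]; last first.
    by rewrite sumEFin lee_fin sumr_ge0 // => J _; rewrite !mulr_ge0 ?expR_ge0.
  rewrite inE => xs; rewrite sumEFin lee_fin.
  have /choice[J0 HJ0] : forall i, exists k : 'I_N, cell L N k (dot x (v i)).
    by move=> i; apply: cell_cover => //; exact: xs.
  pose J := [ffun i => J0 i].
  have CJ : C J x by move=> i; rewrite ffunE.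
  rewrite (bigD1 J) //=; apply: le_trans (FC J x CJ) _.
  rewrite hth indicE mem_set // mul1r gtr0_norm; last by have [] := detA J.
  by rewrite mulrA lerDl sumr_ge0 // => J' _; rewrite !mulr_ge0 ?expR_ge0.
rewrite ge0_integral_sum //; last 2 first.
- move=> J; apply/measurable_EFinP; apply: measurable_funM => //; apply: measurable_funM => //.
  exact: (measurableT_comp (mh J) (measurable_affine (A J) (be J))).
- by move=> J x _; rewrite lee_fin !mulr_ge0 ?expR_ge0.
have -> : (\sum_J \int[vmeas n]_x (K * (`|\det (A J)| * h J (x *m A J + be J)))%:E =
    \sum_J \int[vmeas n]_x (K%:E * (h J x)%:E))%E.
  apply: eq_bigr => J _.
  rewrite -(ge0_integral_vmeas_affine (be J) (uA J) (f := fun x => K%:E * (h J x)%:E)%E); last 2 first.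
  - by apply: measurable_funeM; exact/measurable_EFinP.
  - by move=> x; rewrite mule_ge0 ?lee_fin ?expR_ge0.
  rewrite -ge0_integralZl //; last 2 first.
  - apply: measurable_funeM; apply/measurable_EFinP.
    exact: (measurableT_comp (mh J) (measurable_affine (A J) (be J))).
  - by move=> x _; rewrite mule_ge0 ?lee_fin ?expR_ge0.
  by apply: eq_integral => x _; rewrite -!EFinM mulrCA.
rewrite -ge0_integral_sum //; last 2 first.
- by move=> J; apply: measurable_funeM; exact/measurable_EFinP.
- by move=> J x _; rewrite mule_ge0 ?lee_fin ?expR_ge0.
rewrite -/K -[leRHS]mule1 -(integral_gauss_rv n) -ge0_integralZl ?lee_fin ?expR_ge0 //; last first.
  exact/measurable_EFinP.
apply: ge0_le_integral => //.
- by move=> x _; apply: sume_ge0 => J _; rewrite mule_ge0 ?lee_fin ?expR_ge0.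
- by apply: emeasurable_sum => J; apply: measurable_funeM; exact/measurable_EFinP.
- by apply: measurable_funeM; exact/measurable_EFinP.
move=> x _; under eq_bigr do rewrite -EFinM.
by rewrite sumEFin -EFinM lee_fin -mulr_sumr ler_wpM2l ?expR_ge0.
Qed.

(** Exhaust the space by slabs and let [kappa] tend to 0. *)
Theorem brascamp_lieb :
  (\int[vmeas n]_x (expR (\sum_i c i * phi i (dot (x : 'rV[R]_n) (v i))))%:E <=
   (expR (\sum_i c i * ln (mass i)))%:E)%E.
Proof.
have cvF : (\int[vmeas n]_(x in slab k.+1%:R) F x @[k --> \oo] -->
    \int[vmeas n]_(x in \bigcup_k slab k.+1%:R) F x)%E.
  apply: ge0_nondecreasing_set_cvg_integral.
  - move=> k l kl; apply/subsetPset => x /= xk i; have /andP[x1 x2] := xk i.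
    have kl' : k.+1%:R <= l.+1%:R :> R by rewrite ler_nat.
    by rewrite (le_trans _ x1) ?(lt_le_trans x2) // lerN2.
  - by move=> k; exact: measurable_slab.
  - by move=> k; apply: measurable_funTS; exact: mF.
  - by move=> k x _; rewrite lee_fin expR_ge0.
have UE : \bigcup_k slab k.+1%:R = [set: rvs n].
  rewrite -subTset => x _; exists (Num.truncn (\sum_i `|dot x (v i)|)).+1 => //= i.
  have : `|dot x (v i)| < (Num.truncn (\sum_i `|dot x (v i)|)).+1%:R.
    apply: le_lt_trans (Num.Theory.truncnS_gt _).
    by rewrite (bigD1 i) //= lerDl sumr_ge0.
  rewrite ltr_norml => /andP[a1 a2]; rewrite (ltW (le_lt_trans _ a1)) ?(lt_trans a2) ?ltr_nat //.
  by rewrite lerN2 ler_nat.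
rewrite UE in cvF.
(* The estimate on slabs is uniform in the slab. *)
have bound kappa : 0 < kappa -> (\int[vmeas n]_x F x <=
   (expR (kappa * \sum_i c i + \sum_i c i * ln (mass i)))%:E)%E.
  move=> k0; rewrite -(cvg_lim (@ereal_hausdorff R) cvF).
  apply: lime_le; first by apply/cvg_ex; eexists; exact: cvF.
  by apply: nearW => k; exact: brascamp_lieb_slab.
rewrite -/F leNgt; apply/negP => H.
have sc0 : 0 <= \sum_i c i by exact: sumr_ge0.
set q := \sum_i c i * ln (mass i) in bound H.
have : (\int[vmeas n]_x F x)%E \is a fin_num.
  rewrite ge0_fin_numE; first by apply: le_lt_trans (bound 1 ltr01) _; rewrite ltry.
  by apply: integral_ge0 => x _; rewrite lee_fin expR_ge0.
move: H bound; case: (\int[vmeas n]_x F x)%E => [X| |] //; rewrite lte_fin => H bound _.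
have X0 : 0 < X by apply: lt_trans H; exact: expR_gt0.
have qX : q < ln X by rewrite -ltr_expR lnK.
pose s := \sum_i c i + 1; have s0 : 0 < s by rewrite ltr_wpDl.
have k0 : 0 < (ln X - q) / s / 2 by rewrite !divr_gt0 // subr_gt0.
have := bound _ k0; rewrite lee_fin -{1}(lnK (X0 : X \in Num.pos)) ler_expR.
apply/negP; rewrite -ltNge -ltrBrDr.
have : (ln X - q) / s / 2 * \sum_i c i <= (ln X - q) / s / 2 * s.
  by rewrite ler_wpM2l ?(ltW k0) // /s lerDl.
have -> : (ln X - q) / s / 2 * s = (ln X - q) / 2 by field; rewrite gt_eqF.
by move=> /le_lt_trans; apply; lra.
Qed.

End brascamp_lieb.

(** * Compactness, continuity and separation *)

Section convex_geometry.
Context {R : realType}.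

Lemma continuous_bigsum (T : topologicalType) (I : finType) (f : I -> T -> R) :
  (forall i, continuous (f i)) -> continuous (fun x => \sum_i f i x).
Proof.
move=> cf x; apply: (@cvg_big _ _ +%R 0 xpredT _ T (nbhs x)); first exact: add_continuous.
by move=> i _; exact: cf.
Qed.

Lemma closed_sublevel (T : topologicalType) (f : T -> R) (a : R) :
  continuous f -> closed [set x | f x <= a].
Proof.
by move=> cf; apply: (preimage_closed (D := [set y | y <= a])); [move=> x _; exact: cf|exact: closed_le].
Qed.

Lemma closed_level (T : topologicalType) (f : T -> R) (a : R) :
  continuous f -> closed [set x | f x = a].
Proof.
by move=> cf; apply: (preimage_closed (D := [set y | y = a])); [move=> x _; exact: cf|exact: closed_eq].
Qed.

Lemma open_superlevel (T : topologicalType) (f : T -> R) (a : R) :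
  continuous f -> open [set x | a < f x].
Proof.
by move=> cf; apply: (open_comp (D := [set y | a < y])); [move=> x _; exact: cf|exact: open_gt].
Qed.

Lemma compact_in_box n (A : set 'rV[R]_n) (M : R) : closed A ->
  (forall x, A x -> forall i, `|x ord0 i| <= M) -> compact A.
Proof.
move=> cA AM.
have cbox : compact [set v : 'rV[R]_n | forall i, v ord0 i \in `[- M, M]].
  apply: (@rV_compact R n (fun=> `[- M, M]%classic)) => _; exact: segment_compact.
by apply: subclosed_compact cA cbox _ => x Ax i; rewrite in_itv /= -ler_norml; exact: AM.
Qed.

Lemma continuous_coord n (i : 'I_n) : continuous (fun x : 'rV[R]_n => x ord0 i).
Proof. exact: coord_continuous. Qed.

Lemma continuous_dot n (y : 'rV[R]_n) : continuous (dot^~ y).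
Proof.
rewrite (_ : dot^~ y = fun x : 'rV[R]_n => \sum_i x ord0 i * y ord0 i); last first.
  by apply/funext => x; rewrite dotE.
apply: continuous_bigsum => i x; apply: continuousM; [exact: continuous_coord|exact: cst_continuous].
Qed.

Lemma continuous_quad n (H : 'M[R]_n) : continuous (fun x : 'rV[R]_n => dot (x *m H) x).
Proof.
rewrite (_ : (fun x => _) = fun x : 'rV[R]_n => \sum_i (dot x (row i H^T)) * x ord0 i); last first.
  apply/funext => x; rewrite dotE; apply: eq_bigr => i _; congr (_ * _).
  by rewrite dotE mxE; apply: eq_bigr => j _; rewrite !mxE.
apply: continuous_bigsum => i x; apply: (@continuousM _ _ (dot^~ (row i H^T)) (fun y : 'rV[R]_n => y ord0 i)); [exact: continuous_dot|exact: continuous_coord].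
Qed.

Lemma continuous_dot_sqr n : continuous (fun x : 'rV[R]_n => dot x x).
Proof.
by have := @continuous_quad n 1%:M; under eq_fun do rewrite mulmx1.
Qed.

Lemma dot_sqrB n (x y : 'rV[R]_n) :
  dot (x - y) (x - y) = dot x x - 2 * dot x y + dot y y.
Proof. by rewrite dotBl !dotBr (dotC y x); ring. Qed.

Lemma convex_combination n (K : set 'rV[R]_n) (x y : 'rV[R]_n) (t : R) :
  convex_set (K : set (convex_lmodType 'rV[R]_n)) -> K x -> K y -> 0 <= t <= 1 ->
  K (t *: x + (1 - t) *: y).
Proof.
move=> cK Kx Ky /andP[t0 t1].
by have := cK x y (Itv01 t0 t1) (mem_set Kx) (mem_set Ky); rewrite inE.
Qed.

(** The derivative at 0 of a quadratic function that is minimal at 0. *)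
Lemma first_order_le (a b : R) : 0 <= b ->
  (forall t, 0 < t <= 1 -> 0 <= t * a + t ^+ 2 * b) -> 0 <= a.
Proof.
move=> b0 H; rewrite leNgt; apply/negP => a0.
have b1 : 0 < b + 1 by rewrite ltr_wpDl.
(* Then [t * b < - a], so the quadratic function is negative at [t]. *)
pose t := Num.min 1 (- a / 2 / (b + 1)).
have t0 : 0 < t by rewrite lt_min ltr01 !divr_gt0 // oppr_gt0.
have := H t; rewrite t0 ge_min lexx /= => /(_ isT).
rewrite expr2 -mulrA -mulrDr pmulr_rge0 //; apply/negP; rewrite -ltNge.
have : t * (b + 1) <= - a / 2 by rewrite -ler_pdivlMr // ge_min lexx orbT.
by move: t0; rewrite mulrDr mulr1 => *; lra.
Qed.

(** The direction from the nearest point of [K] to [x]. *)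
Lemma separation n (K : set 'rV[R]_n) (x : 'rV[R]_n) :
  compact K -> convex_set (K : set (convex_lmodType 'rV[R]_n)) -> K !=set0 -> ~ K x ->
  exists theta, theta != 0 /\ forall z, K z -> dot z theta < dot x theta.
Proof.
move=> cK vK K0 nKx.
have cf : continuous (fun z : 'rV[R]_n => dot z z - 2 * dot z x + dot x x).
  move=> z; apply: (@continuousD _ _ _ (fun z => dot z z - 2 * dot z x) (fun=> dot x x)); last exact: cst_continuous.
  apply: (@continuousB _ _ _ (fun z => dot z z) (fun z => 2 * dot z x)); first exact: continuous_dot_sqr.
  by apply: (@continuousM _ _ (fun=> 2) (dot^~ x)); [exact: cst_continuous|exact: continuous_dot].
have [z0] := compact_EVT_min K0 cK (continuous_subspaceT cf).
rewrite inE => Kz0 zmin.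
have t0 : x - z0 != 0 by rewrite subr_eq0; apply/eqP => xz; apply: nKx; rewrite xz.
exists (x - z0); split => // z Kz.
have : 0 <= - (2 * dot (z - z0) (x - z0)).
  apply: (@first_order_le _ (dot (z - z0) (z - z0))); first exact: dot_ge0.
  move=> t /andP[tp t1].
  have Kt : K (t *: z + (1 - t) *: z0) by apply: convex_combination => //; rewrite (ltW tp).
  have := zmin _ (mem_set Kt); rewrite -!dot_sqrB.
  have -> : t *: z + (1 - t) *: z0 - x = t *: (z - z0) - (x - z0).
    by apply/rowP => i; rewrite !mxE; ring.
  rewrite (dot_sqrB (t *: _)) !dotZl !dotZr.
  have -> : dot (z0 - x) (z0 - x) = dot (x - z0) (x - z0).
    by rewrite !dot_sqrB (dotC z0 x); ring.
  by move=> h; rewrite expr2; lra.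
rewrite oppr_ge0 pmulr_rle0 // => zz.
have pos : 0 < dot (x - z0) (x - z0) by rewrite lt_neqAle eq_sym dot_eq0 t0 dot_ge0.
move: zz pos; rewrite (dotBl z z0) (dotBl x z0); lra.
Qed.

Lemma dot_cauchy_schwarz n (x y : 'rV[R]_n) : dot x y ^+ 2 <= dot x x * dot y y.
Proof.
have [->|y0] := eqVneq y 0; first by rewrite {1 3}/dot trmx0 !mulmx0 mxE expr0n mulr0.
have pos : 0 < dot y y by rewrite lt_neqAle eq_sym dot_eq0 y0 dot_ge0.
have := dot_ge0 (dot y y *: x - dot x y *: y).
rewrite dot_sqrB !dotZl !dotZr => h.
have : 0 <= dot y y * (dot x x * dot y y - dot x y ^+ 2) by apply: le_trans h _; rewrite le_eqVlt; apply/orP; left; apply/eqP; ring.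
by rewrite pmulr_rge0 // subr_ge0.
Qed.

(** The operator norm is at most the Hilbert-Schmidt norm. *)
Lemma dot_mulmx_le n (H : 'M[R]_n) (x : 'rV[R]_n) :
  dot (x *m H) (x *m H) <= (\sum_j dot (row j H^T) (row j H^T)) * dot x x.
Proof.
rewrite dot_sqr mulr_suml; apply: ler_sum => j _.
rewrite mulrC; apply: le_trans (dot_cauchy_schwarz _ _).
by rewrite le_eqVlt; apply/orP; left; apply/eqP; congr (_ ^+ 2); rewrite dotE mxE; apply: eq_bigr => k _; rewrite !mxE.
Qed.

End convex_geometry.

(** * Optimality of the unit ball *)

Lemma ball_dotE {R : realType} n (x : 'rV[R]_n) : (enorm x <= 1) = (dot x x <= 1).
Proof. by rewrite /enorm -dot_sqr -{1}sqrtr1 ler_sqrt ?ler01. Qed.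

Lemma char_poly_horner {R : comNzRingType} n (A : 'M[R]_n) (x : R) :
  (char_poly A).[x] = \det (x%:M - A).
Proof.
rewrite -[LHS]/(horner_eval x _) -det_map_mx; congr (\det _).
by apply/matrixP => i j; rewrite !mxE /= /horner_eval hornerD hornerN hornerMn hornerX hornerC.
Qed.

Section john_optimality.
Context {R : realType} {n : nat}.
Variable K : set 'rV[R]_n.
Hypotheses (n0 : (0 < n)%N) (cK : compact K)
  (vK : convex_set (K : set (convex_lmodType 'rV[R]_n))) (hJ : john_position K).

Lemma john_ball x : dot x x <= 1 -> K x.
Proof. by rewrite -ball_dotE => xB; have [BK _] := hJ; exact: BK. Qed.

(** Maximality of the unit ball, for origin-centred ellipsoids. *)
Lemma john_det_le1 (A : 'M[R]_n) : A \in unitmx ->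
  (forall y, dot y y <= 1 -> K (y *m A)) -> `|\det A| <= 1.
Proof.
move=> uA AK; have [_ /(_ [set 0 + x *m A | x in euclidean_ball R n])] := hJ.
have EE : [set 0 + x *m A | x in euclidean_ball R n] = [set x | enorm (x *m invmx A) <= 1].
  apply/seteqP; split => [_ [x xB <-]|x xB]; first by rewrite /= add0r mulmxK.
  by exists (x *m invmx A) => //; rewrite add0r mulmxKV.
have ell : ellipsoid [set 0 + x *m A | x in euclidean_ball R n] by exists A, 0.
have EK : [set 0 + x *m A | x in euclidean_ball R n] `<=` K.
  by move=> _ [x + <-]; rewrite /euclidean_ball /= ball_dotE add0r; exact: AK.
move=> /(_ ell EK).
rewrite !volumeE EE.
have mE : measurable ([set x : 'rV[R]_n | enorm (x *m invmx A) <= 1] : set (rvs n)).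
  have -> : [set x : 'rV[R]_n | enorm (x *m invmx A) <= 1] =
    (fun x : 'rV[R]_n => x *m invmx A) @^-1` [set x | enorm x <= 1] by [].
  rewrite -[X in measurable X]setTI; apply: measurable_linear => //.
  exact: measurable_enorm_le.
rewrite -(vmeas_linear_preimage uA mE) (_ : [set x | _] = euclidean_ball R n); last first.
  by apply/seteqP; split => x /=; rewrite mulmxK.
have [v v0 [vE _]] := ball_volume (R := R) n.
rewrite -volumeE vE -EFinM lee_fin => h.
by rewrite -(ler_pM2r v0) mul1r.
Qed.

(** The points where [K] and the unit ball have a common supporting
hyperplane. *)
Definition contact : set 'rV[R]_n :=
  [set u | dot u u = 1 /\ forall x, K x -> dot x u <= 1].

Section improving_direction.
Variables (H : 'M[R]_n) (delta : R).
Hypotheses (symH : H^T = H) (trH : \tr H = 0) (d0 : 0 < delta)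
  (Hcontact : forall u, contact u -> dot (u *m H) u <= - delta).

(** The directions in question are away from the contact points, so the support
function of [K] exceeds 1 there; by compactness it does so uniformly. *)
Lemma support_gap : exists2 gap : R, 0 < gap &
  forall theta : 'rV[R]_n, dot theta theta = 1 -> - (delta / 2) <= dot (theta *m H) theta ->
    exists2 z, K z & 1 + gap < dot z theta.
Proof.
pose Q : set 'rV[R]_n := [set th | dot th th = 1] `&` [set th | dot (th *m (- H)) th <= delta / 2].
have cQ : compact Q.
  apply: (@compact_in_box _ _ _ 1).
    apply: closedI; first exact: closed_level (@continuous_dot_sqr R n).
    exact: closed_sublevel (@continuous_quad R n (- H)).
  move=> th [th1 _] i; rewrite -(@ler_pXn2r _ 2) ?nnegrE // real_normK ?num_real // expr1n.
  by rewrite -[leRHS]th1 dot_sqr (bigD1 i) //= lerDl sumr_ge0 // => j _; exact: sqr_ge0.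
(* An open cover of [Q], increasing in [k]. *)
pose f (k : nat) : set 'rV[R]_n := \bigcup_(z in K) [set th | 1 + k.+1%:R^-1 < dot z th].
have of_ k : [set: nat] k -> open (f k).
  move=> _; apply: bigcup_open => z _.
  rewrite (_ : [set th | _] = [set th | 1 + k.+1%:R^-1 < dot th z]).
    by apply: open_superlevel; exact: continuous_dot.
  by apply/seteqP; split => th /=; rewrite dotC.
have Qf : Q `<=` cover [set: nat] f.
  move=> th [th1 th2].
  have [z [Kz zth]] : exists z, K z /\ 1 < dot z th.
    apply: contrapT => nz.
    have cth : contact th.
      split => // x Kx; rewrite leNgt; apply/negP => h; apply: nz; by exists x.
    have := Hcontact cth; move: th2; rewrite /= mulmxN dotNl.
    by move: d0; set q := dot _ _ => ? ? ?; lra.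
  exists (Num.truncn (dot z th - 1)^-1) => //; exists z => //=.
  have pos : 0 < dot z th - 1 by rewrite subr_gt0.
  rewrite addrC -ltrBrDr -[ltRHS]invrK ltf_pV2 ?posrE ?invr_gt0 //.
  exact: Num.Theory.truncnS_gt.
move: cQ; rewrite compact_cover => /(_ _ _ _ of_ Qf)[D _ QD].
pose k0 := \max_(k <- finmap.enum_fset D) k.
exists k0.+1%:R^-1; first by rewrite invr_gt0.
move=> th th1 th2.
have /QD[k kD [z Kz zth]] : Q th by split => //=; rewrite mulmxN dotNl lerNl.
exists z => //; apply: le_lt_trans zth.
rewrite lerD2l lef_pV2 ?posrE // ler_nat ltnS.
by apply: (leq_bigmax_seq _ kD).
Qed.

(** The coefficient of [e] in [\det (1%:M + e *: H)] is the trace of [H],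
which is 0, and the higher terms are [O (e ^ 2)]. *)
Lemma det_perturbation : exists2 C : R, 0 <= C &
  forall e, 0 < e <= 1 -> 1 - C * e ^+ 2 <= \det (1%:M + e *: H).
Proof.
pose p := char_poly (- H).
exists (\sum_(k < n.-1) `|p`_k|); first exact: sumr_ge0.
move=> e /andP[e0 e1].
have -> : \det (1%:M + e *: H) = e ^+ n * p.[e^-1].
  rewrite /p char_poly_horner -detZ; congr (\det _).
  by rewrite opprK scalerDr scale_scalar_mx mulfV // gt_eqF.
have sum_top (F : nat -> R) : \sum_(i < n.+1) F i = \sum_(i < n.-1) F i + F n.-1 + F n.
  by case: n n0 => // m _; rewrite !big_ord_recr.
rewrite horner_coef size_char_poly (sum_top (fun i => p`_i * e^-1 ^+ i)).
have -> : p`_n.-1 = 0 by rewrite char_poly_trace // raddfN /= trH !oppr0.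
have -> : p`_n = 1.
  by have /monicP := char_poly_monic (- H); rewrite lead_coefE size_char_poly.
rewrite mul0r addr0 mul1r mulrDr exprVn mulfV ?expf_neq0 ?gt_eqF // [leRHS]addrC lerD2l.
rewrite mulr_sumr mulr_suml -sumrN; apply: ler_sum => i _.
have i2 : (i + 2 <= n)%N by have := ltn_ord i; lia.
have -> : e ^+ n * (p`_i * e^-1 ^+ i) = p`_i * e ^+ (n - i).
  rewrite exprVn mulrCA; congr (_ * _).
  by rewrite -{1}(@subnK i n) ?exprD ?mulfK ?expf_neq0 ?gt_eqF //; lia.
rewrite -mulNr; apply: le_trans (_ : - `|p`_i| * e ^+ (n - i) <= _).
  by rewrite !mulNr lerN2 ler_wpM2l // ler_wiXn2l ?(ltW e0) //; lia.
by rewrite ler_wpM2r ?exprn_ge0 ?(ltW e0) // lerNl -normrN ler_norm.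
Qed.

(** If [H] is traceless and at most [- delta] on contact points, the ellipsoid
that is the image of the ball under [(1 + eta e) (1 + e H)] has volume greater
than the ball: [H] costs only [O (e ^ 2)]. For small [e] it lies in [K]:
a separating direction [th] where [H] is negative is excluded since the
ellipsoid has width [< 1] there, and any other one since the support function of
[K] is at least [1 + gap] there while the ellipsoid has width
[1 + O (e)]. *)
Lemma no_improving_direction : False.
Proof.
have [gap gap0 hgap] := support_gap.
have [C C0 detC] := det_perturbation.
pose h2 := \sum_j dot (row j H^T) (row j H^T).
have h20 : 0 <= h2 by apply: sumr_ge0 => j _; exact: dot_ge0.
(* The dilation [1 + eta e] must compensate the second-order loss of volume,
   but grow less than [H] shrinks the ellipsoid, by [e * delta / 2], in the
   directions without gap. *)
pose eta := delta / 4.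
have eta0 : 0 < eta by rewrite divr_gt0.
pose P := h2 * (1 + 2 * eta + eta ^+ 2).
have P0 : 0 <= P by rewrite mulr_ge0 // addr_ge0 ?sqr_ge0 // addr_ge0 // mulr_ge0 // ltW.
pose M := (2 * eta + eta ^+ 2) + (2 * h2 + 1) + (2 * eta + eta ^+ 2) * (2 * h2 + 1).
have M0 : 0 <= M.
  by rewrite /M; have := sqr_ge0 eta; have := mulr_ge0 (ltW eta0) h20; have := mulr_ge0 (sqr_ge0 eta) h20; nra.
have CE : 0 <= C * (1 + eta) by rewrite mulr_ge0 // addr_ge0 // ltW.
(* The three bounds on [e] serve the directions without gap, the directions
   with gap, and the volume, in this order. *)
pose e := Num.min 1 (Num.min (delta / 2 / (P + 1)) (Num.min (gap / (M + 1)) (eta / (C * (1 + eta) + 1)))).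
have e0 : 0 < e.
  by rewrite !lt_min ltr01 !divr_gt0 // ltr_wpDl.
have e1 : e <= 1 by rewrite ge_min lexx.
have eP : e * (P + 1) <= delta / 2.
  by rewrite -ler_pdivlMr ?ltr_wpDl // !ge_min lexx !orbT.
have eM : e * (M + 1) <= gap.
  by rewrite -ler_pdivlMr ?ltr_wpDl // !ge_min lexx !orbT.
have eC : e * (C * (1 + eta) + 1) <= eta.
  by rewrite -ler_pdivlMr ?ltr_wpDl // !ge_min lexx !orbT.
have e2 : e ^+ 2 <= e by rewrite expr2 ler_piMl // ltW.
have e20 : 0 < e ^+ 2 by rewrite exprn_gt0.
pose B := 1%:M + e *: H; pose A := (1 + eta * e) *: B.
have B0 : 1 - C * e ^+ 2 <= \det B by apply: detC; rewrite e0.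
have s1 : 1 <= 1 + eta * e by rewrite lerDl mulr_ge0 // ltW.
have detA : 1 < \det A.
  have Ce2 : 0 < 1 - C * e ^+ 2.
    have h1 : C * e ^+ 2 <= C * e by rewrite ler_wpM2l.
    have h3 : e * C * (1 + eta) < 1 + eta.
      by apply: le_lt_trans (_ : eta < _); [rewrite -mulrA; lra|lra].
    have h4 : e * C < 1 by move: h3; rewrite gtr_pMl // addr_gt0.
    by rewrite subr_gt0 (le_lt_trans h1) // mulrC.
  rewrite detZ; apply: (@lt_le_trans _ _ ((1 + eta * e) * (1 - C * e ^+ 2))).
    have h5 : e * (e * (C * (1 + eta) + 1)) <= e * eta by rewrite ler_wpM2l // ltW.
    have h6 : eta * e * (C * e ^+ 2) <= eta * (C * e ^+ 2).
      by rewrite -mulrA ler_wpM2l ?(ltW eta0) // ler_piMl // mulr_ge0 // ltW.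
    have h7 : (1 + eta * e) * (1 - C * e ^+ 2) = 1 + e * eta - C * e ^+ 2 - eta * e * (C * e ^+ 2) by ring.
    have h8 : e * (e * (C * (1 + eta) + 1)) = C * e ^+ 2 + eta * (C * e ^+ 2) + e ^+ 2 by ring.
    rewrite h7; rewrite h8 in h5; lra.
  apply: ler_pM => //; [exact: le_trans s1|exact: ltW|].
  by rewrite -[leLHS]expr1 ler_weXn2l.
have uA : A \in unitmx by rewrite unitmxE unitfE gt_eqF // (lt_trans ltr01).
have dot00 : dot (0 : 'rV[R]_n) 0 <= 1 by rewrite /dot mul0mx mxE.
have AK y : dot y y <= 1 -> K (y *m A).
  move=> y1; apply: contrapT => nK.
  have [th' [th'0 sep]] := separation cK vK (ex_intro _ 0 (john_ball dot00)) nK.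
  have [th th1 {}sep] : exists2 th, dot th th = 1 & forall z, K z -> dot z th < dot (y *m A) th.
    have r0 : 0 < Num.sqrt (dot th' th').
      by rewrite sqrtr_gt0 lt_neqAle eq_sym dot_eq0 th'0 dot_ge0.
    exists ((Num.sqrt (dot th' th'))^-1 *: th').
      rewrite dotZl dotZr mulrA -expr2 exprVn sqr_sqrtr ?dot_ge0 // mulVf //.
      by rewrite dot_eq0.
    by move=> z /sep; rewrite !dotZr ltr_pM2l // invr_gt0.
  have symA : A^T = A by rewrite /A /B linearZ /= linearD /= linearZ /= symH tr_scalar_mx.
  have dE : dot (y *m A) th = dot y (th *m A).
    by rewrite /dot -mulmxA trmx_mul symA.
  have bnd : dot (y *m A) th ^+ 2 <= dot (th *m A) (th *m A).
    rewrite dE; apply: le_trans (dot_cauchy_schwarz _ _) _.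
    by rewrite ler_piMl // dot_ge0.
  pose q := dot (th *m H) th; pose w := dot (th *m H) (th *m H).
  have thA : dot (th *m A) (th *m A) = (1 + eta * e) ^+ 2 * (1 + 2 * e * q + e ^+ 2 * w).
    have -> : th *m A = (1 + eta * e) *: (th + e *: (th *m H)).
      by rewrite /A /B -scalemxAr mulmxDr mulmx1 -scalemxAr.
    by rewrite dotZl dotZr !dotDl !dotDr !dotZl !dotZr th1 (dotC th) -/q -/w; ring.
  have wh : w <= h2 by have := dot_mulmx_le H th; rewrite th1 mulr1.
  have w0 : 0 <= w by exact: dot_ge0.
  rewrite thA in bnd.
  have f1 : (1 + eta * e) ^+ 2 = 1 + 2 * eta * e + eta ^+ 2 * e ^+ 2 by ring.
  (* The first case contradicts that the unit ball is in [K], the second one that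
     [K] exceeds [1 + gap] in direction [th]. *)
  have [qd|qd] := leP q (- (delta / 2)).
    have Kth : K th by apply: john_ball; rewrite th1.
    have := sep th Kth; rewrite th1 => lt1.
    have : 1 < dot (y *m A) th ^+ 2 by rewrite exprn_egt1.
    apply/negP; rewrite -leNgt; apply: le_trans bnd _.
    have g1 : 1 + 2 * e * q + e ^+ 2 * w <= 1 - 4 * eta * e + e ^+ 2 * h2.
      have a1 : e ^+ 2 * w <= e ^+ 2 * h2 by rewrite ler_wpM2l // ltW.
      have a2 : e * q <= e * (- (delta / 2)) by rewrite ler_wpM2l // ltW.
      have a3 : 4 * eta * e = 2 * (e * (delta / 2)) by rewrite /eta; field.
      by rewrite a3; move: a1 a2; rewrite mulrN -mulrA; move: (e * q) (e ^+ 2 * w) (e * (delta / 2)) => *; lra.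
    apply: le_trans (ler_wpM2l (sqr_ge0 _) g1) _.
    have a4 : e ^+ 2 * (P + 1) <= e * (2 * eta).
      have -> : e * (2 * eta) = e * (delta / 2) by rewrite /eta; field.
      by rewrite expr2 -mulrA ler_wpM2l // ltW.
    have a5 : e ^+ 2 * h2 * (1 + 2 * eta * e + eta ^+ 2 * e ^+ 2) <= e ^+ 2 * P.
      have -> : e ^+ 2 * P = e ^+ 2 * h2 * (1 + 2 * eta + eta ^+ 2) by rewrite /P; ring.
      apply: ler_wpM2l; first by rewrite mulr_ge0 // ltW.
      have b1 : 2 * eta * e <= 2 * eta by rewrite ler_piMr // mulr_ge0 // ltW.
      have b2 : eta ^+ 2 * e ^+ 2 <= eta ^+ 2 by rewrite ler_piMr ?sqr_ge0 // (le_trans e2).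
      by lra.
    have a6 : 0 <= eta ^+ 2 * e ^+ 2 by rewrite mulr_ge0 ?sqr_ge0.
    have a7 : 0 <= eta ^+ 3 * e ^+ 3 by rewrite mulr_ge0 ?exprn_ge0 // ltW.
    rewrite f1.
    have -> : (1 + 2 * eta * e + eta ^+ 2 * e ^+ 2) * (1 - 4 * eta * e + e ^+ 2 * h2) =
      1 - 2 * (eta * e) - 7 * (eta ^+ 2 * e ^+ 2) - 4 * (eta ^+ 3 * e ^+ 3) +
      e ^+ 2 * h2 * (1 + 2 * eta * e + eta ^+ 2 * e ^+ 2) by ring.
    have {}a4 : e ^+ 2 * P + e ^+ 2 <= 2 * (eta * e).
      have e3 : e * (2 * eta) = 2 * (eta * e) by ring.
      by move: a4; rewrite mulrDr mulr1 e3.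
    move: a4 a5 a6 a7.
    move: (eta ^+ 2 * e ^+ 2) (eta ^+ 3 * e ^+ 3) (e ^+ 2 * h2 * _) (e ^+ 2 * P) (eta * e) e20 => *; lra.
  have [z Kz zth] := hgap th th1 (ltW qd).
  have gt1 := lt_trans zth (sep z Kz).
  have : 1 + gap < dot (y *m A) th ^+ 2.
    apply: (lt_trans gt1); rewrite expr2 ltr_pMr //.
      by apply: lt_trans (gt1); rewrite ltrDl.
    by apply: lt_trans (gt1); rewrite addr_gt0.
  apply/negP; rewrite -leNgt; apply: le_trans bnd _.
  have q2 : 2 * q <= h2 + 1.
    have := dot_ge0 (th *m H - th); rewrite dot_sqrB th1 -/q -/w; lra.
  have g2 : 1 + 2 * e * q + e ^+ 2 * w <= 1 + e * (2 * h2 + 1).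
    have a1 : e ^+ 2 * w <= e * h2.
      by apply: ler_pM => //; rewrite ltW.
    have a2 : e * (2 * q) <= e * (h2 + 1) by rewrite ler_wpM2l // ltW.
    by move: a1 a2; rewrite !mulrDr mulr1 !(mulrCA e) mulrA; move: (e * q) (e * h2) (e ^+ 2 * w) => *; lra.
  apply: le_trans (ler_wpM2l (sqr_ge0 _) g2) _.
  apply: le_trans (_ : 1 + e * M <= _); last by move: eM; rewrite mulrDr mulr1; lra.
  have g3 : (1 + eta * e) ^+ 2 <= 1 + e * (2 * eta + eta ^+ 2).
    have b2 : eta ^+ 2 * e ^+ 2 <= eta ^+ 2 * e by rewrite ler_wpM2l ?sqr_ge0.
    by rewrite f1; move: b2; rewrite mulrDr !(mulrC e) ; lra.
  have hh0 : 0 <= 2 * h2 + 1 by rewrite addr_ge0 // mulr_ge0.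
  apply: le_trans (ler_wpM2r _ g3) _; first by rewrite addr_ge0 // mulr_ge0 // ltW.
  have hE0 : 0 <= 2 * eta + eta ^+ 2 by rewrite addr_ge0 ?sqr_ge0 // mulr_ge0 // ltW.
  rewrite /M; move: hh0 hE0; set X := 2 * h2 + 1; set Y := 2 * eta + eta ^+ 2 => hh0 hE0.
  have -> : (1 + e * Y) * (1 + e * X) = 1 + e * Y + e * X + e ^+ 2 * (Y * X) by ring.
  have : e ^+ 2 * (Y * X) <= e * (Y * X) by rewrite ler_wpM2r // mulr_ge0.
  rewrite !mulrDr; move: (e ^+ 2 * (Y * X)) (e * (Y * X)) (e * X) (e * Y) => *; lra.
have := john_det_le1 uA AK; rewrite gtr0_norm ?(lt_trans ltr01) //.
by rewrite leNgt detA.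
Qed.

End improving_direction.
End john_optimality.

(** * Decomposition of the identity into contact points *)

Section caratheodory.
Context {R : realType} {d : nat}.
Variable A : set 'rV[R]_d.

Definition convex_hull_of k (q : 'rV[R]_d) : Prop :=
  exists (p : 'I_k -> R) (w : 'I_k -> 'rV[R]_d),
    [/\ forall i, 0 <= p i, \sum_i p i = 1, forall i, A (w i) & q = \sum_i p i *: w i].

(** In dimension [d], more than [d + 1] points have an affine dependency
[mu]; moving the weights along [mu] until the first one vanishes removes a
point. *)
Lemma caratheodory_step k q : (d < k)%N -> convex_hull_of k.+1 q -> convex_hull_of k q.
Proof.
move=> dk [p [w [p0 p1 wA qE]]].
(* The additional column of ones turns affine dependencies into linear ones. *)
pose W : 'M[R]_(k.+1, d + 1) := \matrix_i row_mx (w i) 1%:M.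
have [mu muK mu_n0] : exists2 mu : 'rV[R]_k.+1, mu *m W = 0 & mu != 0.
  have : kermx W != 0.
    rewrite kermx_eq0 /row_free neq_ltn; apply/orP; left.
    by apply: leq_ltn_trans (rank_leq_col W) _; rewrite addn1 ltnS.
  by move=> /rowV0Pn[mu /sub_kermxP mu0 mun]; exists mu.
have muW : mu *m W = \sum_i mu ord0 i *: row_mx (w i) 1%:M.
  by rewrite mulmx_sum_row; apply: eq_bigr => i _; rewrite rowK.
have [mu_w mu_1] : \sum_i mu ord0 i *: w i = 0 /\ \sum_i mu ord0 i = 0.
  move: muK; rewrite muW => E; split.
    have /(congr1 lsubmx) := E; rewrite linear_sum linear0 => e; rewrite -[RHS]e.
    by apply: eq_bigr => i _; rewrite linearZ /= row_mxKl.
  have /(congr1 (fun M : 'rV_(d + 1) => (rsubmx M) ord0 ord0)) := E.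
  rewrite linear0 linear_sum summxE mxE => e; rewrite -[RHS]e.
  by apply: eq_bigr => i _; rewrite linearZ /= row_mxKr !mxE eqxx mulr1.
have [i1 i1pos] : exists i, 0 < mu ord0 i.
  apply: contrapT => nopos; move/eqP: mu_n0; apply.
  have neg i : 0 <= - mu ord0 i.
    by rewrite oppr_ge0 leNgt; apply/negP => h; apply: nopos; exists i.
  have : \sum_i - mu ord0 i == 0 by rewrite sumrN mu_1 oppr0.
  rewrite psumr_eq0 // => /allP H; apply/rowP => i; rewrite mxE; apply/eqP.
  by rewrite -oppr_eq0; apply: H; rewrite mem_index_enum.
have [i0 i0pos i0min] := @Order.TotalTheory.arg_minP _ R _ i1 (fun i => 0 < mu ord0 i) (fun i => p i / mu ord0 i) i1pos.
pose t := p i0 / mu ord0 i0.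
have t0 : 0 <= t by rewrite divr_ge0 // ltW.
pose p' i := p i - t * mu ord0 i.
have p'0 i : 0 <= p' i.
  rewrite subr_ge0; case: (ltP 0 (mu ord0 i)) => mi; last first.
    by apply: le_trans (p0 i); rewrite mulr_ge0_le0.
  by rewrite -ler_pdivlMr // i0min.
have p'i0 : p' i0 = 0 by rewrite /p' /t divfK ?subrr // gt_eqF.
exists (fun j => p' (lift i0 j)), (fun j => w (lift i0 j)); split => //.
- have : \sum_i p' i = 1 by rewrite sumrB -mulr_sumr mu_1 mulr0 subr0.
  by rewrite (bigD1_ord i0) //= p'i0 add0r.
- have : \sum_i p' i *: w i = q.
    under eq_bigr do rewrite scalerBl -scalerA.
    by rewrite sumrB -scaler_sumr mu_w scaler0 subr0.
  by rewrite (bigD1_ord i0) //= p'i0 scale0r add0r => ->.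
Qed.

End caratheodory.

Section john_decomposition.
Context {R : realType} {n : nat}.
Variable K : set 'rV[R]_n.
Hypotheses (n0 : (0 < n)%N) (cK : compact K)
  (vK : convex_set (K : set (convex_lmodType 'rV[R]_n))) (hJ : john_position K).

Local Notation contact := (contact K).
Let N := (n * n).+1.
Let Z := 'rV[R]_(N * n.+1).

Let weight (z : Z) (i : 'I_N) : R := z ord0 (mxvec_index i ord0).
Let vertex (z : Z) (i : 'I_N) : 'rV[R]_n := \row_j z ord0 (mxvec_index i (lift ord0 j)).

(** A family of weights and points as one row vector, so that compactness in
finite dimension applies: row [i] of the matrix holds the [i]-th weight followed
by the [i]-th point. *)
Let encode (p : 'I_N -> R) (u : 'I_N -> 'rV[R]_n) : Z :=
  mxvec (\matrix_(i, j) if unlift ord0 j is Some j' then u i ord0 j' else p i).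

Let weight_encode p u : weight (encode p u) = p.
Proof. by apply/funext => i; rewrite /weight /encode mxvecE mxE unlift_none. Qed.

Let vertex_encode p u : vertex (encode p u) = u.
Proof. by apply/funext => i; apply/rowP => j; rewrite mxE /encode mxvecE mxE liftK. Qed.

Let configurations : set Z :=
  [set z | [/\ forall i, 0 <= weight z i, \sum_i weight z i = 1 & forall i, contact (vertex z i)]].

Let continuous_weight i : continuous (weight^~ i).
Proof. exact: coord_continuous. Qed.

Let continuous_vertex_dot i x : continuous (fun z => dot x (vertex z i)).
Proof.
rewrite (_ : (fun z => _) = fun z : Z => \sum_j x ord0 j * z ord0 (mxvec_index i (lift ord0 j))).
  apply: continuous_bigsum => j z.
  apply: (@continuousM _ _ (fun=> x ord0 j) (fun z : Z => z ord0 (mxvec_index i (lift ord0 j)))).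
    exact: cst_continuous.
  exact: coord_continuous.
by apply/funext => z; rewrite dotE; apply: eq_bigr => j _; rewrite mxE.
Qed.

Let continuous_entry i a b : continuous (fun z => vertex z i ord0 a * vertex z i ord0 b).
Proof.
rewrite (_ : (fun z => _) = fun z : Z => z ord0 (mxvec_index i (lift ord0 a)) * z ord0 (mxvec_index i (lift ord0 b))).
  move=> z; apply: (@continuousM _ _ (fun z : Z => z ord0 (mxvec_index i (lift ord0 a))));
    exact: coord_continuous.
by apply/funext => z; rewrite !mxE.
Qed.

Let closed_configurations : closed configurations.
Proof.
rewrite (_ : configurations =
  (\bigcap_(i in [set: 'I_N]) [set z | - weight z i <= 0]) `&`
  ([set z | \sum_i weight z i = 1] `&`
   \bigcap_(i in [set: 'I_N]) ([set z | \sum_a vertex z i ord0 a * vertex z i ord0 a = 1] `&`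
     \bigcap_(x in K) [set z | dot x (vertex z i) <= 1]))).
  apply: closedI.
    apply: closed_bigI => i _; apply: closed_sublevel => z.
    apply: (@continuousN _ _ _ (weight^~ i)); exact: continuous_weight.
  apply: closedI; first by apply: closed_level; apply: continuous_bigsum => i; exact: continuous_weight.
  apply: closed_bigI => i _; apply: closedI.
    by apply: closed_level; apply: continuous_bigsum => a; exact: continuous_entry.
  by apply: closed_bigI => x _; apply: closed_sublevel; exact: continuous_vertex_dot.
apply/seteqP; split => z.
  move=> [w0 w1 vc]; split; first by move=> i _ /=; rewrite oppr_le0.
  split => // i _; have [v1 vx] := vc i; split => //=.
  by rewrite -dotE.
move=> [w0 [w1 vc]]; split => //.
  by move=> i; have := w0 i I; rewrite /= oppr_le0.
by move=> i; have [v1 vx] := vc i I; split; [rewrite dotE|move=> x Kx; exact: vx].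
Qed.

Let compact_configurations : compact configurations.
Proof.
apply: (compact_in_box (M := 1)) closed_configurations _ => z [w0 w1 vc] k.
case/mxvec_indexP: k => i j; case: (unliftP ord0 j) => [j' ->|->].
  have [v1 _] := vc i.
  have -> : z ord0 (mxvec_index i (lift ord0 j')) = vertex z i ord0 j' by rewrite mxE.
  rewrite -(@ler_pXn2r _ 2) ?nnegrE // real_normK ?num_real // expr1n.
  by rewrite -v1 dot_sqr (bigD1 j') //= lerDl sumr_ge0 // => l _; exact: sqr_ge0.
rewrite ger0_norm; last exact: w0.
by rewrite -w1 (bigD1 i) //= lerDl sumr_ge0.
Qed.

(** The difference of [1 / n * Id] and a convex combination of squares of contact
points; its trace is 0 as both have trace 1. *)
Let defect (z : Z) : 'M[R]_n := n%:R^-1%:M - rank_one_sum (vertex z) (weight z).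
Let mdot (A B : 'M[R]_n) := dot (mxvec A) (mxvec B).

Let mdotE A B : mdot A B = \sum_a \sum_b A a b * B a b.
Proof.
rewrite /mdot dotE (reindex _ (curry_mxvec_bij _ _)) /= pair_big /=.
by apply: eq_bigr => -[a b] _; rewrite !mxvecE.
Qed.

Let continuous_defect : continuous (fun z => mdot (defect z) (defect z)).
Proof.
have cab a b : continuous (fun z => defect z a b).
  rewrite (_ : (fun z => _) = fun z => (n%:R^-1%:M : 'M[R]_n) a b -
     \sum_i weight z i * (vertex z i ord0 a * vertex z i ord0 b)).
    move=> z; apply: (@continuousB _ _ _ (fun=> (n%:R^-1%:M : 'M[R]_n) a b)); first exact: cst_continuous.
    apply: continuous_bigsum => i y; apply: (@continuousM _ _ (weight^~ i)).
      exact: continuous_weight.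
    exact: continuous_entry.
  apply/funext => z; rewrite /defect mxE [X in _ + X]mxE /rank_one_sum summxE; congr (_ - _).
  by apply: eq_bigr => i _; rewrite mxE mxE big_ord1 mxE.
under eq_fun do rewrite mdotE.
apply: continuous_bigsum => a; apply: continuous_bigsum => b z.
by apply: (@continuousM _ _ (fun z => defect z a b)); exact: cab.
Qed.

Let mdot_sym A B : mdot A B = mdot B A. Proof. exact: dotC. Qed.

Let mdotBr A B C : mdot A (B - C) = mdot A B - mdot A C.
Proof. by rewrite /mdot linearB /= dotBr. Qed.

Let mdotZr a A B : mdot A (a *: B) = a * mdot A B.
Proof. by rewrite /mdot linearZ /= dotZr. Qed.

Let mdot_sqrB A B : mdot (A - B) (A - B) = mdot A A - 2 * mdot A B + mdot B B.
Proof. by rewrite /mdot linearB /= dot_sqrB. Qed.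

Let quad_mdot (H : 'M[R]_n) (w : 'rV[R]_n) : mdot H (w^T *m w) = dot (w *m H) w.
Proof.
rewrite mdotE exchange_big dotE; apply: eq_bigr => b _.
rewrite mxE mulr_suml; apply: eq_bigr => a _.
by rewrite mxE big_ord1 mxE; ring.
Qed.

Let contact_squares : set 'rV[R]_(n * n) := [set mxvec (u^T *m u) | u in contact].

Let rank_one_hull (p : 'I_N -> R) (u : 'I_N -> 'rV[R]_n) :
  mxvec (rank_one_sum u p) = \sum_i p i *: mxvec ((u i)^T *m u i).
Proof. by rewrite /rank_one_sum linear_sum; apply: eq_bigr => i _; rewrite linearZ. Qed.

(** Minimize the norm of [defect] over families of [n * n + 1] contact points;
by Caratheodory's theorem this is the distance from [1 / n * Id] to the whole
convex hull. If the minimum [E] is not 0, the first-order condition at the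
minimizer says that [E] is an improving direction. *)
Theorem john_decomposition : exists (N : nat) (u : 'I_N -> 'rV[R]_n) (c : 'I_N -> R),
  [/\ forall i, 0 <= c i, forall i, contact (u i) & rank_one_sum u c = 1%:M].
Proof.
have nR : (n%:R : R) != 0 by rewrite pnatr_eq0 -lt0n.
(* Without contact points, [H = 0] would be improving. *)
have [u0 u0c] : exists u, contact u.
  apply: contrapT => noc.
  apply: (@no_improving_direction R n K n0 cK vK hJ 0 1); rewrite ?trmx0 ?mxtrace0 ?ltr01 //.
  by move=> u uc; exfalso; apply: noc; exists u.
have conf0 : configurations !=set0.
  exists (encode (fun i => (i == ord0)%:R) (fun=> u0)).
  rewrite /configurations /= weight_encode vertex_encode; split => //.
  by rewrite (bigD1 ord0) //= big1 ?addr0 // => i /negPf ->.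
have [z] := compact_EVT_min conf0 compact_configurations (continuous_subspaceT continuous_defect).
rewrite inE => -[w0 w1 vc] zmin.
set E := defect z.
have [E0|En0] := eqVneq E 0.
  exists N, (vertex z), (fun i => n%:R * weight z i); split => //.
    by move=> i; rewrite mulr_ge0.
  move: E0; rewrite /E /defect => /eqP; rewrite subr_eq0 => /eqP E0.
  transitivity (n%:R *: rank_one_sum (vertex z) (weight z)).
    by rewrite /rank_one_sum scaler_sumr; apply: eq_bigr => i _; rewrite scalerA.
  by rewrite -E0 scale_scalar_mx mulfV.
exfalso.
set q := rank_one_sum (vertex z) (weight z).
have symq : q^T = q.
  rewrite /q /rank_one_sum linear_sum; apply: eq_bigr => i _ /=.
  by rewrite linearZ /= trmx_mul trmxK.
have trq : \tr q = 1.
  rewrite /q /rank_one_sum linear_sum -w1; apply: eq_bigr => i _ /=.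
  by rewrite linearZ /= mxtrace_mulC /mxtrace big_ord1 -/(dot _ _); have [-> _] := vc i; rewrite mulr1.
have trE : \tr E = 0.
  by rewrite /E /defect -/q linearB /= trq mxtrace_scalar -[_^-1 *+ n]mulr_natr mulVf ?subrr.
apply: (@no_improving_direction R n K n0 cK vK hJ E (mdot E E)) => //.
- by rewrite /E /defect -/q linearB /= symq tr_scalar_mx.
- rewrite lt_neqAle dot_ge0 andbT eq_sym dot_eq0.
  apply: contra En0 => /eqP h; apply/eqP; apply: (can_inj mxvecK).
  by rewrite h linear0.
move=> w wc.
have Eq : mdot E q = - mdot E E.
  have -> : q = n%:R^-1%:M - E by rewrite /E /defect -/q opprB addrC subrK.
  rewrite mdotBr.
  have -> : mdot E n%:R^-1%:M = 0.
    rewrite mdotE; under eq_bigr => a _.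
      rewrite (bigD1 a) //= big1 => [|b ba]; last by rewrite [X in _ * X]mxE eq_sym (negPf ba) mulr0.
      rewrite addr0 [X in _ * X]mxE eqxx mulr1n; over.
    by rewrite -mulr_suml -/(mxtrace E) trE mul0r.
  by rewrite sub0r.
rewrite -quad_mdot -Eq -subr_ge0.
pose D := w^T *m w - q.
suff : 0 <= - (2 * mdot E D).
  have -> : mdot E D = mdot E (w^T *m w) - mdot E q by rewrite mdotBr.
  lra.
apply: (@first_order_le _ _ (mdot D D)); first exact: dot_ge0.
move=> t /andP[t0 t1].
(* The point [q + t D] on the segment from [q] to the square of [w] needs one
   more contact point than a family has, and Caratheodory's step removes it. *)
have [p' [w' [p'0 p'1 w'A qE]]] : convex_hull_of contact_squares N (mxvec (q + t *: D)).
  apply: caratheodory_step; first exact: ltnSn.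
  exists (fun i => if unlift ord0 i is Some j then (1 - t) * weight z j else t),
    (fun i => if unlift ord0 i is Some j then mxvec ((vertex z j)^T *m vertex z j) else mxvec (w^T *m w)).
  split.
  - by move=> i; case: unlift => [j|]; rewrite ?mulr_ge0 ?subr_ge0 // ltW.
  - rewrite big_ord_recl unlift_none; under eq_bigr do rewrite liftK.
    by rewrite -mulr_sumr w1 mulr1 addrC subrK.
  - by move=> i; case: unlift => [j|]; [exists (vertex z j)|exists w].
  rewrite big_ord_recl unlift_none; under eq_bigr do rewrite liftK -scalerA.
  rewrite -scaler_sumr -rank_one_hull -/q -!linearZ -linearD /=; congr mxvec.
  by rewrite /D -scalemxAr scalerBr scalerBl scale1r addrCA.
have /choice[u' Hu'] : forall i, exists u, contact u /\ mxvec (u^T *m u) = w' i.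
  by move=> i; have [u uc uE] := w'A i; exists u.
have := zmin (encode p' u'); rewrite inE.
have -> : defect (encode p' u') = E - t *: D.
  rewrite /defect weight_encode vertex_encode /E /defect -/q.
  have -> : rank_one_sum u' p' = q + t *: D.
    apply: (can_inj mxvecK); rewrite qE rank_one_hull; apply: eq_bigr => i _.
    by have [_ ->] := Hu' i.
  by rewrite opprD addrA.
have mem : configurations (encode p' u').
  rewrite /configurations /= weight_encode vertex_encode; split => // i.
  by have [] := Hu' i.
move=> /(_ mem); rewrite (mdot_sqrB E (t *: D)).
rewrite !mdotZr.
rewrite (mdot_sym (t *: D)) mdotZr => h.
by rewrite expr2; move: h; rewrite -/E; move: (mdot E E) (mdot E D) (mdot D D) => *; lra.
Qed.

End john_decomposition.

(** * Sections by subspaces *)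

Section orthogonal_projection.
Context {R : realType} {n : nat}.

Lemma gram_unitmx k (B : 'M[R]_(k, n)) : row_free B -> B *m B^T \in unitmx.
Proof.
move=> fB; rewrite -row_free_unit -kermx_eq0; apply/negP => /negP /rowV0Pn[x /sub_kermxP xG x0].
have : dot (x *m B) (x *m B) == 0.
  by rewrite /dot trmx_mul mulmxA -(mulmxA x) xG mul0mx mxE.
rewrite dot_eq0 => /eqP xB; move/negP: x0; apply; apply/eqP.
by move: fB; rewrite -kermx_eq0 => /eqP kB; apply/eqP; rewrite -submx0 -kB; apply/sub_kermxP.
Qed.

(** [B^T *m invmx (B *m B^T) *m B] for a basis matrix [B] of [F]; its trace is
that of an identity matrix of size [\dim F] by cyclicity. *)
Lemma orthogonal_projection (F : {vspace 'rV[R]_n}) : exists P : 'M[R]_n,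
  [/\ P^T = P, P *m P = P, forall x, (x \in F) = (x *m P == x) & \tr P = (\dim F)%:R].
Proof.
pose k := \dim F; pose b := vbasis F.
pose B : 'M[R]_(k, n) := \matrix_i b`_i.
have rowB i : row i B = b`_i by rewrite rowK.
have FB x : x \in F -> exists y : 'rV[R]_k, x = y *m B.
  move=> xF; exists (\row_i coord b i x); rewrite mulmx_sum_row.
  rewrite {1}(coord_vbasis xF); apply: eq_bigr => i _; by rewrite mxE rowB.
have BF y : y *m B \in F.
  rewrite mulmx_sum_row; apply: memv_suml => i _; rewrite rowB memvZ //.
  by apply: vbasis_mem; apply: mem_nth; rewrite size_tuple.
have fB : row_free B.
  rewrite -kermx_eq0; apply/rowV0P => y /sub_kermxP; rewrite mulmx_sum_row => yB.
  have /freeP fr := basis_free (vbasisP F).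
  apply/rowP => i; rewrite mxE; apply: fr.
  by rewrite -[RHS]yB; apply: eq_bigr => j _; rewrite rowB.
have uG := gram_unitmx fB; set G := B *m B^T in uG.
have symG : G^T = G by rewrite /G trmx_mul trmxK.
exists (B^T *m invmx G *m B); split.
- by rewrite !trmx_mul trmxK trmx_inv symG mulmxA.
- by rewrite !mulmxA -(mulmxA _ B) -/G mulmxKV.
- move=> x; apply/idP/eqP => [/FB[y ->]|<-]; last by rewrite !mulmxA; exact: BF.
  by rewrite !mulmxA -(mulmxA y) -/G mulmxK.
- by rewrite mxtrace_mulC mulmxA -/G mulmxV // mxtrace1.
Qed.

End orthogonal_projection.

Section interval_potential.
Context {R : realType}.

(** The logarithm of [gauss_dist a]. *)
Definition potential (a t : R) : R := - (pi * itv_dist a t ^+ 2).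

Lemma continuous_potential a : continuous (potential a).
Proof.
move=> t; apply: (@continuousN _ _ _ (fun t => pi * itv_dist a t ^+ 2)).
apply: (@continuousM _ _ (fun=> pi) (fun t => itv_dist a t ^+ 2)); first exact: cst_continuous.
apply: (@continuous_comp _ _ _ (itv_dist a) (fun s : R => s ^+ 2)); last exact: exprn_continuous.
exact: itv_dist_continuous.
Qed.

Lemma itv_dist_lipschitz (a t t' : R) : itv_dist a t <= itv_dist a t' + `|t - t'|.
Proof.
rewrite itv_dist_le ?addr_ge0 ?itv_dist_ge0 //.
have h : `|t'| <= a + itv_dist a t' by rewrite -itv_dist_le ?itv_dist_ge0.
have := ler_normD (t - t') t'; rewrite subrK; lra.
Qed.

Lemma potential_lipschitz (a L : R) : 0 <= a -> exists2 C, 0 <= C &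
  forall t t' : R, `|t| <= L -> `|t'| <= L ->
    potential a t <= potential a t' + C * `|t - t'|.
Proof.
move=> a0; have p0 := pi_ge0 R.
exists (pi * (2 * `|L|)); first by rewrite !mulr_ge0.
move=> t t' tL t'L.
have dL s : `|s| <= L -> itv_dist a s <= `|L|.
  move=> sL; rewrite itv_dist_le //; apply: le_trans sL _.
  by apply: le_trans (ler_norm _) _; rewrite lerDr.
have := dL t tL; have := dL t' t'L; have := itv_dist_lipschitz a t' t.
rewrite distrC /potential; have := itv_dist_ge0 a t; have := itv_dist_ge0 a t'.
move: (itv_dist a t) (itv_dist a t') (`|t - t'|) (normr_ge0 (t - t')) (`|L|) => d d' e e0 l d'0 d0 h1 h2 h3.
have : d' ^+ 2 - d ^+ 2 <= 2 * l * e.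
  have [dd|dd] := leP d' d.
    apply: le_trans (_ : 0 <= _); last by rewrite !mulr_ge0 // (le_trans d0).
    by rewrite subr_le0 lerXn2r ?nnegrE.
  rewrite subr_sqr mulrC; apply: ler_pM; lra.
by move=> /(ler_wpM2l p0); rewrite mulrBr !mulrA; lra.
Qed.

End interval_potential.

Section wills_upper_bound.
Context {R : realType} {n : nat}.

(** [rho] is the distance to [lambda *: S] and [z] selects a nearest point. *)
Lemma wills_distance (S : set 'rV[R]_n) (lambda : R) : compact S -> S !=set0 ->
  (exists w : {ffun 'I_n.+1 -> R}, steiner_coefficients (dilate lambda S) w) ->
  exists (rho : 'rV[R]_n -> R) (z : 'rV[R]_n -> 'rV[R]_n),
    [/\ forall x, S (z x), forall x, rho x = enorm (x - lambda *: z x),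
        measurable_fun setT (rho : rvs n -> measurableTypeR R) &
        (wills (dilate lambda S))%:E = (\int[vmeas n]_x (expR (- (pi * rho x ^+ 2)))%:E)%E].
Proof.
move=> cS S0 exw.
have /choice[z Hz] : forall x, exists z, S z /\
    forall y, S y -> enorm (x - lambda *: z) <= enorm (x - lambda *: y).
  move=> x.
  have cf : continuous (fun z : 'rV[R]_n => dot x x - (2 * lambda) * dot z x + lambda ^+ 2 * dot z z).
    move=> z; apply: (@continuousD _ _ _ (fun z => dot x x - (2 * lambda) * dot z x) (fun z => lambda ^+ 2 * dot z z)).
      apply: (@continuousB _ _ _ (fun=> dot x x) (fun z => (2 * lambda) * dot z x)); first exact: cst_continuous.
      by apply: (@continuousM _ _ (fun=> 2 * lambda) (dot^~ x)); [exact: cst_continuous|exact: continuous_dot].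
    by apply: (@continuousM _ _ (fun=> lambda ^+ 2) (fun z => dot z z)); [exact: cst_continuous|exact: continuous_dot_sqr].
  have [z] := compact_EVT_min S0 cS (continuous_subspaceT cf).
  rewrite inE => Sz zmin; exists z; split => // y Sy.
  rewrite /enorm -!dot_sqr ler_sqrt ?dot_ge0 // !dot_sqrB !dotZr !dotZl !(dotC x).
  by have := zmin y (mem_set Sy); rewrite !expr2; lra.
pose rho x := enorm (x - lambda *: z x).
have mrho : measurable_fun setT (rho : rvs n -> measurableTypeR R).
  apply: measurable_sublevel => t.
  have -> : [set x | rho x < t] = \bigcup_(y in S) [set x | enorm (x - lambda *: y) < t].
    apply/seteqP; split => x /=; first by move=> xt; exists (z x) => //; have [] := Hz x.
    move=> [y Sy /= xy]; apply: le_lt_trans xy; have [_] := Hz x; exact.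
  apply: bigcup_open => y _.
  apply: (@open_comp _ _ (fun x : 'rV[R]_n => enorm (x - lambda *: y)) [set s : R | s < t]); last exact: open_lt.
  move=> x _; rewrite (_ : (fun x => _) = Num.sqrt \o
    (fun x => dot x x - 2 * dot x (lambda *: y) + dot (lambda *: y) (lambda *: y))); last first.
    by apply/funext => s /=; rewrite -dot_sqrB dot_sqr.
  apply: continuous_comp; last exact: sqrt_continuous.
  apply: (@continuousD _ _ _ (fun x => dot x x - 2 * dot x (lambda *: y)) (fun=> dot (lambda *: y) (lambda *: y))); last exact: cst_continuous.
  apply: (@continuousB _ _ _ (fun x => dot x x) (fun x => 2 * dot x (lambda *: y))); first exact: continuous_dot_sqr.
  by apply: (@continuousM _ _ (fun=> 2) (dot^~ (lambda *: y))); [exact: cst_continuous|exact: continuous_dot].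
exists rho, z; split => //; first by move=> x; have [] := Hz x.
apply: wills_integral => //; first by move=> x; exact: enorm_ge0.
move=> t t0; rewrite dilate_ballE //; apply/seteqP; split.
  move=> _ [_ [y Sy <-] [b /= bt <-]] /=; apply: le_trans bt.
  have [_ /(_ y Sy) h] := Hz (lambda *: y + b); apply: le_trans h _.
  by rewrite addrC addKr.
move=> x /= xt; exists (lambda *: z x); first by exists (z x) => //; have [] := Hz x.
by exists (x - lambda *: z x) => //; rewrite addrC subrK.
Qed.

Lemma wills_no_steiner (M : set 'rV[R]_n) :
  ~ (exists w : {ffun 'I_n.+1 -> R}, steiner_coefficients M w) -> wills M = 0.
Proof.
move=> now; rewrite /wills big1 // => i _; rewrite /intrinsic_volume /quermassintegral.
rewrite xgetPN ?ffunE ?mulr0 ?mul0r // => w wM; apply: now; by exists w.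
Qed.

(** Also true for [w = 0], where the weight vanishes: a zero projection of a
contact point needs no separate treatment. *)
Lemma normalize_square (w : 'rV[R]_n) :
  enorm w ^+ 2 *: (((enorm w)^-1 *: w)^T *m ((enorm w)^-1 *: w)) = w^T *m w.
Proof.
have [->|w0] := eqVneq w 0; first by rewrite !scaler0 !mulmx0 scaler0.
have e0 : enorm w != 0 by rewrite /enorm sqrtr_eq0 -ltNge -dot_sqr lt_neqAle eq_sym dot_eq0 w0 dot_ge0.
have -> : ((enorm w)^-1 *: w)^T = (enorm w)^-1 *: w^T by exact: linearZ.
by rewrite -scalemxAl -scalemxAr !scalerA (_ : _ * _ = 1) ?scale1r //; field.
Qed.

Lemma normalize_dot (w : 'rV[R]_n) :
  enorm w ^+ 2 * dot ((enorm w)^-1 *: w) ((enorm w)^-1 *: w) = enorm w ^+ 2.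
Proof.
rewrite dotZl dotZr (dot_sqr w) -sqr_enorm.
by have [->|e0] := eqVneq (enorm w) 0; [rewrite expr0n mul0r|field].
Qed.

End wills_upper_bound.

Section section_integral.
Context {R : realType} {n k : nat}.
Variables (K : set 'rV[R]_n) (N : nat) (u : 'I_N -> 'rV[R]_n) (c : 'I_N -> R) (P : 'M[R]_n).
Variable lambda : R.
Hypotheses (k0 : (0 < k)%N) (n0 : (0 < n)%N)
  (c0 : forall i, 0 <= c i) (u1 : forall i, dot (u i) (u i) = 1)
  (uK : forall i x, K x -> `|dot x (u i)| <= 1)
  (c1 : rank_one_sum u c = 1%:M)
  (symP : P^T = P) (PP : P *m P = P) (trP : \tr P = k%:R) (l0 : 0 <= lambda).

Let s i := enorm (u i *m P).
Let I : finType := ('I_N + 'I_n)%type.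
Let Q : 'M[R]_n := 1%:M - P.

Let symQ : Q^T = Q. Proof. by rewrite /Q linearB /= symP trmx1. Qed.
Let QQ : Q *m Q = Q.
Proof. by rewrite /Q mulmxBl mul1mx mulmxBr mulmx1 PP subrr subr0. Qed.

(** The projected contact points decompose [P] and the rows of [Q] decompose
[Q]; the weights [wt] are those for the normalized vectors [v]. *)
Let vec (i : I) : 'rV[R]_n := match i with inl i => u i *m P | inr j => row j Q end.
Let v (i : I) : 'rV[R]_n := (enorm (vec i))^-1 *: vec i.
Let wt (i : I) : R := match i with inl i => c i * s i ^+ 2 | inr j => enorm (row j Q) ^+ 2 end.
Let a (i : I) : R := match i with inl i => lambda / s i | inr j => 0 end.

Let s_ge0 i : 0 <= s i. Proof. exact: enorm_ge0. Qed.

Let wt0 i : 0 <= wt i.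
Proof. by case: i => i; rewrite /wt; [rewrite mulr_ge0 ?sqr_ge0|exact: sqr_ge0]. Qed.

Let a0 i : 0 <= a i.
Proof. by case: i => i //; rewrite /a divr_ge0 ?s_ge0. Qed.

Let sum_P : \sum_i c i *: ((u i *m P)^T *m (u i *m P)) = P.
Proof.
have -> : \sum_i c i *: ((u i *m P)^T *m (u i *m P)) = P^T *m rank_one_sum u c *m P.
  rewrite /rank_one_sum mulmx_sumr mulmx_suml; apply: eq_bigr => i _.
  by rewrite -scalemxAr -scalemxAl trmx_mul !mulmxA.
by rewrite c1 mulmx1 symP PP.
Qed.

Let frame : rank_one_sum v wt = 1%:M.
Proof.
rewrite /rank_one_sum big_sumType /=.
have -> : \sum_i wt (inl i) *: ((v (inl i))^T *m v (inl i)) = P.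
  rewrite -[RHS]sum_P; apply: eq_bigr => i _.
  by rewrite /wt /v /s -scalerA normalize_square.
have -> : \sum_j wt (inr j) *: ((v (inr j))^T *m v (inr j)) = Q.
  have Qs x y : Q x y = Q y x by rewrite -[in LHS]symQ [LHS]mxE.
  rewrite -[RHS]QQ.
  transitivity (\sum_j (row j Q)^T *m row j Q).
    by apply: eq_bigr => j _; rewrite /wt /v normalize_square.
  apply/matrixP => x y; rewrite summxE [RHS]mxE; apply: eq_bigr => j _.
  move: Qs; generalize Q => Q' Qs; by rewrite !mxE big_ord1 !mxE Qs.
by rewrite /Q addrC subrK.
Qed.

Let wt_unit i : wt i * dot (v i) (v i) = wt i.
Proof.
case: i => i; rewrite /wt /v; last exact: normalize_dot.
by rewrite -mulrA /s normalize_dot.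
Qed.

(** The identity expands [|x - lambda y| ^ 2] over the frame. Since [y] is
fixed by [P], its coordinate along [u i *m P] is the one along [u i], which is at
most 1, and its coordinates along the rows of [Q] vanish. *)
Lemma projected_distance x y : K y -> y *m P = y ->
  \sum_i wt i * itv_dist (a i) (dot x (v i)) ^+ 2 <= enorm (x - lambda *: y) ^+ 2.
Proof.
move=> Ky yP; set e := x - lambda *: y.
rewrite sqr_enorm -dot_sqr (dot_decomposition e e frame).
apply: ler_sum => i _; rewrite -[leRHS]mulrA (dotC (v i) e) -expr2; apply: ler_wpM2l => //.
rewrite -[leRHS]real_normK ?num_real // lerXn2r ?nnegrE ?itv_dist_ge0 //.
rewrite itv_dist_le //.
have -> : dot x (v i) = lambda * dot y (v i) + dot e (v i).
  by rewrite /e dotBl dotZl addrC subrK.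
apply: le_trans (ler_normD _ _) _; rewrite lerD2r normrM (ger0_norm l0).
case: i => i; rewrite /a /v dotZr.
  rewrite normrM ger0_norm ?invr_ge0 ?enorm_ge0 // mulrCA -/(s i) mulrC -mulrA.
  apply: ler_wpM2l => //; rewrite ler_piMl ?invr_ge0 //.
  have -> : dot y (u i *m P) = dot y (u i) by rewrite /dot trmx_mul symP mulmxA yP.
  exact: uK.
have -> : dot y (vec (inr i)) = (y *m Q) ord0 i.
  by rewrite dotE mxE; apply: eq_bigr => j _; congr (_ * _); rewrite mxE -{1}symQ mxE.
by rewrite /Q mulmxBr mulmx1 yP subrr mxE mulr0 normr0 mulr0.
Qed.

Let sum_wt : \sum_i wt (inl i) = k%:R.
Proof.
rewrite -trP -sum_P linear_sum; apply: eq_bigr => i _ /=.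
by rewrite linearZ /= mxtrace_mulC /mxtrace big_ord1 -/(dot _ _) dot_sqr -sqr_enorm.
Qed.

Let sum_c : \sum_i c i = n%:R.
Proof.
rewrite -(@mxtrace1 R n) -c1 /rank_one_sum linear_sum; apply: eq_bigr => i _ /=.
by rewrite linearZ /= mxtrace_mulC /mxtrace big_ord1 -/(dot _ _) u1 mulr1.
Qed.

(** Concavity of [ln] at [m = 1 + 2 lambda sqrt (n / k)], which is an upper
bound of the average of the [1 + 2 a_i]. *)
Lemma sum_log_bound :
  \sum_i wt i * ln (1 + 2 * a i) <= k%:R * ln (1 + 2 * (lambda * Num.sqrt (n%:R / k%:R))).
Proof.
have kR : 0 < k%:R :> R by rewrite ltr0n.
have nR : 0 < n%:R :> R by rewrite ltr0n.
set sg := Num.sqrt (n%:R / k%:R).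
have sg0 : 0 < sg by rewrite sqrtr_gt0 divr_gt0.
have sgE : k%:R * sg ^+ 2 = n%:R.
  by rewrite sqr_sqrtr ?divr_ge0 ?ltW // mulrC divfK // gt_eqF.
set m := 1 + 2 * (lambda * sg).
have m0 : 0 < m by rewrite ltr_wpDr // !mulr_ge0 // ltW.
rewrite big_sumType /= [X in _ + X]big1 ?addr0; last first.
  by move=> j _; rewrite mulr0 addr0 ln1 mulr0.
(* The tangent of [ln] at [m]. *)
apply: (@le_trans _ _ (\sum_i c i * s i ^+ 2 * (ln m + ((1 + 2 * (lambda / s i)) / m - 1)))).
  apply: ler_sum => i _; apply: ler_wpM2l; first exact: (wt0 (inl i)).
  apply: ln_le_tangent => //; have := a0 (inl i); rewrite /a; lra.
have -> : \sum_i c i * s i ^+ 2 * (ln m + ((1 + 2 * (lambda / s i)) / m - 1)) =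
   (\sum_i wt (inl i)) * (ln m - 1 + m^-1) + 2 * lambda / m * \sum_i c i * s i.
  rewrite mulr_suml mulr_sumr -big_split; apply: eq_bigr => i _ /=.
  have [->|si] := eqVneq (s i) 0; first by rewrite expr0n !(mulr0, mul0r) add0r.
  by field; rewrite si gt_eqF.
rewrite sum_wt.
(* [k sg = sqrt (n k)]: the Cauchy-Schwarz inequality for the weights [c], in
   the form of the arithmetic-geometric mean inequality for [sg s_i] and 1. *)
have cs : \sum_i c i * s i <= k%:R * sg.
  apply: (@le_trans _ _ (\sum_i (c i * s i ^+ 2 * (sg / 2) + c i * (sg^-1 / 2)))).
    apply: ler_sum => i _.
    have -> : c i * s i ^+ 2 * (sg / 2) + c i * (sg^-1 / 2) =
      c i * s i + c i * ((sg * s i - 1) ^+ 2 * (sg^-1 / 2)).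
      by field; rewrite gt_eqF.
    rewrite lerDl mulr_ge0 // mulr_ge0 ?sqr_ge0 // divr_ge0 // invr_ge0; exact: ltW.
  rewrite big_split -!mulr_suml /= sum_wt sum_c -sgE le_eqVlt; apply/orP; left.
  by apply/eqP; field; rewrite gt_eqF.
have -> : k%:R * (ln m - 1 + m^-1) + 2 * lambda / m * \sum_i c i * s i =
  k%:R * ln m + (k%:R * (1 - m) + 2 * lambda * \sum_i c i * s i) / m.
  by field; rewrite gt_eqF.
rewrite gerDl pmulr_lle0 ?invr_gt0 //.
have -> : k%:R * (1 - m) = - (2 * lambda * (k%:R * sg)) by rewrite /m; ring.
by rewrite addrC subr_le0 ler_wpM2l // mulr_ge0.
Qed.

Lemma projected_integral_bound (rho : rvs n -> measurableTypeR R) (z : 'rV[R]_n -> 'rV[R]_n) :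
  measurable_fun setT rho -> (forall x, rho x = enorm (x - lambda *: z x)) ->
  (forall x, K (z x) /\ z x *m P = z x) ->
  (\int[vmeas n]_x (expR (- (pi * rho x ^+ 2)))%:E <=
   ((1 + 2 * (lambda * Num.sqrt (n%:R / k%:R))) ^+ k)%:E)%E.
Proof.
move=> mrho rhoE Kz.
have m0 : 0 < 1 + 2 * (lambda * Num.sqrt (n%:R / k%:R)).
  by rewrite ltr_wpDr // !mulr_ge0 // sqrtr_ge0.
have mass0 i : 0 < 1 + 2 * a i by have := a0 i; lra.
have lip (L : R) i : exists2 C, 0 <= C & forall t t' : R,
    `|t| <= L -> `|t'| <= L -> potential (a i) t <= potential (a i) t' + C * `|t - t'|.
  exact: potential_lipschitz.
have BL := brascamp_lieb wt0 frame wt_unit (fun i => @continuous_potential R (a i)) mass0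
  (fun i => integral_gauss_dist (a0 i)) lip.
apply: (@le_trans _ _ (expR (\sum_i wt i * ln (1 + 2 * a i)))%:E); last first.
  rewrite lee_fin; apply: (@le_trans _ _ (expR (k%:R * ln (1 + 2 * (lambda * Num.sqrt (n%:R / k%:R)))))).
    by rewrite ler_expR; exact: sum_log_bound.
  by rewrite mulrC expRM_natr lnK.
apply: le_trans BL; apply: ge0_le_integral => //.
- apply/measurable_EFinP; apply: (measurableT_comp (@measurable_expR R)).
  apply: (measurableT_comp (@oppr_measurable R setT)).
  by apply: measurable_funM => //; apply: measurable_funX.
- apply/measurable_EFinP; apply: (measurableT_comp (@measurable_expR R)).
  apply: measurable_sum => i; apply: measurable_funM => //.
  apply: measurableT_comp (measurable_dot (v i)).
  by apply: continuous_measurable_fun; exact: continuous_potential.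
move=> x _; rewrite lee_fin ler_expR.
have [Kzx zP] := Kz x.
have := projected_distance x Kzx zP; rewrite -rhoE => h.
have -> : \sum_i wt i * potential (a i) (dot x (v i)) =
    - (pi * \sum_i wt i * itv_dist (a i) (dot x (v i)) ^+ 2).
  by rewrite mulr_sumr -sumrN; apply: eq_bigr => i _; rewrite /potential; ring.
by rewrite lerN2 ler_wpM2l // pi_ge0.
Qed.

End section_integral.

Theorem theorem1p5 (R : realType) (n k : nat) (hk : (1 <= k <= n)%N)
    (K : set 'rV[R]_n) (hK : convex_body K) (hsym : centrally_symmetric K)
    (hJ : john_position K)
    (F : {vspace 'rV[R]_n}) (hF : \dim F = k)
    (lambda : R) (hlambda : 0 <= lambda) :
  wills (dilate lambda (K `&` [set` F]))
  <= wills (dilate (lambda * Num.sqrt (n%:R / k%:R)) (linf_ball R k)).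
Proof.
have /andP[k0 kn] := hk; have n0 : (0 < n)%N by exact: leq_trans kn.
have [cK vK _] := hK.
have sg0 : 0 <= lambda * Num.sqrt (n%:R / k%:R) by rewrite mulr_ge0 // sqrtr_ge0.
rewrite (wills_cube k sg0).
have [exw|now] := pselect (exists w : {ffun 'I_n.+1 -> R},
    steiner_coefficients (dilate lambda (K `&` [set` F])) w); last first.
  by rewrite (wills_no_steiner now) exprn_ge0 // addr_ge0 // mulr_ge0.
have [P [symP PP FP trP]] := orthogonal_projection F.
have [N [u [c [c0 uc c1]]]] := john_decomposition n0 cK vK hJ.
have K0 : K 0 by apply: (john_ball hJ); rewrite /dot mul0mx mxE.
have cS : compact (K `&` [set` F]).
  apply: compact_closedI => //.
  (* A subspace is closed: it is the zero set of [dot (x *m (1%:M - P)) x], the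
     squared distance to it. *)
  have -> : [set` F] = [set x | dot (x *m (1%:M - P)) x = 0].
    apply/seteqP; split => x /=; rewrite FP mulmxBr mulmx1.
      by move=> /eqP ->; rewrite subrr /dot mul0mx mxE.
    have -> : dot (x - x *m P) x = dot (x - x *m P) (x - x *m P).
      rewrite [RHS]dotBr [X in _ = _ - X](_ : _ = 0) ?subr0 //.
      by rewrite /dot trmx_mul symP mulmxA mulmxBl -mulmxA PP subrr mul0mx mxE.
    by move=> /eqP; rewrite dot_eq0 subr_eq0 eq_sym.
  apply: closed_level; exact: (@continuous_quad R n (1%:M - P)).
have S0 : (K `&` [set` F]) !=set0 by exists 0; split => //=; exact: mem0v.
have [rho [z [zS rhoE mrho wE]]] := wills_distance cS S0 exw.
rewrite -lee_fin wE.
apply: (projected_integral_bound (K := K) k0 n0 c0 _ _ c1 symP PP _ hlambda mrho rhoE).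
- by move=> i; have [] := uc i.
- move=> i x Kx; rewrite ler_norml; have [_ ucK] := uc i.
  have KNx : K (- x) by rewrite hsym; exists x.
  by rewrite (ucK x Kx) andbT lerNl -dotNl ucK.
- by rewrite trP hF.
- by move=> x; have [Kz] := zS x; rewrite /= FP => /eqP.
Qed.
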